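(* Let $M$ be a (connected) complex projective manifold and let $\mathcal{H}$ be the unitary flat vector bundle on $M$ associated to a representation $\rho : \pi_1(M) \to U(r,\mathbb{C})$. Then $\mathcal{H}$ is nef; moreover, $\mathcal{H}$ is semi-ample if and only if the image $\mathrm{Im}(\rho)$ is finite.
   Context: The unitary flat bundle associated to $\rho:\pi_1(M)\to U(r,\mathbb{C})$ is the holomorphic vector bundle $\mathcal{H} = (\tilde M\times\mathbb{C}^r)/\pi_1(M)$, where $\tilde M$ is the universal cover of $M$ and $\pi_1(M)$ acts on $\mathbb{C}^r$ via $\rho$. For a vector bundle $V$ let $\mathbb{P}:=\mathrm{Proj}(V)=\mathbb{P}(V^\vee)$ with projection $p$ to $M$ and tautological divisor $H$, so that $p_*\mathcal{O}_{\mathbb{P}}(H)=V$. $V$ is nef if $H$ is nef on $\mathbb{P}$, and semi-ample if for some positive integer $m$ the line bundle $\mathcal{O}_{\mathbb{P}}(mH)$ is spanned by global sections. *)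

(* Defs.v *)
(* Holomorphy is Frechet differentiability over the complex
   field: [differentiable] is taken between normed modules over [Cx R], so the
   differentials are complex linear. *)
From HB Require Import structures.
From mathcomp Require Import all_boot all_order all_algebra.
From mathcomp Require Import all_classical all_reals all_analysis.
From mathcomp.real_closed Require Import complex.

Set Implicit Arguments.
Unset Strict Implicit.
Unset Printing Implicit Defensive.

Import Order.TTheory GRing.Theory Num.Theory numFieldNormedType.Exports.

Local Open Scope classical_set_scope.
Local Open Scope ring_scope.

Definition Cx (R : realType) : numClosedFieldType := (R[i])%C.

(* [chart_inv i] is the inverse of [chart i] on [chart i @` chart_dom i];
   its values elsewhere are irrelevant. *)
Record cmanifold (R : realType) (n : nat) := CManifold {
  carrier :> topologicalType;
  chart_index : Type;
  chart_dom : chart_index -> set carrier;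
  chart : chart_index -> carrier -> 'rV[Cx R]_n;
  chart_inv : chart_index -> 'rV[Cx R]_n -> carrier;
  cmanifold_hausdorff : hausdorff_space carrier;
  cmanifold_second_countable : @second_countable carrier;
  chart_cover : forall x, exists i, chart_dom i x;
  open_chart_dom : forall i, open (chart_dom i);
  open_chart_image : forall i, open (chart i @` chart_dom i);
  chartK : forall i x, chart_dom i x -> chart_inv i (chart i x) = x;
  chart_continuous : forall i x, chart_dom i x ->
    {for x, continuous (chart i)};
  chart_inv_continuous : forall i x, chart_dom i x ->
    {for chart i x, continuous (chart_inv i)};
  transition_holomorphic : forall i j x, chart_dom i x -> chart_dom j x ->
    differentiable (chart j \o chart_inv i) (chart i x)
}.

Section Holomorphy.
Context {R : realType}.
Local Notation C := (Cx R).

Definition holo_fun_at {n} {X : cmanifold R n} {W : normedModType C}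
    (f : X -> W) (x : X) : Prop :=
  forall i, chart_dom i x -> differentiable (f \o chart_inv i) (chart i x).

Definition holo_map_at {n p} {X : cmanifold R n} {Y : cmanifold R p}
    (f : X -> Y) (x : X) : Prop :=
  {for x, continuous f} /\
  forall i j, chart_dom i x -> chart_dom j (f x) ->
    differentiable (chart j \o f \o chart_inv i) (chart i x).

(* joint holomorphy on the product Y x C^r *)
Definition holo_fun2_at {n r} {Y : cmanifold R n} (F : Y -> 'rV[C]_r -> C)
    (y : Y) (l : 'rV[C]_r) : Prop :=
  forall i, chart_dom i y ->
    differentiable (fun p : 'rV[C]_n * 'rV[C]_r => F (chart_inv i p.1) p.2)
                   (chart i y, l).

(* An injective holomorphic immersion x |-> [Phi x] into the projective space
   P^N(C), given by homogeneous coordinates.  [Phi] itself need not be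
   continuous; holomorphy and the immersion condition are those of local
   holomorphic lifts F of [Phi].  The tangent space of P^N at [F x] is the
   quotient of C^(N+1) by the line C F(x). *)
Definition projective_embedding {n N} {M : cmanifold R n}
    (Phi : M -> 'rV[C]_N.+1) : Prop :=
  [/\ forall x, Phi x != 0,
      forall x y (c : C), Phi x = c *: Phi y -> x = y &
      forall x, exists F : M -> 'rV[C]_N.+1,
        (\forall y \near x,
           holo_fun_at F y /\ exists2 c : C, c != 0 & F y = c *: Phi y) /\
        forall i, chart_dom i x -> forall (v : 'rV[C]_n) (a : C),
          'd (F \o chart_inv i) (chart i x) v = a *: F x -> v = 0].

Definition projective_manifold {n} (M : cmanifold R n) : Prop :=
  [/\ [set: M] !=set0, connected [set: M], compact [set: M] &
      exists (N : nat) (Phi : M -> 'rV[C]_N.+1), projective_embedding Phi].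

End Holomorphy.

Section FundamentalGroup.
Context {R : realType}.
Implicit Type X : topologicalType.

(* Paths are functions on R of which only the restriction to [0, 1] matters. *)
Definition is_path {X} (g : R -> X) (x y : X) : Prop :=
  [/\ {within `[0, 1], continuous g}, g 0 = x & g 1 = y].

Definition path_homotopic {X} (f g : R -> X) : Prop :=
  exists H : R * R -> X,
    [/\ {within `[0, 1]%classic `*` `[0, 1]%classic, continuous H},
        forall t, t \in `[0, 1] -> H (0, t) = f t /\ H (1, t) = g t &
        forall s, s \in `[0, 1] -> H (s, 0) = f 0 /\ H (s, 1) = f 1].

Definition path_concat {X} (f g : R -> X) : R -> X :=
  fun t => if t <= 2^-1 then f (2 * t) else g (2 * t - 1).

Definition simply_connected X : Prop :=
  (forall x y : X, exists g : R -> X, is_path g x y) /\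
  (forall (x : X) (g : R -> X), is_path g x x -> path_homotopic g (cst x)).

(* A homomorphism from pi_1(X, x0) to U(r), given as a function on loops that
   is constant on homotopy classes; its values on non-loops are irrelevant. *)
Record unitary_rep (X : topologicalType) (x0 : X) (r : nat) := UnitaryRep {
  rep :> (R -> X) -> 'M[Cx R]_r;
  rep_unitary : forall g, is_path g x0 x0 -> rep g \is unitarymx;
  rep_homotopic : forall f g, is_path f x0 x0 -> is_path g x0 x0 ->
    path_homotopic f g -> rep f = rep g;
  rep_concat : forall f g, is_path f x0 x0 -> is_path g x0 x0 ->
    rep (path_concat f g) = rep f *m rep g
}.

Definition rep_image {X} {x0 : X} {r} (rho : unitary_rep x0 r) :
    set 'M[Cx R]_r :=
  rho @` [set g | is_path g x0 x0].

End FundamentalGroup.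

Section UniversalCovering.
Context {R : realType} {n : nat} {Mt M : cmanifold R n}.

(* Over an evenly covered U, the sheets are the images of the sections s k. *)
Definition holo_covering (q : Mt -> M) : Prop :=
  [/\ forall y, holo_map_at q y,
      forall x, exists y, q y = x &
      forall x, exists (U : set M) (K : Type) (s : K -> M -> Mt),
        [/\ open U /\ U x,
            forall k, open (s k @` U),
            forall k z, U z -> q (s k z) = z /\ holo_map_at (s k) z,
            forall k l z, U z -> s k z = s l z -> k = l &
            forall y, U (q y) -> exists k, y = s k (q y)]].

Definition universal_covering (q : Mt -> M) : Prop :=
  holo_covering q /\ @simply_connected R Mt.

Definition deck_transformation (q : Mt -> M) (T : Mt -> Mt) : Prop :=
  exists T' : Mt -> Mt,
    [/\ cancel T T', cancel T' T, continuous T, continuous T' &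
        forall y, q (T y) = q y].

End UniversalCovering.

(* Presentation of a holomorphic vector bundle V of rank r as a quotient
   (Y x C^r)/~ of a trivial bundle: (y, u) ~ (y', u') iff u' = A u for some A
   with [glue y y' A].  It is meant for relations [glue] making ~ an equivalence
   relation whose quotient is a bundle, such as the orbit relation of a free and
   properly discontinuous group action on Y lifted linearly to Y x C^r. *)
Record bundle_presentation (R : realType) (n r : nat) := BundlePresentation {
  bcover : cmanifold R n;
  glue : bcover -> bcover -> 'M[Cx R]_r -> Prop
}.

(* The unitary flat bundle (Mt x C^r)/pi_1(M, q y0).  The class of a loop g
   acts on Mt by the deck transformation T mapping y0 to the end point of the
   lift gt of g starting at y0, and on C^r by rho g. *)
Definition flat_bundle (R : realType) (n r : nat) (Mt M : cmanifold R n)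
    (q : Mt -> M) (x0 : M) (y0 : Mt) (rho : @unitary_rep R M x0 r) :
    bundle_presentation R n r :=
  @BundlePresentation R n r Mt (fun y y' A =>
    exists (T : Mt -> Mt) (gt : R -> Mt),
      [/\ deck_transformation q T, is_path gt y0 (T y0),
          y' = T y & A = rho (q \o gt)]).

Section ProjectiveBundle.
Context {R : realType} {n r : nat}.
Variable V : bundle_presentation R n r.
Local Notation C := (Cx R).
Local Notation Y := (bcover V).

(* P = Proj(V) = P(V^dual) is the quotient of Y x (C^r)^dual \ 0 by gluing and
   by scalars.  Covectors are rows: the gluing (y, u) ~ (y', A u) of V
   identifies (y, l A) with (y', l).  A point of P is represented by the set of
   all pairs (y, l) in its class. *)
Definition Proj_point (e : Y * 'rV[C]_r) : set (Y * 'rV[C]_r) :=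
  [set e' | exists (A : 'M[C]_r) (c : C),
     [/\ glue e.1 e'.1 A, c != 0 & e.2 = c *: (e'.2 *m A)]].

(* Global sections of O_P(mH): functions on the cone V^dual \ 0, homogeneous of
   degree m along the fibres; for m = 1, a section u of V gives l |-> l(u). *)
Definition global_section (m : nat) (F : Y -> 'rV[C]_r -> C) : Prop :=
  [/\ forall y l, l != 0 -> holo_fun2_at F y l,
      forall y l (c : C), l != 0 -> c != 0 -> F y (c *: l) = c ^+ m * F y l &
      forall y y' A l, glue y y' A -> l != 0 -> F y (l *m A) = F y' l].

Definition semi_ample : Prop :=
  exists m : nat, (0 < m)%N /\
    forall (y : Y) (l : 'rV[C]_r), l != 0 ->
      exists2 F, global_section m F & F y l != 0.

Section Curves.
Variable S : cmanifold R 1.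

Definition local_lift (f : S -> set (Y * 'rV[C]_r)) (e : S -> Y * 'rV[C]_r)
    (s : S) : Prop :=
  \forall z \near s,
    [/\ holo_map_at (fun w => (e w).1) z, holo_fun_at (fun w => (e w).2) z,
        (e z).2 != 0 & f z = Proj_point (e z)].

Definition holo_to_Proj (f : S -> set (Y * 'rV[C]_r)) : Prop :=
  forall s, exists e, local_lift f e s.

(* An irreducible compact curve in P, given by its normalization: S is a compact
   Riemann surface and f is injective off a finite set. *)
Definition Proj_curve (f : S -> set (Y * 'rV[C]_r)) : Prop :=
  [/\ [set: S] !=set0 /\ connected [set: S], compact [set: S],
      holo_to_Proj f &
      exists2 B : set S, finite_set B &
        forall s t, ~ B s -> ~ B t -> f s = f t -> s = t].

Definition mero_order (g : S -> C) (s : S) (k : int) : Prop :=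
  exists2 i, chart_dom i s & exists h : S -> C,
    [/\ \forall z \near s, holo_fun_at h z, h s != 0 &
        \forall z \near s^',
          g z = (chart i z 0 0 - chart i s 0 0) ^ k * h z].

(* A nonzero meromorphic section sigma of f^* O_P(H), of divisor D.  The fibre
   of f^* O_P(H) over z consists of the functions of degree 1 on the class f z;
   only the values sigma z e with e in f z matter. *)
Definition mero_section_divisor (f : S -> set (Y * 'rV[C]_r))
    (sigma : S -> Y * 'rV[C]_r -> C) (D : S -> int) : Prop :=
  [/\ forall z y l (c : C), f z (y, l) -> c != 0 ->
        sigma z (y, c *: l) = c * sigma z (y, l),
      forall z y y' A l, glue y y' A -> f z (y', l) ->
        sigma z (y, l *m A) = sigma z (y', l),
      forall s e, local_lift f e s ->
        mero_order (fun z => sigma z (e z)) s (D s) &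
      finite_set [set s | D s != 0]].

(* d is the intersection number H . C = deg f^* O_P(H): the degree of the
   divisor of a nonzero meromorphic section (one exists, and the degree does not
   depend on it). *)
Definition H_degree (f : S -> set (Y * 'rV[C]_r)) (d : int) : Prop :=
  exists sigma D, mero_section_divisor f sigma D /\
    d = \sum_(s \in [set: S]) D s.

End Curves.

Definition nef : Prop :=
  forall (S : cmanifold R 1) (f : S -> set (Y * 'rV[C]_r)), Proj_curve f ->
    forall d : int, H_degree f d -> 0 <= d.

End ProjectiveBundle.

(* Main.v *)
Require Import Defs.
From mathcomp Require Import all_boot all_order all_algebra.
From mathcomp Require Import all_classical all_reals all_analysis.
From mathcomp.real_closed Require Import complex.
From mathcomp Require Import ring lra.

(** Finite image implies semi-ample: the product over the finite group Im(rho) of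
    the translates of a linear form is an invariant form of positive degree, and
    the linear form can be chosen so that none of its translates vanishes at a
    given covector.

    Semi-ample implies finite image: on the universal cover, a section of O(mH) is
    a function F(y, l) with F(y, l A) = F(y', l).  Since M and the closure of
    the orbit of l under Im(rho) are compact, |F| attains its maximum, and the
    maximum principle makes F(y, l) independent of y.  So F(l A) = F(l) for A in
    Im(rho); if l A = a (l B) with A, B in Im(rho), then a^m = 1.  Hence the
    elements of the bounded set Im(rho) are uniformly separated, and Im(rho) is
    finite.

    Nefness: for a curve S with a lift l and a meromorphic section sigma of
    divisor D, the function |l|^2 / |sigma(l)|^2 is well defined on S because
    rho is unitary, and its logarithm is subharmonic up to the singularities
    prescribed by D.  The divisors E carrying such a function form a cone, which
    contains no nonzero divisor E <= 0 by the maximum principle.  By a Harnack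
    chain argument it contains every rational divisor c p - q with c > 1, and
    combining these with D would contradict the maximum principle if deg D were
    negative.

    No integral is used: Goursat's lemma is proved for dyadic midpoint sums, the
    mean value property for averages over roots of unity, and subharmonicity of
    log w is replaced by the existence of a holomorphic h with |h| <= w^m and
    equality at the given point. *)

Set Implicit Arguments.
Unset Strict Implicit.
Unset Printing Implicit Defensive.

Import Order.TTheory GRing.Theory Num.Theory numFieldNormedType.Exports.

Local Open Scope classical_set_scope.
Local Open Scope ring_scope.

(** * Maximum modulus principle *)

Section Modulus.
Import Normc.
Context {R : realType}.
Local Notation C := (Cx R).

(** Neither residues nor Green functions are available to control the degree of a divisor. Weights
    with prescribed singularities are only built in a coordinate disc, as [kappa |Q|^B / |P|^A] with
    P and Q products of coordinate differences. If such a weight is greater than 1 on an inner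
    circle and less than 1 on an outer one, its maximum with 1 extends by 1 to the whole surface,
    since maxima preserve the local support condition. Crossing 1 in this direction with one point
    of multiplicity A against one of multiplicity B requires A > B; this is the origin of the strict
    inequality c > 1.

    To bring the constant down to any c > 1, fix p and let b(q) be the infimum of the c for which c
    p - q lies in the cone. Chains of discs and compactness bound b. Poles at roots of unity on a
    circle show that b(q) is at most the mean of b over circles around q, so the points where b
    reaches its supremum form an open and closed set. If the supremum exceeded 1, this set would
    contain p, whereas b(p) <= 1 because p - p = 0 lies in the cone. *)

Definition cmod (z : C) : R := normc (z : R[i]).
(** The norm of [C] takes its values in [C]; estimates use the real-valued [cmod], and [r2c] is the
    way back. *)
Definition r2c (x : R) : C := (x%:C)%C.

Lemma normE (z : C) : `|z| = r2c (cmod z). Proof. by []. Qed.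
Lemma cmod0 : cmod 0 = 0. Proof. exact: normc0. Qed.
Lemma cmod1 : cmod 1 = 1. Proof. exact: normc1. Qed.
Lemma cmodM (x y : C) : cmod (x * y) = cmod x * cmod y.
Proof. exact: normcM. Qed.
Lemma cmodD (x y : C) : cmod (x + y) <= cmod x + cmod y.
Proof. exact: le_normcD. Qed.
Lemma cmodN (x : C) : cmod (- x) = cmod x.
Proof. exact: normcN. Qed.
Lemma cmodV (x : C) : cmod x^-1 = (cmod x)^-1.
Proof. exact: normcV. Qed.
Lemma cmod_ge0 (x : C) : 0 <= cmod x.
Proof. by case: x => a b; exact: sqrtr_ge0. Qed.
Lemma cmod_eq0 (x : C) : (cmod x == 0) = (x == 0).
Proof. by apply/eqP/eqP => [/eq0_normc//|->]; exact: cmod0. Qed.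
Lemma cmod_gt0 (x : C) : (0 < cmod x) = (x != 0).
Proof. by rewrite lt_def cmod_ge0 andbT cmod_eq0. Qed.
Lemma cmodB (x y : C) : cmod (x - y) = cmod (y - x).
Proof. by rewrite -cmodN opprB. Qed.
Lemma cmodBD (x y : C) : cmod (x - y) <= cmod x + cmod y.
Proof. by rewrite -(cmodN y); exact: cmodD. Qed.
Lemma cmod_tri (y x z : C) : cmod (x - z) <= cmod (x - y) + cmod (y - z).
Proof. by rewrite -[X in cmod X](subrKA y) cmodD. Qed.
Lemma cmod_leB (x y : C) : cmod x - cmod y <= cmod (x - y).
Proof. by rewrite lerBlDr -{1}(subrK y x) cmodD. Qed.
Lemma cmodX (x : C) n : cmod (x ^+ n) = cmod x ^+ n.
Proof.
elim: n => [|n IH]; first by rewrite !expr0 cmod1.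
by rewrite !exprS cmodM IH.
Qed.
Lemma cmod_sum (I : Type) (s : seq I) (P : pred I) (F : I -> C) :
  cmod (\sum_(i <- s | P i) F i) <= \sum_(i <- s | P i) cmod (F i).
Proof.
elim/big_rec2: _ => [|i y x _ h]; first by rewrite cmod0.
by apply: le_trans (cmodD _ _) _; rewrite lerD2l.
Qed.
Lemma cmod_r2c (x : R) : cmod (r2c x) = `|x|.
Proof. by rewrite /cmod /= expr0n /= addr0 sqrtr_sqr. Qed.
Lemma cmod_nat n : cmod n%:R = n%:R.
Proof.
have -> : (n%:R : C) = r2c n%:R by rewrite /r2c rmorph_nat.
by rewrite cmod_r2c ger0_norm.
Qed.
Lemma Re_le_cmod (z : C) : complex.Re z <= cmod z.
Proof.
case: z => a b; rewrite /cmod /=.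
apply: le_trans (ler_norm a) _; rewrite -sqrtr_sqr ler_wsqrtr//.
by rewrite lerDl sqr_ge0.
Qed.
Lemma normRe_le_cmod (z : C) : `|complex.Re z| <= cmod z.
Proof.
case: z => a b; rewrite /cmod /=.
by rewrite -sqrtr_sqr ler_wsqrtr// lerDl sqr_ge0.
Qed.
Lemma normIm_le_cmod (z : C) : `|complex.Im z| <= cmod z.
Proof.
case: z => a b; rewrite /cmod /=.
by rewrite -sqrtr_sqr ler_wsqrtr// lerDr sqr_ge0.
Qed.
Lemma cmod_le_ReIm (z : C) : cmod z <= `|complex.Re z| + `|complex.Im z|.
Proof.
case: z => a b; rewrite /cmod /=.
rewrite -[leRHS]ger0_norm ?addr_ge0// -sqrtr_sqr ler_wsqrtr//.
rewrite sqrrD !real_normK ?num_real//.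
have : 0 <= `|a| * `|b| by rewrite mulr_ge0.
by rewrite -mulr_natl; lra.
Qed.
Lemma norm_lt_r2c (z : C) (e : R) : (`|z| < r2c e) = (cmod z < e).
Proof. by rewrite normE /r2c ltcR. Qed.

Lemma nbhs_cmodP (z : C) (P : set C) :
  nbhs z P <-> exists2 e : R, 0 < e & forall y, cmod (y - z) < e -> P y.
Proof.
split=> [/nbhs_ballP[e /= e0 h]|[e e0 h]].
  have er : e = r2c (complex.Re e).
    by case: e e0 {h} => a b; rewrite ltcE /= => /andP[/eqP -> _].
  exists (complex.Re e).
    by move: e0; rewrite er /r2c -(ltcR 0).
  move=> y hy; apply: h; rewrite -ball_normE /ball_ /=.
  by rewrite er norm_lt_r2c cmodB.
apply/nbhs_ballP; exists (r2c e); first by rewrite /= /r2c (ltcR 0).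
by move=> y; rewrite -ball_normE /ball_ /= norm_lt_r2c cmodB => /h.
Qed.

End Modulus.

(** * Compactness of discs and uniform continuity *)

Section Disc.
Context {R : realType}.
Local Notation C := (Cx R).

Definition cdisc (c : C) (r : R) : set C := [set z | cmod (z - c) <= r].

Lemma cmod_continuous : continuous (@cmod R).
Proof.
move=> z A /nbhs_ballP[e /= e0 he].
apply/nbhs_cmodP; exists e => // y hy; apply: he.
rewrite -ball_normE /ball_ /= distrC; apply: le_lt_trans hy.
rewrite ler_norml cmod_leB andbT lerNl opprB cmodB; exact: cmod_leB.
Qed.

Lemma compact_cdisc (c : C) (r : R) : compact (cdisc c r).
Proof.
pose f (p : R * R) : C := c + (p.1 +i* p.2)%C.
have fc : continuous f.
  move=> [x y] A /nbhs_cmodP[e e0 he].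
  apply/nbhs_ballP; exists (e / 2); first by rewrite /= divr_gt0.
  move=> [x' y'] [/= hx hy]; apply: he.
  have -> : f (x', y') - f (x, y) = ((x' - x) +i* (y' - y))%C.
    by rewrite /f opprD addrACA subrr add0r.
  apply: le_lt_trans (cmod_le_ReIm _) _ => /=.
  move: hx hy; rewrite -!ball_normE /ball_ /= distrC => hx; rewrite distrC => hy.
  by rewrite [e]splitr ltrD.
have hk : compact (f @` (`[-r, r]%classic `*` `[-r, r]%classic)).
  apply: continuous_compact; first exact: continuous_subspaceT.
  by apply: compact_setX; exact: segment_compact.
apply: (subclosed_compact _ hk).
  rewrite -openC; rewrite openE => z /= hz; apply/nbhs_cmodP.
  exists (cmod (z - c) - r); first by rewrite subr_gt0 ltNge; apply/negP.
  move=> y; rewrite (cmodB y z) => hy /= hyr.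
  have := @cmod_tri R y z c; move: hyr hy; rewrite /cdisc /=; lra.
move=> z /= hz; exists (complex.Re (z - c), complex.Im (z - c)).
  split; rewrite /= in_itv /= -ler_norml.
    exact: le_trans (normRe_le_cmod _) hz.
  exact: le_trans (normIm_le_cmod _) hz.
rewrite /f /=; case: (z - c) (subrK c z) => a b <-; by rewrite addrC.
Qed.

(** A cluster point of a sequence of counterexamples contradicts continuity there. Only [z] ranges
    over [K], so values slightly off [K] are controlled too. *)
Lemma unif_cont_compact (K : set C) (g : C -> C) : compact K ->
  (forall z, K z -> {for z, continuous g}) ->
  forall e : R, 0 < e -> exists2 d : R, 0 < d & forall z z', K z ->
    cmod (z' - z) < d -> cmod (g z' - g z) < e.
Proof.
move=> Kc gc e e0; apply: contrapT => hn.
have /choice[p hp] : forall n : nat, exists p : C * C,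
    [/\ K p.1, cmod (p.2 - p.1) < n.+1%:R^-1 & e <= cmod (g p.2 - g p.1)].
  move=> n; apply: contrapT => hn2; apply: hn.
  exists n.+1%:R^-1; first by rewrite invr_gt0.
  move=> z z' Kz hz; rewrite ltNge; apply/negP => hle; apply: hn2.
  by exists (z, z').
have [u [v {}hp]] : exists u v : nat -> C, forall n,
    [/\ K (u n), cmod (v n - u n) < n.+1%:R^-1 & e <= cmod (g (v n) - g (u n))].
  by exists (fun n => (p n).1), (fun n => (p n).2).
have [c [Kc' cl]] : exists c : C, K c /\ cluster (u @ \oo) c.
  have [|c [? ?]] := Kc (u @ \oo) _; last by exists c.
  by exists 0%N => // n _ /=; case: (hp n).
have e2 : 0 < e / 2 by rewrite divr_gt0.
have [d d0 hd] : exists2 d : R, 0 < d &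
    forall y, cmod (y - c) < d -> cmod (g y - g c) < e / 2.
  have /nbhs_cmodP[] : nbhs c [set y | cmod (g y - g c) < e / 2].
    have := gc _ Kc' [set w | cmod (w - g c) < e / 2]; apply.
    by apply/nbhs_cmodP; exists (e / 2).
  by move=> d d0 hd; exists d.
have d2 : 0 < d / 2 by rewrite divr_gt0.
have [||y [[n /= hn1 hn2] hy2]] := cl
   [set x | exists2 n, n.+1%:R^-1 < d / 2 & x = u n]
   [set y | cmod (y - c) < d / 2].
- have [N _ hN] := near_infty_natSinv_lt (PosNum d2).
  by exists N => // m Nm; exists m => //; exact: hN.
- by apply/nbhs_cmodP; exists (d / 2).
subst y; have [_ h1 h2] := hp n.
have {}hy2 : cmod (u n - c) < d / 2 by [].
have := cmod_tri (g c) (g (v n)) (g (u n)).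
have : cmod (g (u n) - g c) < e / 2.
  by apply: hd; apply: lt_trans hy2 _; rewrite ltr_pdivrMr// ltr_pMr// ltr1n.
have : cmod (g (v n) - g c) < e / 2.
  apply: hd; apply: le_lt_trans (cmod_tri (u n) _ _) _.
  by rewrite [d]splitr ltrD// (lt_trans h1).
by rewrite (cmodB (g c)); move: h2; lra.
Qed.

End Disc.

(** * Dyadic midpoint sums over segments and triangles *)

Section Goursat.
Context {R : realType}.
Local Notation C := (Cx R).

Definition cdiff_at (f : C -> C) (c : C) : Prop := exists a : C,
  forall e : R, 0 < e -> exists2 d : R, 0 < d & forall z, cmod (z - c) < d ->
    cmod (f z - f c - a * (z - c)) <= e * cmod (z - c).

Definition mid (a b : C) : C := (a + b) / 2.

(** Midpoint Riemann sum of [f dz] over a segment cut into [2^k] pieces. Bisecting the segment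
    lowers [k] by exactly one, so subdividing a triangle is an identity between finite sums; the
    midpoint rule makes the sum exact on affine functions. *)
Fixpoint rsum k (f : C -> C) (a b : C) : C :=
  if k is k'.+1 then rsum k' f a (mid a b) + rsum k' f (mid a b) b
  else (b - a) * f (mid a b).

Definition tri k f a b c := rsum k f a b + rsum k f b c + rsum k f c a.

Lemma midC a b : mid a b = mid b a. Proof. by rewrite /mid addrC. Qed.

Lemma mid_subl (a b : C) : mid a b - a = (b - a) / 2.
Proof. by rewrite /mid; field. Qed.
Lemma mid_subr (a b : C) : b - mid a b = (b - a) / 2.
Proof. by rewrite /mid; field. Qed.

Lemma rsumN k f a b : rsum k f b a = - rsum k f a b.
Proof.
elim: k a b => [|k IH] a b /=; first by rewrite midC -mulNr opprB.
by rewrite (midC b a) (IH (mid a b)) (IH a) opprD addrC.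
Qed.

(** Each side of the medial triangle is traversed once in each direction, so only the six outer
    halves remain. *)
Lemma triS k f a b c : tri k.+1 f a b c =
  tri k f a (mid a b) (mid c a) + tri k f (mid a b) b (mid b c) +
  tri k f (mid c a) (mid b c) c + tri k f (mid a b) (mid b c) (mid c a).
Proof.
rewrite /tri /=.
rewrite (rsumN k f (mid c a) (mid a b)) (rsumN k f (mid a b) (mid b c)).
by rewrite (rsumN k f (mid b c) (mid c a)); ring.
Qed.

Lemma rsumB k f g a b :
  rsum k (fun z => f z - g z) a b = rsum k f a b - rsum k g a b.
Proof. by elim: k a b => [|k IH] a b /=; rewrite ?IH; ring. Qed.

Lemma rsum_affine k (u v : C) a b :
  rsum k (fun z => u * z + v) a b = (b - a) * (u * mid a b + v).
Proof.
by elim: k a b => [//|k IH] a b /=; rewrite !IH /mid; field; rewrite ?pnatr_eq0.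
Qed.

Lemma tri_affine k (u v : C) a b c : tri k (fun z => u * z + v) a b c = 0.
Proof. by rewrite /tri !rsum_affine /mid; field. Qed.

Lemma triB k f g a b c :
  tri k (fun z => f z - g z) a b c = tri k f a b c - tri k g a b c.
Proof. by rewrite /tri !rsumB; ring. Qed.

Lemma cmod2 : cmod (2 : C) = 2. Proof. exact: (cmod_nat 2). Qed.

Lemma rsum_le (P : set C) k f a b (B : R) :
  (forall x y, P x -> P y -> P (mid x y)) -> P a -> P b ->
  (forall x, P x -> cmod (f x) <= B) -> cmod (rsum k f a b) <= B * cmod (b - a).
Proof.
move=> Pm; elim: k a b => [|k IH] a b Pa Pb hB /=.
  by rewrite cmodM mulrC ler_wpM2r ?cmod_ge0// hB//; exact: Pm.
apply: le_trans (cmodD _ _) _.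
apply: le_trans (lerD (IH _ _ Pa (Pm _ _ Pa Pb) hB) (IH _ _ (Pm _ _ Pa Pb) Pb hB)) _.
by rewrite mid_subl mid_subr cmodM cmodV cmod2; lra.
Qed.

Lemma tri_le (P : set C) k f a b c (B d : R) :
  (forall x y, P x -> P y -> P (mid x y)) -> P a -> P b -> P c ->
  cmod (b - a) <= d -> cmod (c - b) <= d -> cmod (a - c) <= d ->
  (forall x, P x -> cmod (f x) <= B) -> cmod (tri k f a b c) <= B * (3 * d).
Proof.
move=> Pm Pa Pb Pc h1 h2 h3 hB.
have B0 : 0 <= B by apply: le_trans (cmod_ge0 _) (hB _ Pa).
have H x y : P x -> P y -> cmod (y - x) <= d -> cmod (rsum k f x y) <= B * d.
  move=> Px Py hd; apply: le_trans (rsum_le k Pm Px Py hB) _.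
  exact: ler_wpM2l.
apply: le_trans (cmodD _ _) _; apply: le_trans (lerD (cmodD _ _) (lexx _)) _.
by have := H _ _ Pa Pb h1; have := H _ _ Pb Pc h2; have := H _ _ Pc Pa h3; lra.
Qed.

Lemma cdisc_mid (c : C) r x y : cdisc c r x -> cdisc c r y -> cdisc c r (mid x y).
Proof.
rewrite /cdisc /= => hx hy.
have -> : mid x y - c = (x - c + (y - c)) / 2 by rewrite /mid; field.
rewrite cmodM cmodV cmod2.
by have := cmodD (x - c) (y - c); lra.
Qed.

End Goursat.

(** * Goursat's lemma *)

Section GoursatLemma.
Context {R : realType}.
Local Notation C := (Cx R).

Lemma exists_half_pow_lt (d e : R) : 0 < e -> exists n, d / 2 ^+ n < e.
Proof.
move=> e0; have [d0|d0] := leP d 0.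
  by exists 0%N; rewrite expr0 divr1; exact: le_lt_trans e0.
have [n _ hn] := near_infty_natSinv_expn_lt (PosNum (divr_gt0 e0 d0)).
exists n; have := hn n (leqnn n); rewrite /= div1r => h.
by rewrite -ltr_pdivlMl// [_^-1 * _]mulrC.
Qed.

(** A triangle is [good] if the bound [e * d^2] holds for all large [k], the threshold depending on
    the triangle. A bad triangle has a bad quarter, because [4 * (d / 2)^2 = d^2]. Near the limit of
    nested bad triangles the affine part of [f] contributes 0 and the remainder is small for every
    [k], a contradiction. *)
Lemma goursat (f : C -> C) (c0 : C) (r : R) :
  (forall z, cdisc c0 r z -> cdiff_at f z) ->
  forall a b c, cdisc c0 r a -> cdisc c0 r b -> cdisc c0 r c ->
  forall e : R, 0 < e -> exists K, forall k, (K <= k)%N ->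
    cmod (tri k f a b c) <= e.
Proof.
move=> fd.
pose good a b c (d e : R) := exists K, forall k, (K <= k)%N ->
  cmod (tri k f a b c) <= e * d ^+ 2.
pose D := cdisc c0 r.
pose small (a b c : C) (d : R) := [/\ D a, D b & D c] /\
  [/\ cmod (b - a) <= d, cmod (c - b) <= d & cmod (a - c) <= d].
suff H a b c d e : 0 < d -> 0 < e -> small a b c d -> good a b c d e.
  move=> a b c Da Db Dc e e0.
  pose d : R := cmod (b - a) + cmod (c - b) + cmod (a - c) + 1.
  have d0 : 0 < d.
    by rewrite ltr_wpDl// !addr_ge0 ?cmod_ge0.
  have [||K hK] := H a b c d (e / d ^+ 2) d0 _.
  - by rewrite divr_gt0 ?exprn_gt0.
  - split=> //; have := cmod_ge0 (b - a); have := cmod_ge0 (c - b).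
    have := cmod_ge0 (a - c); rewrite /d; split; lra.
  exists K => k /hK; rewrite divfK//.
  by rewrite expf_neq0// gt_eqF.
move=> d0 e0 sm; apply: contrapT => bd.
pose bad (t : C * C * C * R) := let: (a, b, c, d) := t in
  [/\ 0 < d, small a b c d & ~ good a b c d e].
(* On a bad triangle [step] selects a bad quarter; elsewhere its value is arbitrary. *)
have /choice[step stepP] : forall t : C * C * C * R, exists t',
    bad t -> [/\ bad t', t'.2 = t.2 / 2 & cmod (t'.1.1.1 - t.1.1.1) <= t.2].
  move=> [[[a1 b1] c1] d1]; have [[d10 [[Da Db Dc] [h1 h2 h3]] bd1]|nb] :=
    pselect (bad (a1, b1, c1, d1)); last by exists (a1, b1, c1, d1).
  have Dm x y : D x -> D y -> D (mid x y) by exact: cdisc_mid.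
  have d20 : 0 < d1 / 2 by rewrite divr_gt0.
  have half (x y : C) : cmod (y - x) <= d1 -> cmod ((y - x) / 2) <= d1 / 2.
    by move=> h; rewrite cmodM cmodV cmod2 ler_pM2r// invr_gt0.
  have rw1 (x y z : C) : mid x z - mid x y = (z - y) / 2.
    by rewrite /mid; field.
  have rw2 (x y z : C) : mid x y - mid y z = (x - z) / 2.
    by rewrite /mid; field.
  have rw3 (x y z : C) : mid x y - mid z x = (y - z) / 2.
    by rewrite /mid; field.
  have s1 : small a1 (mid a1 b1) (mid c1 a1) (d1 / 2).
    split; first by split=> //; apply: Dm.
    split; first by rewrite mid_subl half.
      by rewrite midC rw1 half.
    by rewrite mid_subr half.
  have s2 : small (mid a1 b1) b1 (mid b1 c1) (d1 / 2).
    split; first by split=> //; apply: Dm.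
    split; first by rewrite mid_subr half.
      by rewrite mid_subl half.
    by rewrite rw2 half.
  have s3 : small (mid c1 a1) (mid b1 c1) c1 (d1 / 2).
    split; first by split=> //; apply: Dm.
    split; first by rewrite rw2 half.
      by rewrite mid_subr half.
    by rewrite mid_subl half.
  have s4 : small (mid a1 b1) (mid b1 c1) (mid c1 a1) (d1 / 2).
    split; first by split=> //; apply: Dm.
    split; first by rewrite cmodB rw2 half.
      by rewrite cmodB rw2 half.
    by rewrite rw3 half// cmodB.
  apply: contrapT => hn.
  have G (x y z : C) : cmod (x - a1) <= d1 -> small x y z (d1 / 2) ->
      good x y z (d1 / 2) e.
    move=> hx hs; apply: contrapT => ng; apply: hn.
    by exists (x, y, z, d1 / 2) => _; split.
  have la : cmod (mid a1 b1 - a1) <= d1.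
    by rewrite mid_subl; apply: le_trans (half _ _ h1) _; lra.
  have lc : cmod (mid c1 a1 - a1) <= d1.
    by rewrite midC mid_subl; apply: le_trans (half a1 c1 _) _; rewrite 1?cmodB//; lra.
  have [|K1 hK1] := G _ _ _ _ s1; first by rewrite subrr cmod0 ltW.
  have [K2 hK2] := G _ _ _ la s2.
  have [K3 hK3] := G _ _ _ lc s3.
  have [K4 hK4] := G _ _ _ la s4.
  apply: bd1; exists (maxn (maxn K1 K2) (maxn K3 K4)).+1 => -[//|k].
  rewrite ltnS !geq_max => /andP[/andP[k1 k2] /andP[k3 k4]].
  rewrite triS.
  apply: le_trans (cmodD _ _) _; apply: le_trans (lerD (cmodD _ _) (lexx _)) _.
  apply: le_trans (lerD (lerD (cmodD _ _) (lexx _)) (lexx _)) _.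
  move: (hK1 _ k1) (hK2 _ k2) (hK3 _ k3) (hK4 _ k4).
  have -> : e * (d1 / 2) ^+ 2 = (e * d1 ^+ 2) / 4 by field.
  by lra.
pose t n := iter n step (a, b, c, d).
have tb n : bad (t n).
  by elim: n => [//|n IH]; have [] := stepP _ IH.
pose u n : C := (t n).1.1.1; pose dd n : R := (t n).2.
have ddS n : dd n.+1 = dd n / 2 by have [_ + _] := stepP _ (tb n).
have dd0 n : 0 < dd n by rewrite /dd; move: (tb n); case: (t n) => [[[? ?] ?] ?] [].
have uS n : cmod (u n.+1 - u n) <= dd n by have [_ _] := stepP _ (tb n).
have ddE n : dd n = d / 2 ^+ n.
  elim: n => [|n IH]; first by rewrite expr0 divr1.
  by rewrite ddS IH exprS invfM [2^-1 * _]mulrC mulrA.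
have umn n m : cmod (u (n + m)%N - u n) <= 2 * dd n - 2 * dd (n + m)%N.
  elim: m => [|m IH]; first by rewrite addn0 !subrr cmod0.
  apply: le_trans (cmod_tri (u (n + m)%N) _ _) _.
  by rewrite addnS; have := uS (n + m)%N; rewrite ddS; move: IH; lra.
have uD n : D (u n).
  by rewrite /u; move: (tb n); case: (t n) => [[[? ?] ?] ?] [_ [[? ? ?] _] _].
have [l [Dl cl]] : exists l : C, D l /\ cluster (u @ \oo) l.
  have [|l [? ?]] := @compact_cdisc R c0 r (u @ \oo) _; last by exists l.
  by exists 0%N => // n _ /=; exact: uD.
have lu n : cmod (l - u n) <= 3 * dd n.
  have [||y [[m /= hm hy1] hy2]] := cl
    [set x | exists2 m, (n <= m)%N & x = u m] [set y | cmod (y - l) < dd n].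
  - by exists n => // m nm; exists m.
  - by apply/nbhs_cmodP; exists (dd n).
  have {}hy2 : cmod (u m - l) < dd n by rewrite -hy1.
  have := umn n (m - n)%N; rewrite subnKC// => h.
  have := cmod_tri (u m) l (u n); rewrite (cmodB l (u m)).
  by move: h hy2 (dd0 m); lra.
have [g hg] := fd l Dl.
(* A triangle of size [s] lies within [4 * s] of [l] ([3 * s] by [lu], plus its own size) and its
   perimeter is at most [3 * s]: hence [12 = 4 * 3], and the radius [de / 4] below. *)
have e12 : 0 < e / 12 by rewrite divr_gt0.
have [de de0 hde] := hg _ e12.
have [n hn] := exists_half_pow_lt d (divr_gt0 de0 (ltr0Sn R 3)).
have := tb n; rewrite -ddE in hn.
move: (lu n) (dd0 n) hn; rewrite /dd /u.
case: (t n) => [[[x y] z] s] /= lx s0 hs [_ [_ [h1 h2 h3]]]; apply.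
exists 0%N => k _.
have -> : tri k f x y z = tri k (fun w => f w - (g * w + (f l - g * l))) x y z.
  by rewrite triB tri_affine subr0.
pose P : set C := cdisc x s.
apply: le_trans (@tri_le _ P k _ x y z (e / 12 * (4 * s)) s _ _ _ _ h1 h2 h3 _) _.
- exact: cdisc_mid.
- by rewrite /P /cdisc /= subrr cmod0 ltW.
- by [].
- by rewrite /P /cdisc /= cmodB.
- move=> w hw.
  have hwl : cmod (w - l) <= 4 * s.
    have {}hw : cmod (w - x) <= s := hw.
    have := cmod_tri x w l; rewrite (cmodB x l) => tr.
    by apply: le_trans tr _; clear -hw lx; lra.
  have -> : f w - (g * w + (f l - g * l)) = f w - f l - g * (w - l) by ring.
  apply: le_trans (hde _ _) _; last by rewrite ler_pM2l.
  apply: le_lt_trans hwl _; rewrite mulrC -ltr_pdivlMr//.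
- by rewrite le_eqVlt; apply/orP; left; apply/eqP; field.
Qed.

End GoursatLemma.

(** * Roots of unity and averages over circles *)

Section MeanValue.
Context {R : realType}.
Local Notation C := (Cx R).

Definition cis (t : R) : C := (cos t +i* sin t)%C.

Lemma cisD s t : cis (s + t) = cis s * cis t.
Proof.
rewrite /cis cosD sinD; apply/eqP; rewrite eq_complex /=.
by rewrite eqxx /= addrC.
Qed.

Lemma cis0 : cis 0 = 1. Proof. by rewrite /cis cos0 sin0. Qed.

Lemma cmod_cis t : cmod (cis t) = 1.
Proof. by rewrite /cmod /cis /= cos2Dsin2 sqrtr1. Qed.

Lemma cis_near1 (e : R) : 0 < e ->
  exists2 d : R, 0 < d & forall t, `|t| < d -> cmod (cis t - 1) < e.
Proof.
move=> e0; have e2 : 0 < e / 2 by rewrite divr_gt0.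
have H (g : R -> R) : continuous g ->
    exists2 d : R, 0 < d & forall t, `|t| < d -> `|g t - g 0| < e / 2.
  move=> /(_ 0) gc; have /nbhs_ballP[d /= d0 hd] : nbhs (0 : R) (g @^-1` ball (g 0) (e / 2)).
    by apply: gc; exact: nbhsx_ballx.
  exists d => // t ht; have := hd t; rewrite -!ball_normE /ball_ /= sub0r normrN distrC.
  by apply.
have [d1 d10 h1] := H _ (@continuous_cos R).
have [d2 d20 h2] := H _ (@continuous_sin R).
exists (Num.min d1 d2); first by rewrite lt_min d10.
move=> t; rewrite lt_min => /andP[/h1 + /h2]; rewrite cos0 sin0 => u v.
have -> : cis t - 1 = ((cos t - 1) +i* (sin t - 0))%C by [].
by apply: le_lt_trans (cmod_le_ReIm _) _; rewrite [e]splitr ltrD.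
Qed.

Definition rootu k : C := cis (pi *+ 2 / 2 ^+ k).

Lemma rootuX k j : rootu k ^+ j = cis (j%:R * (pi *+ 2 / 2 ^+ k)).
Proof.
elim: j => [|j IH]; first by rewrite mul0r cis0 expr0.
rewrite exprS IH /rootu -cisD; congr cis.
by rewrite -natr1; ring.
Qed.

Lemma cmod_rootuX k j : cmod (rootu k ^+ j) = 1.
Proof. by rewrite rootuX cmod_cis. Qed.

Lemma rootu_pow k : rootu k ^+ (2 ^ k) = 1.
Proof.
by rewrite rootuX natrX mulrC divfK ?expf_neq0// /cis cos2pi sin2pi.
Qed.

Lemma rootu_half k : rootu k.+1 ^+ (2 ^ k) = -1.
Proof.
rewrite rootuX natrX exprS.
have -> : 2 ^+ k * (pi *+ 2 / (2 * 2 ^+ k)) = pi :> R.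
  by rewrite -mulr_natl; field; rewrite expf_neq0.
by rewrite /cis cospi sinpi; apply/eqP; rewrite eq_complex /= oppr0 !eqxx.
Qed.

Lemma rootu_neq1 k : rootu k.+1 != 1.
Proof.
apply/eqP => h; have := rootu_half k; rewrite h expr1n => /eqP.
by rewrite -subr_eq0 opprK (_ : 1 + 1 = 2%:R)// pnatr_eq0.
Qed.

(** The order divides [2^k]; if it were a proper divisor, the half power would be 1, but it is
    -1. *)
Lemma rootu_prim k : (2 ^ k).-primitive_root (rootu k).
Proof.
have [m hm /dvdn_pfactor] := prim_order_exists (expn_gt0 2 k) (rootu_pow k).
move=> /(_ isT)[j jk mE]; subst m.
move: jk; rewrite leq_eqVlt => /orP[/eqP jk|]; first by rewrite jk in hm.
case: k hm => // k hm.
rewrite ltnS => jk; have := rootu_half k.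
have -> : (2 ^ k = 2 ^ j * 2 ^ (k - j))%N by rewrite -expnD subnKC.
rewrite exprM (prim_expr_order hm) expr1n => /eqP.
by rewrite -subr_eq0 opprK (_ : 1 + 1 = 2%:R)// pnatr_eq0.
Qed.

(** The roots near 1 make up a proportion [2^-k0] of all roots, the same for every [k]. This
    proportion stands in for the measure of an arc. *)
Lemma rootu_arc (e : R) : 0 < e -> exists k0, forall k, (k0 <= k)%N ->
  forall j, (j < 2 ^ (k - k0))%N -> cmod (rootu k ^+ j - 1) < e.
Proof.
move=> /cis_near1[d d0 hd].
have [k0 hk0] := exists_half_pow_lt (pi *+ 2) d0.
exists k0 => k k0k j hj; rewrite rootuX; apply: hd.
have P0 : 0 <= (pi : R) *+ 2 by exact: mulrn_wge0 (pi_ge0 R).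
rewrite ger0_norm; last by rewrite mulr_ge0// divr_ge0// exprn_ge0.
apply: le_lt_trans hk0.
rewrite mulrCA; apply: ler_wpM2l => //.
rewrite ler_pdivrMr ?exprn_gt0// [leRHS]mulrC ler_pdivlMr ?exprn_gt0//.
by rewrite -!natrX -natrM ler_nat -[X in (_ <= 2 ^ X)%N](subnK k0k) expnD leq_mul2r ltnW ?orbT.
Qed.

Definition avg k (f : C -> C) z : C :=
  (\sum_(j < 2 ^ k) f (z * rootu k ^+ j)) / 2 ^+ k.

Lemma cdiff_cont (f : C -> C) c : cdiff_at f c -> {for c, continuous f}.
Proof.
move=> [a ha] A /nbhs_cmodP[e e0 he]; apply/nbhs_cmodP.
have [d d0 hd] := ha 1 ltr01.
have m0 : 0 < cmod a + 1 by rewrite ltr_wpDl// cmod_ge0.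
exists (Num.min d (e / (cmod a + 1))); first by rewrite lt_min d0 divr_gt0.
move=> y; rewrite lt_min => /andP[/hd h1]; rewrite ltr_pdivlMr// => h2.
apply: he; rewrite -(subrK (a * (y - c)) (f y - f c)).
apply: le_lt_trans (cmodD _ _) _; rewrite cmodM.
by move: h1 h2; lra.
Qed.

(** The average of [f] over a circle is, up to a constant factor, a Riemann sum of [f z / z dz];
    Goursat's lemma is applied to this quotient. *)
Lemma cdiff_divz (f : C -> C) c : c != 0 -> cdiff_at f c ->
  cdiff_at (fun z => f z / z) c.
Proof.
move=> c0 [a ha]; exists ((a - f c / c) / c) => e e0.
have C0 : 0 < cmod c by rewrite cmod_gt0.
pose b := a - f c / c.
have e4 : 0 < e * cmod c / 4 by rewrite !divr_gt0 ?mulr_gt0.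
have [d d0 hd] := ha _ e4.
have b0 : 0 < cmod b + 1 by rewrite ltr_wpDl// cmod_ge0.
exists (Num.min d (Num.min (cmod c / 2) (e * cmod c ^+ 2 / 4 / (cmod b + 1)))).
  by rewrite !lt_min d0 !divr_gt0 ?mulr_gt0 ?exprn_gt0.
move=> z; rewrite !lt_min => /and3P[/hd h1 h2]; rewrite ltr_pdivlMr// => h3.
have hz : cmod c / 2 < cmod z.
  by have := cmod_leB c z; rewrite cmodB; move: h2; lra.
have Z0 : 0 < cmod z by apply: lt_trans hz; rewrite divr_gt0.
have z0 : z != 0 by rewrite -cmod_gt0.
have -> : f z / z - f c / c - (a - f c / c) / c * (z - c) =
   (f z - f c - a * (z - c)) / z - b * ((z - c) * (z - c)) / (z * c).
  by rewrite /b; field; rewrite c0 z0.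
apply: le_trans (cmodBD _ _) _.
rewrite !cmodM !cmodV !cmodM.
set x := cmod (z - c) in h1 h2 h3 *.
have x0 : 0 <= x by exact: cmod_ge0.
have H1 : cmod (f z - f c - a * (z - c)) / cmod z <= e / 2 * x.
  rewrite ler_pdivrMr//; apply: le_trans h1 _.
  have -> : e * cmod c / 4 * x = e / 2 * x * (cmod c / 2) by field.
  by rewrite ler_wpM2l// ?mulr_ge0// ?divr_ge0// ltW.
have H2 : cmod b * (x * x) / (cmod z * cmod c) <= e / 2 * x.
  rewrite ler_pdivrMr ?mulr_gt0// mulrA.
  rewrite [leRHS]mulrAC ler_wpM2r//.
  have h4 : cmod b * x <= e * cmod c ^+ 2 / 4.
    apply: le_trans (ltW h3); rewrite mulrC ler_wpM2l//; lra.
  apply: le_trans h4 _; rewrite expr2.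
  have -> : e * (cmod c * cmod c) / 4 = e / 2 * (cmod c / 2 * cmod c) by field.
  by rewrite ler_wpM2l// ?divr_ge0// ?ltW// ltr_pM2r.
by move: H1 H2; lra.
Qed.

End MeanValue.

(** * Averages over two circles of an annulus *)

Section AnnulusAverage.
Context {R : realType}.
Local Notation C := (Cx R).

Lemma rsum_approx k (g : C -> C) a b (e : R) :
  (forall z, cmod (z - a) <= cmod (b - a) -> cmod (g z - g a) <= e) ->
  cmod (rsum k g a b - (b - a) * g a) <= e * cmod (b - a).
Proof.
move=> he.
have -> : (b - a) * g a = rsum k (fun z => 0 * z + g a) a b.
  by rewrite rsum_affine mul0r add0r.
rewrite -rsumB; apply: (@rsum_le _ (cdisc a (cmod (b - a)))).
- exact: cdisc_mid.
- by rewrite /cdisc /= subrr cmod0 cmod_ge0.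
- by rewrite /cdisc /=.
- by move=> z hz; rewrite mul0r add0r; exact: he.
Qed.

(* Two triangles of vertices on the circles of radius |z1| and s |z1| fill the
   sector between consecutive roots; the radial sides cancel. *)
Lemma sum_tri_annulus m (g : C -> C) (z1 s w : C) N : w ^+ N = 1 ->
  \sum_(j < N) (tri m g (s * (z1 * w ^+ j)) (z1 * w ^+ j) (z1 * w ^+ j.+1) +
    tri m g (s * (z1 * w ^+ j)) (z1 * w ^+ j.+1) (s * (z1 * w ^+ j.+1))) =
  \sum_(j < N) (rsum m g (z1 * w ^+ j) (z1 * w ^+ j.+1) -
    rsum m g (s * (z1 * w ^+ j)) (s * (z1 * w ^+ j.+1))).
Proof.
move=> w1; pose A j := rsum m g (s * (z1 * w ^+ j)) (z1 * w ^+ j).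
suff : \sum_(j < N) (A j - A j.+1) = 0.
  move=> h; rewrite -[RHS]addr0 -[X in _ = _ + X]h -big_split /=; apply: eq_bigr => j _.
  rewrite /A /tri (rsumN m g (s * (z1 * w ^+ j)) (z1 * w ^+ j.+1)).
  rewrite (rsumN m g (s * (z1 * w ^+ j)) (s * (z1 * w ^+ j.+1))).
  by rewrite (rsumN m g (s * (z1 * w ^+ j.+1)) (z1 * w ^+ j.+1)); ring.
rewrite -(big_mkord xpredT (fun j => A j - A j.+1)).
under eq_bigr do rewrite -opprB; rewrite sumrN telescope_sumr//.
by rewrite /A w1 expr0 subrr oppr0.
Qed.

(** With [g = f z / z] and consecutive vertices, [(z (j+1) - z j) * g (z j) = (w - 1) * f (z j)], so
    [N * (w - 1)] times the average is an endpoint sum of [g] over the inscribed polygon. The number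
    of roots is fixed first, fine enough for the uniform continuity of [g]; only then is the depth
    [m] of the dyadic sums chosen. *)
Lemma avg_annulus (f : C -> C) (z1 : C) (r s : R) :
  (forall z, z != 0 -> cmod z < r -> cdiff_at f z) ->
  z1 != 0 -> 2 * cmod z1 < r -> 0 < s < 1 ->
  forall e : R, 0 < e -> exists K, forall k, (K <= k)%N ->
    cmod (avg k f z1 - avg k f (r2c s * z1)) <= e.
Proof.
move=> fd z10 z1r /andP[s0 s1] e e0.
pose g z := f z / z; pose rho := cmod z1.
have rho0 : 0 < rho by rewrite cmod_gt0.
have gd z : z != 0 -> cmod z < r -> cdiff_at g z.
  by move=> z0 zr; apply: cdiff_divz => //; exact: fd.
(* [2 * e1 * rho = e / 2]: replacing side sums by endpoint values on both circles costs half of the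
   error; the other half goes to Goursat's lemma, through [tau]. *)
pose e1 : R := e / (4 * rho).
have e10 : 0 < e1 by rewrite divr_gt0 ?mulr_gt0.
pose ann : set C := [set z | s * rho <= cmod z <= rho].
have annP z : ann z -> z != 0 /\ cmod z < r.
  move=> /andP[h1 h2]; split.
    by rewrite -cmod_gt0; apply: lt_le_trans h1; rewrite mulr_gt0.
  by apply: le_lt_trans h2 _; move: z1r; rewrite -/rho; move: rho0; lra.
have annc : compact ann.
  apply: (subclosed_compact _ (@compact_cdisc R 0 rho)).
    have -> : ann = cmod @^-1` `[s * rho, rho]%classic.
      by apply/seteqP; split => z; rewrite /ann /= in_itv.
    apply: closed_comp; last exact: itv_closed.
    by move=> z _; exact: cmod_continuous.
  by move=> z /andP[_ h]; rewrite /cdisc /= subr0.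
have [d d0 hd] : exists2 d : R, 0 < d & forall z z', ann z ->
    cmod (z' - z) < d -> cmod (g z' - g z) < e1.
  apply: unif_cont_compact => // z /annP[z0 zr].
  by apply: cdiff_cont; exact: gd.
have dd : 0 < Num.min (d / rho) (s / 2) by rewrite lt_min !divr_gt0.
have [k0 hk0] := rootu_arc dd.
exists k0.+1 => -[//|k] k0k.
pose w : C := rootu k.+1; pose N := (2 ^ k.+1)%N.
have hw : cmod (w - 1) < Num.min (d / rho) (s / 2).
  have := hk0 k.+1 (ltnW k0k) 1%N; rewrite expr1; apply.
  by rewrite -[1%N](expn0 2) ltn_exp2l// subn_gt0.
move: hw; rewrite lt_min ltr_pdivlMr// => /andP[hw1 hw2].
have w1 : w ^+ N = 1 by exact: rootu_pow.
have wj j : cmod (w ^+ j) = 1 by exact: cmod_rootuX.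
have wn0 j : w ^+ j != 0 by rewrite -cmod_gt0 wj.
have w10 : 0 < cmod (w - 1) by rewrite cmod_gt0 subr_eq0 rootu_neq1.
pose z j := z1 * w ^+ j; pose S : C := r2c s.
have S0 : S != 0 by rewrite -cmod_gt0 cmod_r2c normr_gt0 gt_eqF.
have cS : cmod S = s by rewrite cmod_r2c gtr0_norm.
have cz j : cmod (z j) = rho by rewrite cmodM wj mulr1.
have czz j : cmod (z j.+1 - z j) = rho * cmod (w - 1).
  by rewrite /z exprS -mulrBr -{2}(mul1r (w ^+ j)) -mulrBl !cmodM wj mulr1.
have zn0 j : z j != 0 by rewrite -cmod_gt0 cz.
have NR0 : 0 < (N%:R : R) by rewrite ltr0n expn_gt0.
pose tau : R := N%:R * cmod (w - 1) * (e / 2).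
have tau0 : 0 < tau by rewrite !mulr_gt0 ?divr_gt0.
have tt0 : 0 < tau / (2 * N%:R) by rewrite divr_gt0 ?mulr_gt0.
(* This disc, centred at the middle of a radial side, avoids 0 and contains both triangles of the
   sector. *)
have sector j x : cdisc (r2c ((1 + s) / 2) * z j) (rho / 2) x -> cdiff_at g x.
  rewrite /cdisc /= => hx.
  have hc : cmod (r2c ((1 + s) / 2) * z j) = (1 + s) / 2 * rho.
    by rewrite cmodM cmod_r2c cz ger0_norm//; move: s0; lra.
  apply: gd.
    rewrite -cmod_gt0; have := cmod_leB (r2c ((1 + s) / 2) * z j) x.
    have : 0 < s * rho by rewrite mulr_gt0.
    by rewrite cmodB hc; move: hx; lra.
  have := cmod_leB x (r2c ((1 + s) / 2) * z j); rewrite hc.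
  have : s * rho < rho by rewrite gtr_pMl.
  by move: hx z1r; rewrite -/rho; lra.
have half12 : (1 - s) / 2 * rho + s / 2 * rho = rho / 2 by field.
have wr : cmod (w - 1) * rho < s / 2 * rho by rewrite ltr_pM2r.
have scN (x : R) (y : C) : 0 <= x -> cmod (r2c x * y) = x * cmod y.
  by move=> x0; rewrite cmodM cmod_r2c ger0_norm.
have r1 : (1 : C) = r2c 1 by [].
have r2B x y : r2c x - r2c y = r2c (x - y) :> C by rewrite /r2c rmorphB.
have in1 j : cmod (z j - r2c ((1 + s) / 2) * z j) = (1 - s) / 2 * rho.
  rewrite -{1}(mul1r (z j)) -mulrBl r1 r2B scN ?cz//; last by move: s1; lra.
  by congr (_ * _); field.
have in2 j : cmod (S * z j - r2c ((1 + s) / 2) * z j) = (1 - s) / 2 * rho.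
  rewrite cmodB -mulrBl r2B scN ?cz//; last by move: s1; lra.
  by congr (_ * _); field.
have p0 : 0 <= s / 2 * rho by rewrite mulr_ge0 ?divr_ge0 ?ltW.
have d1 j : cdisc (r2c ((1 + s) / 2) * z j) (rho / 2) (z j).
  by rewrite /cdisc /= in1 -half12 lerDl.
have d2 j : cdisc (r2c ((1 + s) / 2) * z j) (rho / 2) (S * z j).
  by rewrite /cdisc /= in2 -half12 lerDl.
have d3 j : cdisc (r2c ((1 + s) / 2) * z j) (rho / 2) (z j.+1).
  rewrite /cdisc /=; apply: le_trans (cmod_tri (z j) _ _) _.
  by rewrite czz in1 -half12; move: wr; lra.
have d4 j : cdisc (r2c ((1 + s) / 2) * z j) (rho / 2) (S * z j.+1).
  rewrite /cdisc /=; apply: le_trans (cmod_tri (S * z j) _ _) _.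
  rewrite in2 -mulrBr cmodM czz cS -half12 [leRHS]addrC lerD2r.
  apply: le_trans (ltW wr); rewrite [leRHS]mulrC ler_piMl ?ltW// mulr_gt0//.
have /choice[M hM] : forall j : 'I_N, exists M, forall m, (M <= m)%N ->
    cmod (tri m g (S * z j) (z j) (z j.+1) + tri m g (S * z j) (z j.+1) (S * z j.+1))
      <= tau / N%:R.
  move=> j.
  have [M1 h1] := goursat (@sector j) (d2 j) (d1 j) (d3 j) tt0.
  have [M2 h2] := goursat (@sector j) (d2 j) (d3 j) (d4 j) tt0.
  exists (maxn M1 M2) => m; rewrite geq_max => /andP[/h1 + /h2].
  have -> : tau / N%:R = tau / (2 * N%:R) + tau / (2 * N%:R).
    by field; rewrite gt_eqF.
  by move=> u v; apply: le_trans (cmodD _ _) (lerD u v).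
pose m := \max_j M j.
have key := sum_tri_annulus m g z1 S w1; rewrite -/w in key.
have b1 : cmod (\sum_(j < N) (rsum m g (z j) (z j.+1) - rsum m g (S * z j) (S * z j.+1)))
    <= tau.
  rewrite -key; apply: le_trans (cmod_sum _ _ _) _.
  apply: le_trans (ler_sum _ (G := fun=> tau / N%:R) _) _.
    by move=> j _; apply: hM; exact: leq_bigmax.
  by rewrite sumr_const card_ord -[leLHS]mulr_natr divfK// gt_eqF.
have annz j : ann (z j) by rewrite /ann /= cz lexx andbT ger_pMl// ltW.
have annSz j : ann (S * z j).
  by rewrite /ann /= cmodM cS cz lexx /= ger_pMl// ltW.
have ap j : cmod (rsum m g (z j) (z j.+1) - (z j.+1 - z j) * g (z j)) <=
    e1 * (rho * cmod (w - 1)).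
  rewrite -(czz j); apply: rsum_approx => x hx; apply/ltW/hd => //.
  by apply: le_lt_trans hx _; rewrite czz mulrC.
have aps j : cmod (rsum m g (S * z j) (S * z j.+1) -
    (S * z j.+1 - S * z j) * g (S * z j)) <= e1 * (rho * cmod (w - 1)).
  have h : cmod (S * z j.+1 - S * z j) <= rho * cmod (w - 1).
    rewrite -mulrBr cmodM cS czz ger_pMl ?ltW// mulr_gt0//.
  apply: le_trans (@rsum_approx m g _ _ e1 _) _; last by rewrite ler_pM2l//; exact: h.
  move=> x hx; apply/ltW/hd => //.
  by apply: le_lt_trans hx _; apply: le_lt_trans h _; rewrite mulrC.
have E j : (z j.+1 - z j) * g (z j) = (w - 1) * f (z j).
  rewrite /g mulrA [_ * f _]mulrC -mulrA mulrC; congr (_ * _).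
  by rewrite {1}/z exprS mulrCA -/(z j) -{2}(mul1r (z j)) -mulrBl mulfK.
have Es j : (S * z j.+1 - S * z j) * g (S * z j) = (w - 1) * f (S * z j).
  rewrite /g -mulrBr mulrA [_ * f _]mulrC -mulrA mulrC; congr (_ * _).
  rewrite {1}/z exprS mulrCA -/(z j) -{2}(mul1r (z j)) -mulrBl mulrCA mulfK//.
  by rewrite mulf_neq0.
have fin : cmod ((w - 1) * (\sum_(j < N) f (z j) - \sum_(j < N) f (S * z j))) <=
    tau + N%:R * (2 * (e1 * (rho * cmod (w - 1)))).
  rewrite -sumrB mulr_sumr.
  under eq_bigr => j _ do rewrite mulrBr -E -Es.
  pose X j : C := rsum m g (z j) (z j.+1) - rsum m g (S * z j) (S * z j.+1).
  rewrite -[X in cmod X](subKr (\sum_(j < N) X j)) -sumrB.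
  apply: le_trans (cmodBD _ _) _; apply: lerD => //.
  apply: le_trans (cmod_sum _ _ _) _.
  apply: le_trans (ler_sum _ (G := fun=> 2 * (e1 * (rho * cmod (w - 1)))) _) _.
    move=> j _; rewrite /X.
    set a := rsum _ _ _ _; set b := rsum _ _ _ _; set c := (_ * g (z j)).
    set u := (_ * _).
    have -> : a - b - (c - u) = (a - c) - (b - u) by ring.
    apply: le_trans (cmodBD _ _) _; have := ap j; have := aps j.
    by rewrite -/a -/b -/c -/u; lra.
  by rewrite sumr_const card_ord -[leLHS]mulr_natl.
rewrite /avg -mulrBl.
have -> : \sum_(j < 2 ^ k.+1) f (r2c s * z1 * rootu k.+1 ^+ j) =
    \sum_(j < N) f (S * z j).
  by apply: eq_bigr => j _; rewrite mulrA.
rewrite -/w -/N cmodM cmodV -natrX cmod_nat ler_pdivrMr//.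
rewrite -(ler_pM2l w10) -cmodM; apply: le_trans fin _.
rewrite /tau /e1 le_eqVlt; apply/orP; left; apply/eqP.
by field; rewrite gt_eqF.
Qed.

End AnnulusAverage.

(** * Mean value property and maximum modulus *)

Section MaximumModulus.
Context {R : realType}.
Local Notation C := (Cx R).

Lemma continuous_cmodP (f : C -> C) c : {for c, continuous f} ->
  forall e : R, 0 < e -> exists2 d : R, 0 < d &
    forall z, cmod (z - c) < d -> cmod (f z - f c) < e.
Proof.
move=> fc e e0; have /nbhs_cmodP[] : nbhs c [set z | cmod (f z - f c) < e].
  have := fc [set w | cmod (w - f c) < e]; apply.
  by apply/nbhs_cmodP; exists e.
by move=> d d0 hd; exists d.
Qed.

Lemma ler_sum_arc (N n : nat) (a : nat -> R) (U V : R) : (n <= N)%N ->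
  (forall j, (j < N)%N -> a j <= U) -> (forall j, (j < n)%N -> a j <= V) ->
  \sum_(j < N) a j <= n%:R * V + (N - n)%:R * U.
Proof.
move=> nN hU hV; rewrite -(big_mkord xpredT) (big_cat_nat (n := n))//=; apply: lerD.
  rewrite big_mkord; apply: le_trans (ler_sum _ (G := fun=> V) _) _.
    by move=> j _; exact: hV.
  by rewrite sumr_const card_ord mulr_natl.
rewrite big_nat; apply: le_trans (ler_sum _ (G := fun=> U) _) _.
  by move=> j /andP[_ /hU].
by rewrite -big_nat sumr_const_nat mulr_natl.
Qed.

Lemma avg_le k (f : C -> C) z c (e : R) :
  (forall j, cmod (f (z * rootu k ^+ j) - c) <= e) -> cmod (avg k f z - c) <= e.
Proof.
move=> he; have n0 : (2 ^+ k : C) != 0 by rewrite expf_neq0// pnatr_eq0.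
have -> : avg k f z - c = (\sum_(j < 2 ^ k) (f (z * rootu k ^+ j) - c)) / 2 ^+ k.
  rewrite sumrB sumr_const card_ord mulrBl; congr (_ - _).
  by rewrite -[X in _ = X / _]mulr_natr natrX mulfK.
have N0 : 0 < ((2 ^ k)%:R : R) by rewrite ltr0n expn_gt0.
rewrite cmodM cmodV -natrX cmod_nat ler_pdivrMr//.
apply: le_trans (cmod_sum _ _ _) _.
apply: le_trans (ler_sum _ (G := fun=> e) _) _; first by move=> j _; exact: he.
by rewrite sumr_const card_ord -[leLHS]mulr_natr.
Qed.

(** Shrinking the circle hardly changes the average, and on a small circle all values are close to
    [f 0] by continuity. *)
Lemma mean_value (f : C -> C) (z1 : C) (r : R) : {for 0, continuous f} ->
  (forall z, z != 0 -> cmod z < r -> cdiff_at f z) ->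
  z1 != 0 -> 2 * cmod z1 < r ->
  forall e : R, 0 < e -> exists K, forall k, (K <= k)%N ->
    cmod (avg k f z1 - f 0) <= e.
Proof.
move=> fc fd z10 z1r e e0.
have rho0 : 0 < cmod z1 by rewrite cmod_gt0.
have e2 : 0 < e / 2 by rewrite divr_gt0.
have [d d0 hd] := continuous_cmodP fc e2.
pose s := Num.min 2^-1 (d / (2 * cmod z1)).
have s0 : 0 < s by rewrite lt_min invr_gt0 ltr0n divr_gt0// mulr_gt0.
have s1 : s < 1 by rewrite gt_min invf_lt1// ltr1n.
have [|K hK] := avg_annulus fd z10 z1r _ e2 (s := s); first by rewrite s0.
exists K => k /hK h; apply: le_trans (cmod_tri (avg k f (r2c s * z1)) _ _) _.
rewrite [e]splitr; apply: lerD => //; apply: avg_le => j; apply/ltW/hd.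
rewrite subr0 !cmodM cmod_rootuX mulr1 cmod_r2c gtr0_norm//.
have : s <= d / (2 * cmod z1) by rewrite ge_min lexx orbT.
rewrite ler_pdivlMr ?mulr_gt0// => h2.
by have := mulr_gt0 s0 rho0; move: h2; lra.
Qed.

Lemma cmod_Re_eq1 (q : C) : cmod q <= 1 -> 1 <= complex.Re q -> q = 1.
Proof.
case: q => a b; rewrite /cmod /= => h1 h2.
have h3 : a ^+ 2 + b ^+ 2 <= 1.
  rewrite -(@sqr_sqrtr _ (a ^+ 2 + b ^+ 2)) ?addr_ge0 ?sqr_ge0//.
  by rewrite exprn_ile1// sqrtr_ge0.
have a2 : 1 <= a ^+ 2 by rewrite exprn_ege1.
have b2 : b ^+ 2 = 0 by apply/eqP; rewrite eq_le sqr_ge0 andbT; lra.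
have b0 : b = 0 by apply/eqP; rewrite -sqrf_eq0 b2.
have a1 : a = 1.
  apply/eqP; rewrite eq_le h2 andbT.
  by move: h3; rewrite b2 addr0 -[X in _ <= X -> _](expr1n _ 2) ler_pXn2r ?nnegrE ?ler01// (le_trans ler01).
by rewrite a1 b0.
Qed.

Lemma ReD (x y : C) : complex.Re (x + y) = complex.Re x + complex.Re y.
Proof. by case: x => a b; case: y. Qed.
Lemma Re_r2cM (x : R) (y : C) : complex.Re (r2c x * y) = x * complex.Re y.
Proof. by case: y => a b /=; rewrite mul0r subr0. Qed.
Lemma Re_sum (I : Type) (s : seq I) (P : pred I) (F : I -> C) :
  complex.Re (\sum_(i <- s | P i) F i) = \sum_(i <- s | P i) complex.Re (F i).
Proof. by elim/big_rec2: _ => [//|i y x _ <-]; rewrite ReD. Qed.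

(** After division by [f 0], all values have real part at most 1 and their average tends to 1. If
    the real part at [z1] were [1 - eta], continuity would keep it below [1 - eta / 2] on a fixed
    proportion of the circle. *)
Lemma maximum_modulus (f : C -> C) (r : R) : {for 0, continuous f} ->
  (forall z, z != 0 -> cmod z < r -> cdiff_at f z) ->
  (forall z, cmod z < r -> cmod (f z) <= cmod (f 0)) ->
  forall z, 2 * cmod z < r -> f z = f 0.
Proof.
move=> fc fd fm z1 z1r.
have z1r' : cmod z1 < r by have := cmod_ge0 z1; move: z1r; lra.
have [f0|f0] := eqVneq (f 0) 0.
  apply/eqP; rewrite f0 -cmod_eq0 eq_le cmod_ge0 andbT.
  by have := fm _ z1r'; rewrite f0 cmod0.
have [->//|z10] := eqVneq z1 0.
have F0 : 0 < cmod (f 0) by rewrite cmod_gt0.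
pose q z := f z / f 0.
suff : 1 <= complex.Re (q z1).
  move=> /cmod_Re_eq1 h; have : q z1 = 1.
    by apply: h; rewrite cmodM cmodV ler_pdivrMr// mul1r fm.
  by move=> /(congr1 ( *%R^~ (f 0))); rewrite mul1r divfK.
rewrite leNgt; apply/negP => hq.
pose eta := 1 - complex.Re (q z1).
have eta0 : 0 < eta by rewrite subr_gt0.
have rho0 : 0 < cmod z1 by rewrite cmod_gt0.
have e2 : 0 < eta / 2 * cmod (f 0) by rewrite mulr_gt0// divr_gt0.
have [d d0 hd] := continuous_cmodP (cdiff_cont (fd _ z10 z1r')) e2.
have [k0 hk0] := rootu_arc (divr_gt0 d0 rho0).
(* Half of the deficit [2^-k0 * eta / 2] that the arc near [z1] imposes on the average. *)
pose e := (2 ^+ k0)^-1 * (eta / 4).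
have e0 : 0 < e by rewrite mulr_gt0 ?invr_gt0 ?exprn_gt0// divr_gt0.
have [K hK] := mean_value fc fd z10 z1r (mulr_gt0 e0 F0).
pose k := maxn k0 K; have k0k : (k0 <= k)%N by rewrite leq_maxl.
have := hK k (leq_maxr _ _).
pose a j : R := complex.Re (q (z1 * rootu k ^+ j)).
have aU j : (j < 2 ^ k)%N -> a j <= 1.
  move=> _; apply: le_trans (Re_le_cmod _) _.
  by rewrite cmodM cmodV ler_pdivrMr// mul1r fm// cmodM cmod_rootuX mulr1.
have aV j : (j < 2 ^ (k - k0))%N -> a j <= 1 - eta / 2.
  move=> /(hk0 _ k0k) hj.
  have h : cmod (z1 * rootu k ^+ j - z1) < d.
    by rewrite -{2}(mulr1 z1) -mulrBr cmodM mulrC -ltr_pdivlMr.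
  have -> : a j = complex.Re (q (z1 * rootu k ^+ j) - q z1) + complex.Re (q z1).
    by rewrite -ReD subrK.
  have -> : 1 - eta / 2 = eta / 2 + complex.Re (q z1) by rewrite /eta; field.
  rewrite lerD2r; apply: le_trans (Re_le_cmod _) _.
  rewrite /q -mulrBl cmodM cmodV ler_pdivrMr// ltW//; exact: hd.
have := ler_sum_arc (leq_pexp2l (ltn0Sn 1) (leq_subr k0 k)) aU aV.
set Sm := \sum_(j < _) _; move=> hS.
have N0 : 0 < (2 ^+ k : R) by rewrite exprn_gt0.
have avgE : complex.Re (avg k f z1 / f 0) = Sm / 2 ^+ k.
  have -> : avg k f z1 / f 0 = r2c (2 ^+ k)^-1 * \sum_(j < 2 ^ k) q (z1 * rootu k ^+ j).
    rewrite /avg mulrAC mulrC; congr (_ * _).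
      by rewrite /r2c fmorphV rmorphXn rmorph_nat.
    by rewrite /q mulr_suml.
  by rewrite Re_r2cM Re_sum mulrC.
move=> hA.
have : 1 - Sm / 2 ^+ k <= e.
  rewrite -avgE; have -> : 1 - complex.Re (avg k f z1 / f 0) =
      complex.Re (1 - avg k f z1 / f 0).
    by case: (avg k f z1 / f 0).
  apply: le_trans (Re_le_cmod _) _; rewrite -(mulfV f0) -mulrBl cmodM cmodV.
  by rewrite ler_pdivrMr// cmodB.
have N1 : (2 ^+ k : R) = 2 ^+ (k - k0) * 2 ^+ k0 by rewrite -exprD subnK.
move: hS; rewrite natrB ?leq_pexp2l ?leq_subr// !natrX => hS.
have -> : e = 2 ^+ (k - k0) * (eta / 4) / 2 ^+ k.
  rewrite N1 /e; field; rewrite !expf_neq0//=.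
rewrite -(ler_pM2r N0) mulrBl !divfK ?gt_eqF// mul1r.
have n0 : 0 < (2 ^+ (k - k0) : R) * eta by rewrite mulr_gt0 ?exprn_gt0.
by move: hS n0; lra.
Qed.

End MaximumModulus.

(** * Coverings and monodromy *)

Section Continuity.
Context {R : realType}.

(** The open and closed argument in pointwise form, serving as an induction principle along paths
    and over surfaces. *)
Lemma connected_forall (T : topologicalType) (A : set T) (P : T -> Prop) :
  connected A -> (exists2 a, A a & P a) ->
  (forall a, A a -> P a -> \forall x \near a, A x -> P x) ->
  (forall a, A a -> ~ P a -> \forall x \near a, A x -> ~ P x) ->
  forall a, A a -> P a.
Proof.
move=> Ac [a0 Aa0 Pa0] hP hN.
have /Ac : A `&` [set x | P x] !=set0 by exists a0.
move=> H a Aa; suff E : A `&` [set x | P x] = A by move: Aa; rewrite -E => -[].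
apply: H.
  exists (interior [set x | A x -> P x]); first exact: open_interior.
  apply/seteqP; split => [x [Ax Px]|x [Ax /interior_subset h]]; split => //.
    exact: hP.
  exact: h.
exists (~` interior [set x | A x -> ~ P x]).
  by rewrite closedC; exact: open_interior.
apply/seteqP; split => [x [Ax Px]|x [Ax nx]]; split => //.
  by move=> /interior_subset /(_ Ax).
by apply: contrapT => nPx; apply: nx; exact: hN.
Qed.

(** Paths are continuous only within [[0, 1]]. Composing with [clamp] makes them continuous on [R]
    with the same values there, which keeps subspace topologies out of the lifting arguments. *)
Definition clamp (t : R) : R := Num.max 0 (Num.min 1 t).

Lemma clamp_itv t : clamp t \in `[0, 1].
Proof.
by rewrite in_itv /= /clamp le_max lexx /= ge_max ler01 /= ge_min lexx.
Qed.

Lemma clamp_id t : t \in `[0, 1] -> clamp t = t.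
Proof.
rewrite in_itv /= => /andP[t0 t1].
by rewrite /clamp (min_r t1) (max_r t0).
Qed.

Lemma clamp0 : clamp 0 = 0. Proof. by rewrite clamp_id// in_itv /= lexx ler01. Qed.
Lemma clamp1 : clamp 1 = 1. Proof. by rewrite clamp_id// in_itv /= lexx ler01. Qed.

Lemma clamp_continuous : continuous clamp.
Proof.
move=> t; apply: (@continuous_comp _ _ _ (fun t : R => Num.min 1 t) (fun t : R => Num.max 0 t)).
  exact: (@continuous_min R _ (fun=> 1) idfun t (cvg_cst _) cvg_id).
exact: (@continuous_max R _ (fun=> 0) idfun _ (cvg_cst _) cvg_id).
Qed.

Lemma pair_continuous (T X Y : topologicalType) (f : T -> X) (g : T -> Y) p :
  {for p, continuous f} -> {for p, continuous g} ->
  {for p, continuous (fun x => (f x, g x))}.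
Proof.
move=> fc gc W [[A B] [/= /fc hA /gc hB] AB].
by near=> x; apply: AB; split => /=; near: x.
Unshelve. all: by end_near.
Qed.

Lemma fst_continuous (X Y : topologicalType) : continuous (@fst X Y).
Proof. by move=> p W hW; exists (W, setT) => [|x []//]; split => //; exact: filterT. Qed.

Lemma snd_continuous (X Y : topologicalType) : continuous (@snd X Y).
Proof. by move=> p W hW; exists (setT, W) => [|x []//]; split => //; exact: filterT. Qed.

Lemma clamp_ext_continuous (X : topologicalType) (g : R -> X) :
  {within `[0, 1], continuous g} -> continuous (g \o clamp).
Proof.
move=> /subspace_continuousP gc t W hW.
have h := gc (clamp t) (clamp_itv t) W hW.
have {}h : nbhs t (fun u => `[0, 1]%classic (clamp u) -> W (g (clamp u))).
  exact: clamp_continuous h.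
by apply: filterS h => u; apply; exact: clamp_itv.
Qed.

Lemma clamp2_ext_continuous (X : topologicalType) (H : R * R -> X) :
  {within `[0, 1]%classic `*` `[0, 1]%classic, continuous H} ->
  continuous (fun p => H (clamp p.1, clamp p.2)).
Proof.
move=> /subspace_continuousP Hc [s t] W hW /=.
have i2 p : (`[0, 1]%classic `*` `[0, 1]%classic) (clamp p.1, clamp p.2).
  by split; exact: clamp_itv.
have h := Hc (clamp s, clamp t) (i2 (s, t)) W hW.
have cc : {for (s, t), continuous (fun p : R * R => (clamp p.1, clamp p.2))}.
  apply: pair_continuous.
    by apply: (@continuous_comp _ _ _ fst clamp); [exact: fst_continuous|exact: clamp_continuous].
  by apply: (@continuous_comp _ _ _ snd clamp); [exact: snd_continuous|exact: clamp_continuous].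
have {}h : nbhs (s, t) (fun p => (`[0, 1]%classic `*` `[0, 1]%classic)
    (clamp p.1, clamp p.2) -> W (H (clamp p.1, clamp p.2))) by exact: cc h.
by apply: filterS h => u; apply; exact: i2.
Qed.

Lemma continuous_within01 (X : topologicalType) (g : R -> X) :
  continuous g -> {within `[0, 1], continuous g}.
Proof. exact: continuous_subspaceT. Qed.

Lemma paste_continuous (T X : topologicalType) (P : T -> bool) (f g : T -> X) p :
  {for p, continuous f} -> {for p, continuous g} -> f p = g p ->
  {for p, continuous (fun x => if P x then f x else g x)}.
Proof.
move=> fc gc fg W; rewrite /= (_ : (if P p then f p else g p) = f p); last first.
  by rewrite -fg if_same.
move=> hW; have h1 : nbhs p (f @^-1` W) by exact: fc.
have h2 : nbhs p (g @^-1` W) by apply: gc; rewrite -fg.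
by apply: filterS2 h1 h2 => x /= a b; case: (P x).
Qed.

Lemma near_eq_continuous (T X : topologicalType) (f g : T -> X) p :
  (\forall x \near p, f x = g x) -> {for p, continuous f} -> {for p, continuous g}.
Proof.
move=> fg fc W hW; have e : f p = g p by exact: (@nbhs_singleton _ p (fun x => f x = g x) fg).
have {}hW : nbhs (f p) W by rewrite e.
have h : nbhs p (f @^-1` W) by exact: fc.
have : nbhs p (g @^-1` W) by apply: filterS2 fg h => x ex; rewrite /= ex.
by [].
Qed.

End Continuity.

(** * Lifting of paths and of families of paths *)

Section Covering.
Context {R : realType} {X Y : topologicalType}.
Variable q : Y -> X.

Definition evenly_covered (U : set X) : Prop :=
  exists (K : Type) (s : K -> X -> Y),
  [/\ forall k, open (s k @` U),
      forall k z, U z -> q (s k z) = z /\ {for z, continuous (s k)} &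
      forall y, U (q y) -> exists k, y = s k (q y)].

Definition covering : Prop := [/\ continuous q, hausdorff_space Y &
  forall x, exists U, [/\ open U, U x & evenly_covered U]].

Hypothesis qcov : covering.

(** The image of a section is open, so the points near [y] lie on the same sheet: the last clause
    makes [s] a local inverse of [q] on both sides. *)
Lemma sheet U y : evenly_covered U -> U (q y) -> exists s : X -> Y,
  [/\ s (q y) = y,
      forall z, U z -> q (s z) = z /\ {for z, continuous s} &
      \forall y' \near y, U (q y') -> s (q y') = y'].
Proof.
move=> [K [s [so sq sy]]] Uy; have [k yk] := sy _ Uy.
exists (s k); split => //; first exact: sq.
have : nbhs y (s k @` U) by have := so k; rewrite openE; apply; exists (q y).
apply: filterS => y' [z Uz <-] _.
by have [->] := sq k z Uz.
Qed.

Definition lifts (g : R -> X) (y y' : Y) : Prop := exists gt : R -> Y,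
  [/\ continuous gt, gt 0 = y, gt 1 = y' & forall t, t \in `[0, 1] -> q (gt t) = g t].

(** The set of agreement is open, as both lifts follow one sheet near a common point, and closed, as
    [Y] is Hausdorff. *)
Lemma lift_unique (g1 g2 : R -> Y) : continuous g1 -> continuous g2 ->
  g1 0 = g2 0 -> (forall t, t \in `[0, 1] -> q (g1 t) = q (g2 t)) ->
  forall t, t \in `[0, 1] -> g1 t = g2 t.
Proof.
move=> c1 c2 e0 eq; have [qc qh qe] := qcov.
apply: (@connected_forall _ (`[0, 1]%classic : set R) (fun t => g1 t = g2 t)).
- exact: segment_connected.
- by exists 0 => //; rewrite /= in_itv /= lexx ler01.
- move=> t t01 et; have [U [Uo Ux Ue]] := qe (q (g1 t)).
  have [s [s1 s2 s3]] := sheet Ue Ux.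
  have n1 : nbhs t (g1 @^-1` [set y' | U (q y') -> s (q y') = y']) by exact: c1.
  have n2 : nbhs t (g2 @^-1` [set y' | U (q y') -> s (q y') = y']).
    by apply: c2; rewrite -et.
  have n3 : nbhs t ((q \o g1) @^-1` U).
    apply: (continuous_comp (c1 t) (qc (g1 t))).
    by move: Uo; rewrite openE; apply.
  near=> u => u01.
  have h3 : U (q (g1 u)) by near: u.
  have h1 : U (q (g1 u)) -> s (q (g1 u)) = g1 u by near: u.
  have h2 : U (q (g2 u)) -> s (q (g2 u)) = g2 u by near: u.
  by transitivity (s (q (g1 u))); [rewrite h1|rewrite eq// h2// -eq].
- move=> t t01 /eqP ne; move: qh; rewrite open_hausdorff => /(_ _ _ ne)[[A B] /= [tA tB] [oA oB /eqP AB]].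
  have n1 : nbhs t (g1 @^-1` A).
    by apply: c1; move: oA; rewrite openE; apply; rewrite -inE.
  have n2 : nbhs t (g2 @^-1` B).
    by apply: c2; move: oB; rewrite openE; apply; rewrite -inE.
  near=> u => _ e.
  have h1 : A (g1 u) by near: u.
  have h2 : B (g2 u) by near: u.
  have : (A `&` B) (g1 u) by split => //; rewrite e.
  by rewrite AB.
Unshelve. all: by end_near.
Qed.

Lemma lifts_unique g y y1 y2 : lifts g y y1 -> lifts g y y2 -> y1 = y2.
Proof.
move=> [g1 [c1 <- <- q1]] [g2 [c2 e2 <- q2]].
have i1 : (1 : R) \in `[0, 1] by rewrite in_itv /= ler01 lexx.
by apply: (lift_unique c1 c2) => // t t01; rewrite q1// q2.
Qed.

(** Compactness of [[0, 1]] gives a mesh [1 / N] such that, for all [s] near [s0], each piece of the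
    path stays in an evenly covered set; the lift is prolonged piece by piece through a section. The
    neighbourhood of [s0] may shrink at each step, so the result is local in [s]. *)
Lemma lift_family (H : R * R -> X) (G0 : R -> Y) (s0 : R) : continuous H ->
  continuous G0 -> (forall s, q (G0 s) = H (s, 0)) ->
  exists G : R * R -> Y, \forall s \near s0,
    [/\ forall t, {for (s, t), continuous G}, G (s, 0) = G0 s &
        forall t, t \in `[0, 1] -> q (G (s, t)) = H (s, t)].
Proof.
move=> Hc G0c G0q; have [qc qh qe] := qcov.
have [N N0 hN] : exists2 N, (0 < N)%N & forall t, t \in `[0, 1] -> exists2 U,
    evenly_covered U & forall s u, `|s - s0| < N%:R^-1 -> `|u - t| <= N%:R^-1 ->
      open U /\ U (H (s, u)).
  have /compact_near_coveringP : compact (`[0, 1]%classic : set R).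
    exact: segment_compact.
  move=> /(_ nat \oo (fun N t => exists2 U,
    evenly_covered U & forall s u, `|s - s0| < N%:R^-1 -> `|u - t| <= N%:R^-1 ->
      open U /\ U (H (s, u))) _) h.
  have [|N0 _ hN] := h; last first.
    by exists N0.+1 => // t t01; apply: (hN N0.+1) => //=.
  move=> t t01; have [U [Uo Ux Ue]] := qe (H (s0, t)).
  have /nbhs_ballP[e /= e0 he] : nbhs (s0, t) (H @^-1` U).
    by apply: Hc; move: Uo; rewrite openE; apply.
  have e2 : 0 < e / 2 by rewrite divr_gt0.
  have [M _ hM] := near_infty_natSinv_lt (PosNum e2).
  exists (ball t (e / 2), [set n | (M.+1 <= n)%N]).
    by split; [exact: nbhsx_ballx|exists M.+1].
  move=> [t' [[]//|n]] [/= ht Mn]; have {}Mn : (M <= n)%N by [].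
  exists U => // s u hs hu; split=> //; apply: he.
  have := hM n Mn => /= hn.
  split => /=; rewrite -ball_normE /ball_ /= distrC.
    by apply: lt_trans hs _; apply: lt_trans hn _; rewrite ltr_pdivrMr// ltr_pMr// ltr1n.
  move: ht; rewrite -ball_normE /ball_ /= distrC => ht.
rewrite distrC;  apply: le_lt_trans (ler_distD t' u t) _; rewrite [e]splitr.
  apply: ltrD; last by rewrite distrC.
  exact: le_lt_trans hu hn.
have NR : 0 < (N%:R : R) by rewrite ltr0n.
suff P i : (i <= N)%N -> exists G : R * R -> Y, \forall s \near s0,
    [/\ forall t, {for (s, t), continuous G}, G (s, 0) = G0 s &
        forall t, 0 <= t <= i%:R / N%:R -> q (G (s, t)) = H (s, t)].
  have [G hG] := P N (leqnn N); exists G; apply: filterS hG => s [h1 h2 h3].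
  by split=> // t; rewrite in_itv /= => t01; apply: h3; rewrite divff ?gt_eqF.
elim: i => [_|i IH iN].
  exists (G0 \o fst); near=> s; split => //.
    by move=> t; apply: continuous_comp; [exact: fst_continuous|exact: G0c].
  by move=> t /=; rewrite mul0r -eq_le => /eqP <-.
have [G hG] := IH (ltnW iN).
pose t1 : R := i%:R / N%:R; pose t2 : R := i.+1%:R / N%:R.
have t10 : 0 <= t1 by rewrite divr_ge0.
have t12 : t1 <= t2 by rewrite ler_pM2r ?invr_gt0// ler_nat.
have t1N : t2 - t1 = N%:R^-1 by rewrite -mulrBl -natr1 addrAC subrr add0r mul1r.
have t101 : t1 \in `[0, 1].
  by rewrite in_itv /= t10 /= ler_pdivrMr// mul1r ler_nat ltnW.
have [U Ue hU] := hN _ t101.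
have N1 : 0 < (N%:R^-1 : R) by rewrite invr_gt0.
have Uo : open U by apply: (proj1 (hU s0 t1 _ _)); rewrite subrr normr0// ltW.
have hU' s u : `|s - s0| < N%:R^-1 -> `|u - t1| <= N%:R^-1 -> U (H (s, u)).
  by move=> h1 h2; have [] := hU s u h1 h2.
have [g1 g2 g3] := nbhs_singleton hG.
have qG : q (G (s0, t1)) = H (s0, t1) by rewrite g3// t10 lexx.
have UG : U (q (G (s0, t1))).
  by rewrite qG; apply: hU'; rewrite subrr normr0// ltW.
have [sh [sh1 sh2 sh3]] := sheet Ue UG.
(* Freezing time at [t2] keeps the argument of the section inside [U], so the prolonged lift is
   continuous at every [t]. *)
pose m (t : R) := Num.min t t2.
have mc : continuous m.
  by move=> t; exact: (@continuous_min R _ idfun (fun=> t2) t cvg_id (cvg_cst _)).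
pose G' (p : R * R) := if p.2 <= t1 then G p else sh (H (p.1, m p.2)).
exists G'.
have n1 : nbhs s0 ((fun s => G (s, t1)) @^-1` [set y | U (q y) -> sh (q y) = y]).
  have cc : {for s0, continuous (fun s : R => G (s, t1))}.
    apply: (@continuous_comp _ _ _ (fun s : R => (s, t1)) G); last exact: g1.
    by apply: pair_continuous; [exact: cvg_id|exact: cvg_cst].
  by apply: cc.
have n2 : nbhs s0 [set s | `|s - s0| < N%:R^-1].
  apply/nbhs_ballP; exists N%:R^-1 => //= s.
  by rewrite -ball_normE /ball_ /= distrC.
near=> s.
have [k1 k2 k3] : [/\ forall t, {for (s, t), continuous G}, G (s, 0) = G0 s &
        forall t, 0 <= t <= i%:R / N%:R -> q (G (s, t)) = H (s, t)] by near: s.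
have ks : `|s - s0| < N%:R^-1 by near: s.
have kq : q (G (s, t1)) = H (s, t1) by rewrite k3// t10 lexx.
have kU t : t1 <= t -> U (H (s, m t)).
  move=> tt; apply: hU' => //; rewrite /m ger0_norm ?subr_ge0 ?le_min ?tt//.
  by rewrite -t1N lerD2r ge_min lexx orbT.
have m1 : m t1 = t1 by rewrite /m min_l.
have kG : sh (H (s, t1)) = G (s, t1).
  rewrite -kq; have : U (q (G (s, t1))) -> sh (q (G (s, t1))) = G (s, t1) by near: s.
  by apply; rewrite kq -m1; exact: kU.
have shc t : t1 <= t -> {for (s, t), continuous (fun p : R * R => sh (H (p.1, m p.2)))}.
  move=> tt; apply: (@continuous_comp _ _ _ (fun p : R * R => H (p.1, m p.2)) sh).
    apply: (@continuous_comp _ _ _ (fun p : R * R => (p.1, m p.2)) H); last exact: Hc.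
    apply: pair_continuous; first exact: fst_continuous.
    apply: (@continuous_comp _ _ _ snd m); [exact: snd_continuous|exact: mc].
  by have [] := sh2 _ (kU _ tt).
split.
- move=> t; case: (ltgtP t t1) => tt.
  + apply: near_eq_continuous (k1 t).
    have : nbhs (s, t) [set p : R * R | p.2 < t1].
      by apply: (@snd_continuous R R (s, t) [set u | u < t1]); exact: lt_nbhsl.
    by apply: filterS => p hp; rewrite /G' (ltW hp).
  + apply: near_eq_continuous (shc _ (ltW tt)).
    have : nbhs (s, t) [set p : R * R | t1 < p.2].
      by apply: (@snd_continuous R R (s, t) [set u | t1 < u]); exact: lt_nbhsr.
    by apply: filterS => p hp; rewrite /G' leNgt hp.
  + rewrite tt; apply: paste_continuous => //; first by apply: shc.
    by rewrite /= m1.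
- by rewrite /G' /= t10.
- move=> t /andP[t0 tt2]; rewrite /G' /=; case: (leP t t1) => tt.
    by rewrite k3// t0.
  have mt : m t = t by rewrite /m min_l.
  by have [-> _] := sh2 _ (kU _ (ltW tt)); rewrite mt.
Unshelve. all: by end_near.
Qed.

Lemma lifts_exists (g : R -> X) y : continuous g -> q y = g 0 -> exists y', lifts g y y'.
Proof.
move=> gc gy.
have [|||G hG] := @lift_family (g \o snd) (fun=> y) 0.
- by move=> p; apply: continuous_comp; [exact: snd_continuous|exact: gc].
- by move=> s; exact: cvg_cst.
- by [].
have [h1 h2 h3] := nbhs_singleton hG.
exists (G (0, 1)), (fun t => G (0, t)); split => //.
move=> t; apply: (@continuous_comp _ _ _ (fun t : R => (0 : R, t)) G); last exact: h1.
by apply: pair_continuous; [exact: cvg_cst|exact: cvg_id].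
Qed.

End Covering.

(** * Monodromy and deck transformations *)

Section Monodromy.
Context {R : realType} {X Y : topologicalType}.
Variable q : Y -> X.
Hypothesis qcov : covering q.
Hypothesis sc : @simply_connected R Y.
Local Notation lifts := (@lifts R X Y q).

Lemma is_path_ext (g : R -> Y) y y' : is_path g y y' ->
  [/\ continuous (g \o clamp), (g \o clamp) 0 = y & (g \o clamp) 1 = y'].
Proof.
by move=> [gc g0 g1]; split; rewrite /= ?clamp0 ?clamp1//; exact: clamp_ext_continuous.
Qed.

Lemma path_exists y y' : exists g : R -> Y, [/\ continuous g, g 0 = y & g 1 = y'].
Proof. by have [g /is_path_ext[]] := sc.1 y y'; exists (g \o clamp). Qed.

(** Contract the loop in [Y] and lift the projected homotopy from [y1]. The endpoints of the lifts
    all lie over [q y], hence are locally constant in [s]; at [s = 1] the path is constant and its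
    lift ends at [y1]. *)
Lemma lifts_loop (g : R -> Y) y y1 : continuous g -> g 0 = y -> g 1 = y ->
  q y1 = q y -> lifts (q \o g) y1 y1.
Proof.
move=> gc g0 g1 qy1; have [qc qh qe] := qcov.
have [H [Hc H0 H1]] : path_homotopic g (cst y).
  by apply: sc.2; split => //; exact: continuous_within01.
pose K (p : R * R) := q (H (clamp p.1, clamp p.2)).
have Kc : continuous K.
  move=> p; apply: (@continuous_comp _ _ _ (fun p => H (clamp p.1, clamp p.2)) q).
    exact: clamp2_ext_continuous.
  exact: qc.
have i0 : (0 : R) \in `[0, 1] by rewrite in_itv /= ler01 lexx.
have i1 : (1 : R) \in `[0, 1] by rewrite in_itv /= ler01 lexx.
have K0 s : K (s, 0) = q y by rewrite /K /= clamp0 (H1 _ (clamp_itv s)).1 g0.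
have K1 s : K (s, 1) = q y by rewrite /K /= clamp1 (H1 _ (clamp_itv s)).2 g1.
suff : forall s, s \in `[0, 1] -> lifts (fun t => K (s, t)) y1 y1.
  move=> /(_ 0 i0)[gt [h1 h2 h3 h4]]; exists gt; split => // t t01.
  by rewrite h4// /K /= clamp0 (clamp_id t01) (H0 _ t01).1.
have loc (s0 : R) : exists e, \forall s \near s0, lifts (fun t => K (s, t)) y1 e.
  have [|||G hG] := @lift_family _ _ _ q qcov K (fun=> y1) s0.
  - exact: Kc.
  - by move=> s; exact: cvg_cst.
  - by move=> s; rewrite K0.
  have [g1' _ g3] := nbhs_singleton hG.
  have [U [Uo Ux Ue]] := qe (q y).
  have UG : U (q (G (s0, 1))) by rewrite g3// K1.
  have [sh [sh1 sh2 sh3]] := sheet Ue UG.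
  have n1 : nbhs s0 ((fun s => G (s, 1)) @^-1` [set y | U (q y) -> sh (q y) = y]).
    have cc : {for s0, continuous (fun s : R => G (s, 1))}.
      apply: (@continuous_comp _ _ _ (fun s : R => (s, 1 : R)) G); last exact: g1'.
      by apply: pair_continuous; [exact: cvg_id|exact: cvg_cst].
    by apply: cc.
  exists (sh (q y)); near=> s.
  have [k1 k2 k3] : [/\ forall t, {for (s, t), continuous G}, G (s, 0) = y1 &
        forall t, t \in `[0, 1] -> q (G (s, t)) = K (s, t)] by near: s.
  exists (fun t => G (s, t)); split => //.
    move=> t; apply: (@continuous_comp _ _ _ (fun t : R => (s, t)) G); last exact: k1.
    by apply: pair_continuous; [exact: cvg_cst|exact: cvg_id].
  have : U (q (G (s, 1))) -> sh (q (G (s, 1))) = G (s, 1) by near: s.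
  by rewrite k3// K1 => ->.
apply: (@connected_forall _ (`[0, 1]%classic : set R)
   (fun s => lifts (fun t => K (s, t)) y1 y1)).
- exact: segment_connected.
- exists 1 => //; exists (fun=> y1); split => //.
    by move=> t; exact: cvg_cst.
  by move=> t t01; rewrite /K /= clamp1 (clamp_id t01) (H0 _ t01).2 qy1.
- move=> s0 _ h0; have [e he] := loc s0.
  have ey := lifts_unique qcov (nbhs_singleton he) h0.
  by apply: filterS he => s; rewrite ey.
- move=> s0 _ h0; have [e he] := loc s0.
  have e0 := nbhs_singleton he; apply: filterS he => s hs _ h; apply: h0.
  rewrite -[X in lifts _ _ X](lifts_unique qcov hs h).
Unshelve. all: by end_near.
Qed.

Lemma path_concat_continuous (Z : topologicalType) (f g : R -> Z) :
  continuous f -> continuous g -> f 1 = g 0 -> continuous (path_concat f g).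
Proof.
move=> fc gc fg t.
have fc' : {for t, continuous (fun t : R => f (2 * t))}.
  apply: (@continuous_comp _ _ _ (fun t : R => 2 * t) f); last exact: fc.
  exact: mulrl_continuous.
have gc' : {for t, continuous (fun t : R => g (2 * t - 1))}.
  apply: (@continuous_comp _ _ _ (fun t : R => 2 * t - 1) g); last exact: gc.
  by apply: cvgB; [exact: mulrl_continuous|exact: cvg_cst].
case: (ltgtP t 2^-1) => tt.
- apply: near_eq_continuous fc'.
  by have := lt_nbhsl tt; apply: filterS => u hu; rewrite /path_concat ltW.
- apply: near_eq_continuous gc'.
  by have := lt_nbhsr tt; apply: filterS => u hu; rewrite /path_concat leNgt hu.
- have e : f (2 * t) = g (2 * t - 1) by rewrite tt mulfV ?pnatr_eq0// subrr.
  have h := paste_continuous (P := fun t : R => t <= 2^-1) fc' gc' e.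
  exact h.
Qed.

Lemma path_concatl (Z : topologicalType) (f g : R -> Z) t : t \in `[0, 1] ->
  path_concat f g (t / 2) = f t.
Proof.
rewrite in_itv /= => /andP[_ t1]; rewrite /path_concat ifT.
  by congr f; field.
by rewrite ler_pdivrMr// mulVf.
Qed.

Lemma path_concatr (Z : topologicalType) (f g : R -> Z) t : f 1 = g 0 -> t \in `[0, 1] ->
  path_concat f g ((1 + t) / 2) = g t.
Proof.
move=> fg; rewrite in_itv /= => /andP[t0 _]; rewrite /path_concat.
case: ifPn => [h|_]; last by congr g; field.
have -> : t = 0.
  apply/eqP; rewrite eq_le t0 andbT; move: h; lra.
by rewrite -fg; congr f; field.
Qed.

Lemma half_itv (t : R) : t \in `[0, 1] -> t / 2 \in `[0, 1] /\ (1 + t) / 2 \in `[0, 1].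
Proof. by rewrite !in_itv /= => /andP[t0 t1]; split; apply/andP; split; lra. Qed.

Lemma lifts_concat (g h : R -> Y) y1 y2 y3 : g 1 = h 0 ->
  lifts (q \o g) y1 y2 -> lifts (q \o h) y2 y3 -> lifts (q \o path_concat g h) y1 y3.
Proof.
move=> gh [gt [c1 gt0 gt1 gq]] [ht [c2 ht0 ht1 hq]].
have e1 : gt 1 = ht 0 by rewrite gt1 ht0.
exists (path_concat gt ht); split.
- exact: path_concat_continuous.
- have := @path_concatl _ gt ht 0; rewrite mul0r => ->//.
  by rewrite in_itv /= lexx ler01.
- have := @path_concatr _ gt ht 1 e1; rewrite (_ : (1 + 1) / 2 = 1); last by field.
  by move=> ->//; rewrite in_itv /= lexx ler01.
- move=> t; rewrite in_itv /= => /andP[t0 t1]; rewrite /path_concat /=.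
  case: ifPn => h2; first by apply: gq; rewrite in_itv /=; apply/andP; split; lra.
  by apply: hq; rewrite in_itv /= -ltNge in h2 *; apply/andP; split; lra.
Qed.

(** [e] is the image of [y] under the deck transformation to be built, which sends [y0] to [y1]. *)
Definition transport (y0 y1 y e : Y) : Prop := exists g : R -> Y,
  [/\ continuous g, g 0 = y0, g 1 = y & lifts (q \o g) y1 e].

Lemma transport_total y0 y1 y : q y0 = q y1 -> exists e, transport y0 y1 y e.
Proof.
move=> e01; have [g [gc g0 g1]] := path_exists y0 y.
have [qc _ _] := qcov.
have [||e he] := @lifts_exists R _ _ q qcov (q \o g) y1.
- by move=> t; apply: continuous_comp; [exact: gc|exact: qc].
- by rewrite /= g0.
by exists e, g.
Qed.

(** One path followed by the reverse of the other is a loop, and its projection lifts to a loop at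
    [y1]. The two halves of that lift, the second one reversed, are the lifts of the two paths, and
    they share the middle point. *)
Lemma transport_unique y0 y1 y e e' : q y0 = q y1 ->
  transport y0 y1 y e -> transport y0 y1 y e' -> e = e'.
Proof.
move=> e01 [g [gc g0 g1 ge]] [h [hc h0 h1 he]].
pose hr t := h (1 - t).
have hrc : continuous hr.
  move=> t; apply: (@continuous_comp _ _ _ (fun t : R => 1 - t) h); last exact: hc.
  by apply: cvgB; [exact: cvg_cst|exact: cvg_id].
have ghr : g 1 = hr 0 by rewrite /hr subr0 h1.
have i0 : (0 : R) \in `[0, 1] by rewrite in_itv /= ler01 lexx.
have i1 : (1 : R) \in `[0, 1] by rewrite in_itv /= ler01 lexx.
have : lifts (q \o path_concat g hr) y1 y1.
  apply: (@lifts_loop _ y0) => //.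
  - exact: path_concat_continuous.
  - by have := @path_concatl _ g hr 0 i0; rewrite mul0r => ->.
  - have := @path_concatr _ g hr 1 ghr i1; rewrite (_ : (1 + 1) / 2 = 1); last by field.
    by move=> ->; rewrite /hr subrr.
move=> [G [Gc G0 G1 Gq]].
have GL : lifts (q \o g) y1 (G (1 / 2)).
  exists (fun t => G (t / 2)); split => //.
  - move=> t; apply: (@continuous_comp _ _ _ (fun t : R => t / 2) G); last exact: Gc.
    exact: mulrr_continuous.
  - by rewrite mul0r.
  - by move=> t t01; rewrite Gq /= ?path_concatl//; exact: (half_itv t01).1.
have HL : lifts (q \o h) y1 (G (1 / 2)).
  exists (fun t => G (1 - t / 2)); split => //.
  - move=> t; apply: (@continuous_comp _ _ _ (fun t : R => 1 - t / 2) G); last exact: Gc.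
    by apply: cvgB; [exact: cvg_cst|exact: mulrr_continuous].
  - by rewrite mul0r subr0.
  - by congr G; field.
  - move=> t t01; have t01' : 1 - t \in `[0, 1].
      by move: t01; rewrite !in_itv /= => /andP[? ?]; apply/andP; split; lra.
    have -> : 1 - t / 2 = (1 + (1 - t)) / 2 by field.
    rewrite Gq; last exact: (half_itv t01').2.
    by rewrite /= path_concatr// /hr subKr.
by rewrite (lifts_unique qcov ge GL) (lifts_unique qcov he HL).
Qed.

Lemma transport_q y0 y1 y e : transport y0 y1 y e -> q e = q y.
Proof.
move=> [g [gc g0 g1 [gt [_ _ <- h]]]].
by rewrite h /= ?g1// in_itv /= ler01 lexx.
Qed.

Lemma transport_sym y0 y1 y e : q y0 = q y1 -> transport y0 y1 y e -> transport y1 y0 e y.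
Proof.
move=> e01 [g [gc g0 g1 [gt [gtc gt0 gt1 gtq]]]]; exists gt; split => //.
by exists g; split => // t t01; rewrite /= gtq.
Qed.

Hypothesis lpc : forall y (W : set Y), nbhs y W -> \forall y' \near y,
  exists g : R -> Y, [/\ continuous g, g 0 = y, g 1 = y' & forall t, W (g t)].

(** Near [y] the map coincides with [s \o q] for the section [s] through [T y]: prolong the path
    ending at [y] by a short one over [U]. *)
Lemma transport_continuous y0 y1 (T : Y -> Y) : q y0 = q y1 ->
  (forall y, transport y0 y1 y (T y)) -> continuous T.
Proof.
move=> e01 hT y; have [qc qh qe] := qcov.
have [U [Uo Ux Ue]] := qe (q (T y)).
have [s [s1 s2 s3]] := sheet Ue Ux.
have qT := transport_q (hT y); rewrite qT in Ux s1.
have nU : nbhs y (q @^-1` U) by apply: qc; move: Uo; rewrite openE; apply.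
apply: (@near_eq_continuous _ _ (s \o q)); last first.
  apply: continuous_comp; first exact: qc.
  by have [] := s2 _ Ux.
apply: filterS (lpc nU) => y' [b [bc b0 b1 bU]].
apply: (@transport_unique y0 y1 y') => //.
have [g [gc g0 g1 ge]] := hT y.
have gb : g 1 = b 0 by rewrite g1 b0.
have i0 : (0 : R) \in `[0, 1] by rewrite in_itv /= ler01 lexx.
have i1 : (1 : R) \in `[0, 1] by rewrite in_itv /= ler01 lexx.
exists (path_concat g b); split.
- exact: path_concat_continuous.
- by have := @path_concatl _ g b 0 i0; rewrite mul0r => ->.
- have := @path_concatr _ g b 1 gb i1; rewrite (_ : (1 + 1) / 2 = 1); last by field.
  by move=> ->.
apply: lifts_concat gb ge _.
exists (s \o (q \o b)); split.
- move=> t; apply: continuous_comp; last by have [] := s2 _ (bU t).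
  by apply: continuous_comp; [exact: bc|exact: qc].
- by rewrite /= b0 s1.
- by rewrite /= b1.
- by move=> t _ /=; have [] := s2 _ (bU t).
Qed.

(** The inverse is the transport with [y0] and [y1] exchanged, since a path and its lift play
    symmetric roles. *)
Lemma deck_exists y0 y1 : q y0 = q y1 -> exists T T' : Y -> Y,
  [/\ T y0 = y1, cancel T T', cancel T' T, continuous T &
      continuous T' /\ forall y, q (T y) = q y].
Proof.
move=> e01; have e10 : q y1 = q y0 by [].
have [T hT] := choice (fun y => transport_total y e01).
have [T' hT'] := choice (fun y => transport_total y e10).
exists T, T'; split.
- apply: (transport_unique e01 (hT y0)); exists (fun=> y0); split => //.
    by move=> t; exact: cvg_cst.
  by exists (fun=> y1); split => // t; exact: cvg_cst.
- by move=> y; apply: (transport_unique e10 (hT' _)); exact: transport_sym.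
- by move=> y; apply: (transport_unique e01 (hT _)); exact: transport_sym.
- exact: (transport_continuous e01).
- split; first exact: (transport_continuous e10).
  by move=> y; exact: transport_q (hT y).
Qed.

End Monodromy.

Lemma nbhs_normedP (K : numFieldType) (V : normedModType K) (p : V) (W : set V) :
  nbhs p W <-> exists2 e : K, 0 < e & forall x, `|p - x| < e -> W x.
Proof.
split=> [/nbhs_ballP[e e0 h]|[e e0 h]].
  by exists e => // x hx; apply: h; rewrite -ball_normE.
by apply/nbhs_ballP; exists e => // x; rewrite -ball_normE => /h.
Qed.

(** * Coverings of complex manifolds *)

Section ManifoldCovering.
Context {R : realType} {n : nat}.
Local Notation C := (Cx R).

Lemma r2c_continuous : continuous (@r2c R).
Proof.
move=> x W /nbhs_cmodP[e e0 he]; apply/nbhs_ballP; exists e => //= y.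
rewrite -ball_normE /ball_ /= => hy; apply: he.
by rewrite /r2c -rmorphB cmod_r2c distrC.
Qed.

Lemma norm_r2c_le1 (t : R) : t \in `[0, 1] -> `|r2c t| <= 1 :> C.
Proof.
rewrite in_itv /= => /andP[t0 t1]; rewrite normE cmod_r2c ger0_norm// /r2c.
by rewrite (lecR t 1).
Qed.

Lemma chart_nbhs (Y : cmanifold R n) (i : chart_index Y) y (W : set Y) :
  chart_dom i y -> nbhs y W ->
  exists2 e : C, 0 < e & forall p, `|chart i y - p| < e ->
    exists z, [/\ chart_dom i z, chart i z = p, chart_inv i p = z & W z].
Proof.
move=> iy Wy.
have n1 : nbhs (chart i y) (chart_inv i @^-1` W).
  by apply: (chart_inv_continuous iy); rewrite chartK.
have n2 : nbhs (chart i y) (chart i @` chart_dom i).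
  by apply: open_nbhs_nbhs; split; [exact: open_chart_image|exists y].
have /nbhs_normedP[e e0 he] : nbhs (chart i y) (chart_inv i @^-1` W `&` chart i @` chart_dom i).
  exact: filterI n1 n2.
exists e => // p /he[h [z iz zp]].
by exists z; rewrite -zp chartK//; split => //; move: h; rewrite /= -zp chartK.
Qed.

Lemma chart_near (Y : cmanifold R n) (i : chart_index Y) y (e : C) :
  chart_dom i y -> 0 < e ->
  \forall z \near y, chart_dom i z /\ `|chart i y - chart i z| < e.
Proof.
move=> iy e0.
have h : nbhs (chart i y) (fun p => `|chart i y - p| < e).
  by apply/nbhs_normedP; exists e.
have n1 : nbhs y (fun z => `|chart i y - chart i z| < e).
  exact: (chart_continuous iy h).
have n2 : nbhs y (chart_dom i).
  by apply: open_nbhs_nbhs; split => //; exact: open_chart_dom.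
exact: filterI n2 n1.
Qed.

(** Straight segments in a chart; this supplies the hypothesis [lpc] of the monodromy argument. *)
Lemma cmanifold_path (Y : cmanifold R n) (y : Y) (W : set Y) : nbhs y W ->
  \forall y' \near y, exists g : R -> Y,
    [/\ continuous g, g 0 = y, g 1 = y' & forall t, W (g t)].
Proof.
move=> Wy; have [i iy] := chart_cover y.
have [e e0 he] := chart_nbhs iy Wy.
apply: filterS (chart_near iy e0) => y' [iy' hy'].
pose v := chart i y' - chart i y.
pose p (t : R) := chart i y + r2c (clamp t) *: v.
have hp t : `|chart i y - p t| < e.
  rewrite /p opprD addNKr normrN normrZ; apply: le_lt_trans hy'.
  rewrite distrC; apply: ler_piMl => //; exact/norm_r2c_le1/clamp_itv.
exists (fun t => chart_inv i (p t)); split.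
- move=> t; apply: (@continuous_comp _ _ _ p (chart_inv i)).
    rewrite /p; apply: cvgD; first exact: cvg_cst.
    apply: cvgZr_tmp.
    apply: (@continuous_comp _ _ _ clamp (@r2c R)); first exact: clamp_continuous.
    exact: r2c_continuous.
  have [z [iz <- _ _]] := he _ (hp t); exact: chart_inv_continuous.
- by rewrite /p clamp0 /r2c scale0r addr0 chartK.
- by rewrite /p clamp1 /r2c scale1r /v subrKC chartK.
- by move=> t; have [z [_ _ -> ]] := he _ (hp t).
Qed.

Context {Mt M : cmanifold R n}.
Variable q : Mt -> M.

Lemma holo_covering_covering : holo_covering q -> covering q.
Proof.
move=> [qh qs qe]; split.
- by move=> y; have [] := qh y.
- exact: cmanifold_hausdorff.
- move=> x; have [U [K [s [[Uo Ux] so sq su sy]]]] := qe x.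
  exists U; split => //; exists K, s; split => //.
  by move=> k z Uz; have [-> []] := sq k z Uz.
Qed.

Hypothesis quc : universal_covering q.

Lemma deck_transitive y0 y1 : q y0 = q y1 ->
  exists2 T, deck_transformation q T & T y0 = y1.
Proof.
move=> e01; have [T [T' [h1 h2 h3 h4 [h5 h6]]]] :=
  deck_exists (holo_covering_covering quc.1) quc.2 (@cmanifold_path Mt) e01.
by exists T => //; exists T'; split.
Qed.

End ManifoldCovering.

(** * Gluing matrices and the image of the representation *)

Section FlatGlue.
Context {R : realType} {n r : nat} {Mt M : cmanifold R n}.
Variables (q : Mt -> M) (x0 : M) (y0 : Mt).
Hypotheses (quc : universal_covering q) (hy0 : q y0 = x0).
Variable rho : @unitary_rep R M x0 r.
Local Notation C := (Cx R).
Local Notation V := (flat_bundle q y0 rho).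
Local Notation glueV := (@Defs.glue R n r V).

Lemma proj_loop (T : Mt -> Mt) (gt : R -> Mt) : deck_transformation q T ->
  is_path gt y0 (T y0) -> is_path (q \o gt) x0 x0.
Proof.
move=> [T' [_ _ _ _ qT]] [gc g0 g1].
have [qc _ _] := holo_covering_covering quc.1.
split; rewrite /= ?g0 ?g1 ?qT//.
move/subspace_continuousP : gc => gc; apply/subspace_continuousP => t t01.
apply: (@cvg_comp _ _ _ gt q); first exact: gc.
exact: qc.
Qed.

Lemma glue_unitary y y' A : glueV y y' A -> A \is unitarymx.
Proof.
by move=> [T [gt [dT hg _ ->]]]; apply: rep_unitary; exact: proj_loop dT hg.
Qed.

Lemma glue_image y y' A : glueV y y' A -> rep_image rho A.
Proof. by move=> [T [gt [dT hg _ ->]]]; exists (q \o gt) => //; exact: proj_loop dT hg. Qed.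

Lemma glue_fibre y y' : q y = q y' -> exists A, glueV y y' A.
Proof.
move=> e; have [T dT Ty] := deck_transitive quc e.
have [g hg] := quc.2.1 y0 (T y0).
by exists (rho (q \o g)), T, g; split.
Qed.

(** A representation takes functions on all of [R]; this homotopy allows a loop to be replaced by
    its clamped form or by the projection of its lift. *)
Lemma path_homotopic_id01 (X : topologicalType) (f g : R -> X) :
  {within `[0, 1], continuous f} ->
  (forall t, t \in `[0, 1] -> f t = g t) -> path_homotopic f g.
Proof.
move=> fc fg; exists (fun p => f (clamp p.2)); split.
- apply: continuous_subspaceT => p.
  apply: (@continuous_comp _ _ _ snd (f \o clamp)); first exact: snd_continuous.
  exact: clamp_ext_continuous.
- by move=> t t01; rewrite /= clamp_id// -fg.
- by move=> s s01; rewrite /= clamp0 clamp1.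
Qed.

(** The lift from [y0] of a loop of matrix [A] ends in the fibre of [y0], and a deck transformation
    reaches that end. One [T] serves all [y]. *)
Lemma image_glue A : rep_image rho A -> exists2 T, deck_transformation q T &
  forall y, glueV y (T y) A.
Proof.
move=> [g pg <-]; have [gc g0 g1] := is_path_ext pg.
have qcov := holo_covering_covering quc.1.
have [|y1 [gt [gtc gt0 gt1 gtq]]] := lifts_exists qcov (y := y0) gc.
  by rewrite hy0 g0.
have i1 : (1 : R) \in `[0, 1] by rewrite in_itv /= ler01 lexx.
have qy1 : q y0 = q y1 by rewrite -gt1 gtq// g1.
have [T dT Ty] := deck_transitive quc qy1.
have pgt : is_path gt y0 (T y0).
  by split; rewrite ?gt0 ?gt1 ?Ty//; exact: continuous_within01.
exists T => // y; exists T, gt; split => //.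
apply: rep_homotopic => //; first exact: proj_loop dT pgt.
have [gc' _ _] := pg.
by apply: path_homotopic_id01 => // t t01; rewrite /= gtq//= clamp_id.
Qed.

(** The constant loop concatenated with itself is the same function, so its matrix is idempotent,
    and it is invertible. *)
Lemma rep_cst : rho (cst x0) = 1%:M.
Proof.
have pc : is_path (cst x0 : R -> M) x0 x0.
  by split => //; apply: continuous_within01 => t; exact: cvg_cst.
have := rep_concat rho pc pc.
have -> : path_concat (cst x0 : R -> M) (cst x0) = cst x0.
  by apply/funext => t; rewrite /path_concat if_same.
have /unitarymx_unit u := rep_unitary rho pc.
move=> e; apply: (can_inj (mulKmx u)); by rewrite mulmx1 -e.
Qed.

Lemma glue_refl y : glueV y y 1%:M.
Proof.
exists id, (cst y0); split => //.
- by exists id; split => // ?; exact: cvg_id.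
- by split => //; apply: continuous_within01 => t; exact: cvg_cst.
- by rewrite -rep_cst; congr (rep rho _); apply/funext => t /=.
Qed.

End FlatGlue.

(** * Semi-ampleness and finiteness *)

Lemma line_continuous (K : numFieldType) (W : normedModType K) (p v : W) :
  continuous (fun t : K => p + t *: v).
Proof.
move=> z; apply: (@continuousD K W K (fun=> p) (fun t => t *: v)).
  exact: cst_continuous.
exact: scalel_continuous.
Qed.

(** * Restriction to complex lines *)

Section Lines.
Context {R : realType}.
Local Notation C := (Cx R).

Lemma differentiable_cdiff (W : normedModType C) (f : W -> C) (p v : W) (z : C) :
  differentiable f (p + z *: v) -> cdiff_at (fun t => f (p + t *: v)) z.
Proof.
move=> /(@diff_derivable _ _ _ _ _ v) /cvg_ex[a ha].
exists a => e e0.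
have : nbhs a [set w : C | cmod (w - a) < e] by apply/nbhs_cmodP; exists e.
move=> /ha; rewrite nbhs_filterE /= => h.
have /nbhs_cmodP[d d0 hd] : nbhs (0 : C) (fun h : C => h != 0 ->
    cmod (h^-1 *: (f (h *: v + (p + z *: v)) - f (p + z *: v)) - a) < e).
  by have := h; rewrite /nbhs /= /dnbhs /within.
exists d => // y hy; have [->|yz] := eqVneq y z.
  by rewrite !subrr mulr0 subr0 cmod0 mulr0.
have yz0 : y - z != 0 by rewrite subr_eq0.
have := hd (y - z); rewrite subr0 => /(_ hy yz0) => /ltW.
have -> : (y - z) *: v + (p + z *: v) = p + y *: v.
  by rewrite addrCA -scalerDl subrK.
set D := _ - f _ => hD.
have -> : D - a * (y - z) = ((y - z)^-1 *: D - a) * (y - z).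
  rewrite mulrBl; congr (_ - _).
  by rewrite /GRing.scale /= mulrAC mulVf// mul1r.
by rewrite cmodM ler_wpM2r// cmod_ge0.
Qed.

(* Continuity at p of f is enough there: the maximum modulus principle at the
   centre of a disc does not use differentiability at the centre. *)
Lemma maximum_modulus_near (W : normedModType C) (f : W -> C) (p : W) :
  {for p, continuous f} -> (\forall x \near p^', differentiable f x) ->
  (\forall x \near p, cmod (f x) <= cmod (f p)) ->
  \forall x \near p, f x = f p.
Proof.
move=> fc fd fm.
have : nbhs p (fun x => (x != p -> differentiable f x) /\ cmod (f x) <= cmod (f p)).
  have fd' : nbhs p (fun x => x != p -> differentiable f x) by [].
  exact: filterI fd' fm.
move=> /nbhs_ballP[e /= e0 he]; apply/nbhs_ballP.
have e2 : 0 < e / 4 by rewrite divr_gt0.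
exists (e / 4) => // x; rewrite -ball_normE /ball_ /= => hx.
have [->//|xp] := eqVneq x p.
pose v := x - p; have v0 : v != 0 by rewrite subr_eq0.
have in_ball (t : C) : cmod t < 4 -> ball p e (p + t *: v).
  move=> t4; rewrite -ball_normE /ball_ /= opprD addNKr normrN normrZ.
  have t4' : `|t| <= (4 : C).
    by rewrite normE /r2c -(rmorph_nat (real_complex R)) lecR ltW.
  apply: le_lt_trans (ler_pM (normr_ge0 _) (normr_ge0 _) t4' (lexx _)) _.
  by rewrite mulrC -ltr_pdivlMr// distrC.
have tv0 t : (p + t *: v == p) = (t == 0).
  by rewrite -subr_eq0 addrAC subrr add0r scaler_eq0 (negPf v0) orbF.
pose g : C -> C := fun t => f (p + t *: v).
have g0 : g 0 = f p by rewrite /g scale0r addr0.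
have g1 : g 1 = f x by rewrite /g scale1r /v subrKC.
have gc : {for 0, continuous g}.
  apply: (@continuous_comp _ _ _ (fun t : C => p + t *: v) f).
    exact: line_continuous.
  by rewrite scale0r addr0.
have gd (z : C) : z != 0 -> cmod z < 4 -> cdiff_at g z.
  move=> z0 z4; apply: differentiable_cdiff.
  by have [+ _] := he _ (in_ball _ z4); apply; rewrite tv0.
have gm (z : C) : cmod z < 4 -> cmod (g z) <= cmod (g 0).
  by move=> z4; rewrite g0; have [_] := he _ (in_ball _ z4).
have l1 : 2 * cmod (1 : C) < 4 by rewrite cmod1 mulr1 ltr_nat.
by rewrite -g0 -g1; exact: (maximum_modulus gc gd gm l1).
Qed.

End Lines.

Section Differentiability.
Context {K : numFieldType} {V : normedModType K}.

Lemma differentiable_bigprod (I : Type) (s : seq I) (F : I -> V -> K) x :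
  (forall i, differentiable (F i) x) ->
  differentiable (fun y => \prod_(i <- s) F i y) x.
Proof.
move=> h; elim: s => [|i s IH].
  by under eq_fun do rewrite big_nil; exact: differentiable_cst.
by under eq_fun do rewrite big_cons; apply: differentiableM.
Qed.

Lemma differentiable_bigsum (I : Type) (s : seq I) (F : I -> V -> K) x :
  (forall i, differentiable (F i) x) ->
  differentiable (fun y => \sum_(i <- s) F i y) x.
Proof.
move=> h; elim: s => [|i s IH].
  by under eq_fun do rewrite big_nil; exact: differentiable_cst.
by under eq_fun do rewrite big_cons; apply: differentiableD.
Qed.

Lemma differentiable_form r (f : V -> 'rV[K]_r) (u : 'cV[K]_r) x :
  differentiable f x -> differentiable (fun y => (f y *m u) 0 0) x.
Proof.
move=> h; under eq_fun do rewrite mxE.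
apply: differentiable_bigsum => i; apply: differentiableM; last exact: differentiable_cst.
apply: (@differentiable_comp _ _ _ _ f (fun v : 'rV[K]_r => v 0 i)) => //.
exact: differentiable_coord.
Qed.

End Differentiability.

Lemma differentiable_snd (K : numFieldType) (V W : normedModType K) (p : V * W) :
  differentiable (@snd V W) p.
Proof.
have h := @linear_differentiable K (V * W)%type W (@snd V W : {linear (V * W)%type -> W}) p.
apply: h => x.
exact: snd_continuous.
Qed.

(** * Invariant forms for a finite image *)

Section FiniteImage.
Context {R : realType} {n r : nat} {Mt M : cmanifold R n}.
Variables (q : Mt -> M) (x0 : M) (y0 : Mt).
Hypotheses (quc : universal_covering q) (hy0 : q y0 = x0).
Variable rho : @unitary_rep R M x0 r.
Local Notation C := (Cx R).
Local Notation V := (flat_bundle q y0 rho).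

Lemma rep_image_mul A B : rep_image rho A -> rep_image rho B -> rep_image rho (A *m B).
Proof.
move=> [f pf <-] [g pg <-].
have [f1 f2 f3] := is_path_ext pf; have [g1 g2 g3] := is_path_ext pg.
have pf' : is_path (f \o clamp) x0 x0 by split => //; exact: continuous_within01.
have pg' : is_path (g \o clamp) x0 x0 by split => //; exact: continuous_within01.
have E h (ph : is_path h x0 x0) : rho h = rho (h \o clamp).
  have [h1 h2 h3] := is_path_ext ph; have [hc _ _] := ph.
  apply: rep_homotopic => //; first by split => //; exact: continuous_within01.
  by apply: path_homotopic_id01 => // t t01; rewrite /= clamp_id.
rewrite (E _ pf) (E _ pg) -rep_concat//.
exists (path_concat (f \o clamp) (g \o clamp)) => //; split.
- by apply: continuous_within01; apply: path_concat_continuous; rewrite // f3 g2.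
- have := @path_concatl _ _ (f \o clamp) (g \o clamp) 0.
  by rewrite mul0r => -> //; rewrite in_itv /= lexx ler01.
- have := @path_concatr _ _ (f \o clamp) (g \o clamp) 1.
  rewrite (_ : (1 + 1) / 2 = 1 :> R); last by field.
  by move=> -> //; [rewrite f3 g2|rewrite in_itv /= lexx ler01].
Qed.

Lemma rep_image_unitary A : rep_image rho A -> A \is unitarymx.
Proof. by move=> [g pg <-]; exact: rep_unitary. Qed.

Lemma nonroot (p : {poly C}) : p != 0 -> exists t, p.[t] != 0.
Proof.
move=> p0; apply: contrapT => h.
have hr (t : C) : root p t by rewrite /root; apply: contrapT => /negP ht; apply: h; exists t.
have := @max_poly_roots _ p [seq i%:R | i <- iota 0 (size p)] p0.
rewrite size_map size_iota ltnn => F; apply/notF/F.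
  by apply/allP => x _.
rewrite map_inj_uniq ?iota_uniq// => i j /eqP; by rewrite eqr_nat => /eqP.
Qed.

Lemma finite_semi_ample : finite_set (rep_image rho) -> semi_ample V.
Proof.
move=> /finite_seqP[s0 hs]; pose s := undup s0.
have sP A : rep_image rho A <-> A \in s by rewrite hs mem_undup.
have sU A : A \in s -> A \in unitmx by move=> /sP/rep_image_unitary/unitarymx_unit.
have s1 : 1%:M \in s.
  by apply/sP; exact: (glue_image quc hy0 (glue_refl hy0 (rho := rho) y0)).
exists (size s); split; first by case: s s1 {sP sU}.
move=> y l l0.
(* A point of the moment curve: pairing [v] with it evaluates at [t] the polynomial with
   coefficients [v]. Avoiding finitely many hyperplanes becomes avoiding the roots of one nonzero
   polynomial. *)
pose mon (t : C) : 'cV[C]_r := \col_i t ^+ i.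
have monE (v : 'rV[C]_r) t : (v *m mon t) 0 0 = (rVpoly v).[t].
  rewrite (horner_coef_wide _ (size_poly _ _)) mxE.
  by apply: eq_bigr => i _; rewrite mxE coef_rVpoly_ord.
have [t ht] : exists t, (\prod_(A <- s) rVpoly (l *m A)).[t] != 0.
  apply: nonroot; rewrite prodf_seq_neq0; apply/allP => A As /=.
  rewrite -size_poly_eq0; apply: contraNN l0 => /eqP h.
  have : rVpoly (l *m A) = 0 by apply/eqP; rewrite -size_poly_eq0 h.
  move=> /(congr1 (poly_rV (d := r))); rewrite rVpolyK linear0 => e.
  by rewrite -(mulmxK (sU _ As) l) e mul0mx.
exists (fun _ v => \prod_(A <- s) (v *m A *m mon t) 0 0); last first.
  by under eq_bigr do rewrite monE; rewrite -horner_prod.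
split.
- move=> y' l' _ i _ /=; apply: differentiable_bigprod => A.
  have -> : (fun y1 : 'rV[C]_n * 'rV[C]_r => (y1.2 *m A *m mon t) 0 0) =
     (fun y1 => (y1.2 *m (A *m mon t)) 0 0).
    by apply/funext => z; rewrite mulmxA.
  by apply: differentiable_form; exact: differentiable_snd.
- move=> y' l' c _ _.
  under eq_bigr => A _ do rewrite -!scalemxAl mxE.
  by rewrite big_split /= big_const_seq count_predT iter_mulr_1.
- move=> y1 y2 A l' /(glue_image quc hy0)/sP As l'0.
  have AU := sU _ As.
  (* Left multiplication by [A] is injective and maps the finite set [s] into itself, so it permutes
     the factors. *)
  have pe : perm_eq [seq A *m B | B <- s] s.
    have us : uniq [seq A *m B | B <- s].
      by rewrite map_inj_uniq ?undup_uniq//; exact: can_inj (mulKmx AU).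
    apply: uniq_perm => //; first exact: undup_uniq.
    have ss : {subset [seq A *m B | B <- s] <= s}.
      by move=> _ /mapP[B Bs ->]; apply/sP; apply: rep_image_mul; apply/sP.
    by have [] := uniq_min_size us ss; rewrite ?size_map.
  rewrite -[RHS](perm_big _ pe) big_map; apply: eq_bigr => B _.
  by rewrite (mulmxA l').
Qed.

End FiniteImage.

(** * A real-valued norm on row vectors *)

Section SumNorm.
Context {R : realType} {n : nat}.
Local Notation C := (Cx R).

Implicit Types u v w p : 'rV[C]_n.

Definition n1 (v : 'rV[C]_n) : R := \sum_j cmod (v 0 j).

Lemma n1_ge0 v : 0 <= n1 v. Proof. by apply: sumr_ge0 => j _; exact: cmod_ge0. Qed.

Lemma cmod_le_n1 v j : cmod (v 0 j) <= n1 v.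
Proof.
by rewrite /n1 (bigD1 j)//= lerDl; apply: sumr_ge0 => i _; exact: cmod_ge0.
Qed.

Lemma n1D u v : n1 (u + v) <= n1 u + n1 v.
Proof. by rewrite -big_split /=; apply: ler_sum => j _; rewrite mxE cmodD. Qed.

Lemma n1N v : n1 (- v) = n1 v.
Proof. by apply: eq_bigr => j _; rewrite mxE cmodN. Qed.

Lemma n1B u v : n1 (u - v) = n1 (v - u). Proof. by rewrite -n1N opprB. Qed.

Lemma n10 : n1 0 = 0.
Proof. by rewrite /n1 big1// => j _; rewrite mxE cmod0. Qed.

Lemma n1_gt0 v : v != 0 -> 0 < n1 v.
Proof.
move=> /eqP v0; rewrite lt_def n1_ge0 andbT; apply/eqP => h; apply: v0.
apply/rowP => j; rewrite mxE; apply/eqP; rewrite -cmod_eq0 eq_le cmod_ge0 andbT.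
by rewrite -h cmod_le_n1.
Qed.

Lemma nbhs_n1P (p : 'rV[C]_n) (W : set 'rV[C]_n) :
  nbhs p W <-> exists2 e : R, 0 < e & forall v, n1 (v - p) < e -> W v.
Proof.
split.
  move=> [P hP PW].
  have /choice[d hd] : forall j, exists d : R, 0 < d /\
      forall y, cmod (y - p 0 j) < d -> P 0 j y.
    by move=> j; have /nbhs_cmodP[d d0 h] := hP 0 j; exists d.
  exists (\big[Num.min/1]_j d j).
    by elim/big_ind: _ => // [x y x0 y0|j _]; [rewrite lt_min x0|case: (hd j)].
  move=> v hv; apply: PW => i j; rewrite (ord1 i); apply: (hd j).2.
  apply: le_lt_trans (lt_le_trans hv _); last exact: bigmin_le_cond.
  by have := cmod_le_n1 (v - p) j; rewrite !mxE.
move=> [e e0 h].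
have en : 0 < e / n.+1%:R by rewrite divr_gt0.
exists (fun i j => [set z | cmod (z - p i j) < e / n.+1%:R]).
  by move=> i j; apply/nbhs_cmodP; exists (e / n.+1%:R).
move=> v hv; apply: h; apply: (@le_lt_trans _ _ (n%:R * (e / n.+1%:R))).
  have -> : n%:R * (e / n.+1%:R) = \sum_(j < n) (e / n.+1%:R).
    by rewrite sumr_const card_ord mulr_natl.
  by apply: ler_sum => j _; rewrite !mxE ltW//; exact: (hv 0 j).
by rewrite mulrCA -[ltRHS]mulr1 ltr_pM2l// ltr_pdivrMr// mul1r ltr_nat.
Qed.

Lemma n1_dist_continuous p : continuous (fun v => n1 (v - p)).
Proof.
move=> w W /nbhs_ballP[e /= e0 he]; apply/nbhs_n1P; exists e => // v hv.
have /nbhs_ballP : nbhs (n1 (w - p)) W by apply/nbhs_ballP; exists e.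
move=> _; apply: he; rewrite -ball_normE /ball_ /= distrC; apply: le_lt_trans hv.
have h1 : n1 (v - p) <= n1 (v - w) + n1 (w - p).
  by rewrite -[X in n1 X <= _](subrKA w) n1D.
have h2 : n1 (w - p) <= n1 (v - w) + n1 (v - p).
  by rewrite (n1B v w) -[X in n1 X <= _](subrKA v) n1D.
by rewrite ler_norml; apply/andP; split; lra.
Qed.

Lemma compact_n1 p (B : R) : compact [set v | n1 (v - p) <= B].
Proof.
have := @rV_compact _ n (fun j => cdisc (p 0 j) B) (fun j => @compact_cdisc R (p 0 j) B).
move=> h; apply: (subclosed_compact _ h).
  rewrite (_ : mkset _ = (fun v => n1 (v - p)) @^-1` [set x | x <= B]) //.
  by apply: closed_comp; [move=> v _; exact: n1_dist_continuous|exact: closed_le].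
by move=> v /= hv j; apply: le_trans hv; have := cmod_le_n1 (v - p) j; rewrite !mxE.
Qed.

End SumNorm.

(** * A compact set upstairs that covers the base *)

Section CompactSection.
Context {R : realType} {n : nat} {Mt M : cmanifold R n}.
Variable q : Mt -> M.
Hypothesis qcov : holo_covering q.
Local Notation C := (Cx R).

Lemma compact_nbhs (Y : cmanifold R n) (y : Y) : exists2 K, compact K & nbhs y K.
Proof.
have [i iy] := chart_cover y.
have : nbhs (chart i y) (chart i @` chart_dom i).
  by apply: open_nbhs_nbhs; split; [exact: open_chart_image|exists y].
move=> /nbhs_n1P[e e0 he]; have e2 : 0 < e / 2 by rewrite divr_gt0.
have ee : e / 2 < e by rewrite ltr_pdivrMr// ltr_pMr// ltr1n.
exists (chart_inv i @` [set v | n1 (v - chart i y) <= e / 2]).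
  apply: continuous_compact; last exact: compact_n1.
  apply: continuous_in_subspaceT => v /set_mem /= hv.
  have [z iz <-] := he v (le_lt_trans hv ee); exact: chart_inv_continuous.
have n1' : nbhs y (fun z => n1 (chart i z - chart i y) < e / 2).
  have h : nbhs (chart i y) (fun p => n1 (p - chart i y) < e / 2).
    by apply/nbhs_n1P; exists (e / 2).
  exact: (chart_continuous iy h).
have n2 : nbhs y (chart_dom i).
  by apply: open_nbhs_nbhs; split => //; exact: open_chart_dom.
apply: filterS2 n1' n2 => z hz iz; exists (chart i z); first exact: ltW.
by rewrite chartK.
Qed.

(** The filter of properties shared by all large enough compact sets. Near-covering compactness of
    [M] along it performs the finite union of local compact lifts. *)
Lemma compact_filter (T : topologicalType) : Filter
  (fun P : set (set T) => exists2 K, compact K & forall L, compact L -> K `<=` L -> P L).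
Proof.
split.
- by exists set0 => //; exact: compact0.
- move=> P Q [K Kc hK] [L Lc hL]; exists (K `|` L); first exact: compactU.
  by move=> N Nc KLN; split; [apply: hK|apply: hL] => //;
    apply: subset_trans KLN => x; [left|right].
- by move=> P Q PQ [K Kc hK]; exists K => // L Lc KL; apply: PQ; exact: hK.
Qed.

Lemma compact_lift : compact [set: M] ->
  exists2 K : set Mt, compact K & forall x, exists2 y, K y & q y = x.
Proof.
move=> /compact_near_coveringP Mc.
have [|K Kc hK] := Mc (set Mt) _ (fun K x => exists2 y, K y & q y = x)
    (@compact_filter Mt); last first.
  by exists K => // x; exact: (hK K Kc).
move=> x _; have [_ qs _] := qcov; have [y yx] := qs x.
have [K Kc Ky] := compact_nbhs y.
have [qc qh qe] := holo_covering_covering qcov.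
have [U [Uo Ux Ue]] := qe x; rewrite -yx in Ux.
have [s [s1 s2 s3]] := sheet Ue Ux.
have n1 : nbhs x (s @^-1` K).
  by rewrite -yx; apply: (s2 _ Ux).2; rewrite s1.
have n2 : nbhs x U by apply: open_nbhs_nbhs; split => //; rewrite -yx.
exists (U `&` s @^-1` K, [set L | compact L /\ K `<=` L]).
  by split; [exact: filterI|exists K].
move=> [x' L] [/= [Ux' sK] [_ KL]]; exists (s x'); first exact: KL.
by have [] := s2 _ Ux'.
Qed.

End CompactSection.

Section Unitary.
Local Open Scope sesquilinear_scope.
Context {R : realType} {r : nat}.
Local Notation C := (Cx R).
Implicit Types (A : 'M[C]_r) (v : 'rV[C]_r).

Lemma cmod_sqr (z : C) : r2c (cmod z ^+ 2) = z * z^*.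
Proof. by rewrite -normCK normE /r2c rmorphXn. Qed.

Lemma unitary_row A i : A \is unitarymx -> \sum_j cmod (A i j) ^+ 2 = 1.
Proof.
move=> /unitarymxP /matrixP /(_ i i); rewrite !mxE eqxx => h.
apply: (@complexI R); rewrite rmorph_sum rmorph1 -[RHS]h.
by apply: eq_bigr => j _; rewrite !mxE -cmod_sqr.
Qed.

Lemma unitary_entry A i j : A \is unitarymx -> cmod (A i j) <= 1.
Proof.
move=> /(@unitary_row _ i) h; rewrite -(@expr_le1 _ 2) ?cmod_ge0// -h.
by rewrite (bigD1 j)//= lerDl; apply: sumr_ge0 => k _; rewrite exprn_ge0// cmod_ge0.
Qed.

(** The entries of a unitary matrix have modulus at most 1. The constant is crude, but what matters
    is that it is uniform over the unitary group. *)
Lemma n1_mul_le A v : A \is unitarymx -> n1 (v *m A) <= r%:R * n1 v.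
Proof.
move=> uA.
apply: (@le_trans _ _ (\sum_(j < r) n1 v)); last first.
  by rewrite sumr_const card_ord mulr_natl.
apply: ler_sum => j _; rewrite mxE; apply: le_trans (cmod_sum _ _ _) _.
apply: ler_sum => i _; rewrite cmodM ler_piMr ?cmod_ge0//; exact: unitary_entry.
Qed.

Lemma n1_le_mul A v : A \is unitarymx -> n1 v <= r%:R * n1 (v *m A).
Proof.
move=> uA; have uA' : A ^t* \is unitarymx by rewrite trmxC_unitary.
have := n1_mul_le (v *m A) uA'; rewrite -mulmxA.
by move/unitarymxP: uA => ->; rewrite mulmx1.
Qed.

End Unitary.

(** * Sections of powers of the tautological bundle are constant along the cover *)

Section SectionConstant.
Context {R : realType} {n r : nat} {Mt M : cmanifold R n}.
Variables (q : Mt -> M) (x0 : M) (y0 : Mt).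
Hypotheses (quc : universal_covering q) (hy0 : q y0 = x0).
Hypothesis Mc : compact [set: M].
Variable rho : @unitary_rep R M x0 r.
Local Notation C := (Cx R).
Local Notation V := (flat_bundle q y0 rho).
Variables (m : nat) (F : Mt -> 'rV[C]_r -> C).
Hypothesis hF : @global_section R n r V m F.

Lemma section_continuous y l : l != 0 ->
  {for (y, l), continuous (fun p : Mt * 'rV[C]_r => F p.1 p.2)}.
Proof.
move=> l0; have [h _ _] := hF; have [i iy] := chart_cover y.
have hd := differentiable_continuous (h y l l0 i iy).
pose f (p : Mt * 'rV[C]_r) := (chart i p.1, p.2).
have fc : {for (y, l), continuous f}.
  apply: pair_continuous; last exact: snd_continuous.
  apply: (@continuous_comp _ _ _ fst (chart i)); first exact: fst_continuous.
  exact: chart_continuous.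
have := continuous_comp fc hd.
apply: near_eq_continuous.
have n2 : nbhs y (chart_dom i).
  by apply: open_nbhs_nbhs; split => //; exact: open_chart_dom.
have : nbhs (y, l) [set p : Mt * 'rV[C]_r | chart_dom i p.1].
  exact: (@fst_continuous Mt 'rV[C]_r (y, l) _ n2).
by apply: filterS => p ip; rewrite /f /= chartK.
Qed.

Lemma section_locally_constant y l : l != 0 ->
  (forall y', cmod (F y' l) <= cmod (F y l)) -> \forall y' \near y, F y' l = F y l.
Proof.
move=> l0 hm; have [h _ _] := hF; have [i iy] := chart_cover y.
pose f (p : 'rV[C]_n) := F (chart_inv i p) l.
have fd z : chart_dom i z -> differentiable f (chart i z).
  move=> iz; have hz := h z l l0 i iz.
  apply: (@differentiable_comp _ _ _ _ (fun p : 'rV[C]_n => (p, l))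
     (fun p : 'rV[C]_n * 'rV[C]_r => F (chart_inv i p.1) p.2)) => //.
have n2 : nbhs (chart i y) (chart i @` chart_dom i).
  by apply: open_nbhs_nbhs; split; [exact: open_chart_image|exists y].
have : \forall p \near chart i y, f p = f (chart i y).
  apply: maximum_modulus_near.
  - exact: differentiable_continuous (fd y iy).
  - by apply: (@nbhs_dnbhs _ _ _); apply: filterS n2 => p [z iz <-]; exact: fd.
  - by near=> p; rewrite /f (chartK iy).
move=> nf.
have n3 : nbhs y (fun z => f (chart i z) = f (chart i y)).
  exact: (chart_continuous iy nf).
have n4 : nbhs y (chart_dom i).
  by apply: open_nbhs_nbhs; split => //; exact: open_chart_dom.
by apply: filterS2 n3 n4 => z; rewrite /f (chartK iy) => + iz; rewrite (chartK iz).
Unshelve. all: by end_near.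
Qed.

Lemma section_max_constant y l : l != 0 ->
  (forall y', cmod (F y' l) <= cmod (F y l)) -> forall y', F y' l = F y l.
Proof.
move=> l0 hm y'; have [g [gc g0 g1]] := path_exists quc.2 y y'.
suff : forall t, t \in `[0, 1] -> F (g t) l = F y l.
  by move=> /(_ 1); rewrite g1 => -> //; rewrite in_itv /= ler01 lexx.
apply: (@connected_forall _ (`[0, 1]%classic : set R) (fun t => F (g t) l = F y l)).
- exact: segment_connected.
- by exists 0 => //; [rewrite /= in_itv /= ler01 lexx|rewrite g0].
- move=> t _ ht.
  have nh : nbhs (g t) (fun z => F z l = F (g t) l).
    by apply: section_locally_constant => // z; rewrite ht.
  have : nbhs t (fun u => F (g u) l = F (g t) l) by exact: (gc t _ nh).
  by apply: filterS => u; rewrite ht.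
- move=> t _ /eqP ht.
  have nh : nbhs (F (g t) l) (fun z => z != F y l).
    apply/nbhs_cmodP; exists (cmod (F (g t) l - F y l)).
      by rewrite cmod_gt0 subr_eq0.
    by move=> z; rewrite cmodB; apply: contraTneq => ->; rewrite ltxx.
  have cc : {for t, continuous (fun u => F (g u) l)}.
    apply: (@continuous_comp _ _ _ (fun u => (g u, l)) (fun p => F p.1 p.2)).
      by apply: pair_continuous; [exact: gc|exact: cvg_cst].
    exact: section_continuous.
  have : nbhs t (fun u => F (g u) l != F y l) by exact: (cc _ nh).
  by apply: filterS => u /eqP.
Qed.

End SectionConstant.

Section OrbitClosure.
Context {R : realType} {n r : nat} {Mt M : cmanifold R n}.
Variables (q : Mt -> M) (x0 : M) (y0 : Mt).
Hypotheses (quc : universal_covering q) (hy0 : q y0 = x0).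
Hypothesis Mc : compact [set: M].
Variable rho : @unitary_rep R M x0 r.
Local Notation C := (Cx R).
Local Notation V := (flat_bundle q y0 rho).
Local Notation G := (rep_image rho).

Lemma closure_n1P (A : set 'rV[C]_r) v : closure A v <->
  forall e : R, 0 < e -> exists2 w, A w & n1 (w - v) < e.
Proof.
split=> [h e e0|h B /nbhs_n1P[e e0 he]].
  have [|w [Aw we]] := h (fun w => n1 (w - v) < e); last by exists w.
  by apply/nbhs_n1P; exists e.
by have [w Aw we] := h e e0; exists w; split => //; exact: he.
Qed.

(** The image of the representation is not known to be closed, so the orbit is closed up to obtain
    compactness; the price is an approximation argument in [section_const]. *)
Definition orbit_closure (l : 'rV[C]_r) : set 'rV[C]_r :=
  closure [set v | exists2 A, G A & v = l *m A].

Lemma orbit_closure_id l : orbit_closure l l.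
Proof.
apply: subset_closure; exists 1%:M; last by rewrite mulmx1.
exact: (glue_image quc hy0 (glue_refl hy0 (rho := rho) y0)).
Qed.

Lemma orbit_closure_mul l v B : orbit_closure l v -> G B -> orbit_closure l (v *m B).
Proof.
move=> /closure_n1P Ov GB; apply/closure_n1P => e e0.
have r0 : (0 : R) < r.+1%:R by [].
have [w [A GA ->] h] := Ov _ (divr_gt0 e0 r0).
exists (l *m (A *m B)); first by exists (A *m B) => //; exact: rep_image_mul.
rewrite mulmxA -mulmxBl; apply: le_lt_trans (n1_mul_le _ (rep_image_unitary GB)) _.
rewrite ltr_pdivlMr// in h; apply: le_lt_trans h; rewrite mulrC ler_wpM2l ?n1_ge0//.
by rewrite ler_nat.
Qed.

Lemma orbit_closure_le l v : orbit_closure l v -> n1 v <= r%:R * n1 l.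
Proof.
move=> /closure_n1P Ov; apply/ler_addgt0Pr => e e0.
have [w [A GA ->] h] := Ov _ e0.
have := n1_mul_le l (rep_image_unitary GA).
have := n1D (v - l *m A) (l *m A); rewrite subrK n1B.
by move: h; lra.
Qed.

Lemma orbit_closure_ge l v : orbit_closure l v -> n1 l <= r%:R * n1 v.
Proof.
move=> /closure_n1P Ov; apply/ler_addgt0Pr => e e0.
have r0 : (0 : R) < r.+1%:R by [].
have [w [A GA ->] h] := Ov _ (divr_gt0 e0 r0).
apply: le_trans (n1_le_mul l (rep_image_unitary GA)) _.
rewrite ltr_pdivlMr// in h.
have h1 := n1D (l *m A - v) v; rewrite subrK in h1.
apply: (@le_trans _ _ (r%:R * (n1 (l *m A - v) + n1 v))).
  by rewrite ler_wpM2l.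
rewrite mulrDr addrC lerD2l; apply: le_trans (ltW h).
by rewrite mulrC ler_wpM2l ?n1_ge0// ler_nat.
Qed.

Lemma orbit_closure_neq0 l v : l != 0 -> orbit_closure l v -> v != 0.
Proof.
move=> l0 /orbit_closure_ge h; apply: contraTneq (n1_gt0 l0) => v0.
by rewrite -leNgt; rewrite v0 n10 mulr0 in h.
Qed.

Lemma orbit_closure_compact l : compact (orbit_closure l).
Proof.
apply: (subclosed_compact _ (@compact_n1 R r 0 (r%:R * n1 l))).
  exact: closed_closure.
by move=> v /orbit_closure_le h; rewrite /= subr0.
Qed.

Variables (m : nat) (F : Mt -> 'rV[C]_r -> C).
Hypothesis hF : @global_section R n r V m F.

(** Compactness in the pair [(y, w)] makes the modulus of continuity in the covector uniform. *)
Lemma section_equicontinuous (K : set Mt) l (e : R) : compact K -> l != 0 -> 0 < e ->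
  exists2 d : R, 0 < d & forall y w w', K y -> orbit_closure l w ->
    n1 (w' - w) < d -> cmod (F y w' - F y w) < e.
Proof.
move=> Kc l0 e0.
have := compact_setX Kc (@orbit_closure_compact l).
move=> /compact_near_coveringP h.
have [|N _ hN] := h nat \oo (fun N (p : Mt * 'rV[C]_r) => forall w' : 'rV[C]_r,
    n1 (w' - p.2) < N.+1%:R^-1 -> cmod (F p.1 w' - F p.1 p.2) < e) _; last first.
  exists N.+1%:R^-1; first by rewrite invr_gt0.
  move=> y w w' Ky Ow hw; have := hN N (leqnn N) (y, w); apply => //=.
move=> [y w] [/= Ky Ow]; have w0 := orbit_closure_neq0 l0 Ow.
have e2 : 0 < e / 2 by rewrite divr_gt0.
have hn : nbhs (F y w) (fun z => cmod (z - F y w) < e / 2).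
  by apply/nbhs_cmodP; exists (e / 2).
have [[W1 W2] /= [h1 /nbhs_n1P[d d0 hd]] hW] := section_continuous hF w0 hn.
have d2 : 0 < d / 2 by rewrite divr_gt0.
have [N _ hN] := near_infty_natSinv_lt (PosNum d2).
exists (W1 `*` [set v | n1 (v - w) < d / 2], [set k | (N <= k)%N]).
  split; last by exists N.
  exists (W1, [set v | n1 (v - w) < d / 2]) => //; split => //=.
  by apply/nbhs_n1P; exists (d / 2).
move=> [[y' v] k] [/= [Wy' hv] Nk] w' hw'.
have kd : k.+1%:R^-1 < d / 2 by exact: hN.
have dd : d / 2 < d by rewrite ltr_pdivrMr// ltr_pMr// ltr1n.
have a1 : cmod (F y' v - F y w) < e / 2.
  by apply: (hW (y', v)); split => //=; apply: hd; exact: lt_trans dd.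
have a2 : cmod (F y' w' - F y w) < e / 2.
  apply: (hW (y', w')); split => //=; apply: hd.
  rewrite -(subrKA v); apply: le_lt_trans (n1D _ _) _.
  by rewrite [d]splitr; apply: ltrD => //; exact: lt_trans hw' kd.
apply: le_lt_trans (cmod_tri (F y w) _ _) _.
by rewrite [e]splitr; apply: ltrD => //; rewrite cmodB.
Qed.

(* |F| attains its maximum over Mt times the orbit closure of l, by compactness
   modulo the deck transformations; there F is constant in y, and this constancy
   propagates from the limit point to l. *)
Lemma section_const l y y' : l != 0 -> F y l = F y' l.
Proof.
move=> l0; have [_ hF2 hF3] := hF.
have [K Kc hK] := compact_lift quc.1 Mc.
have Fgl y1 y2 A v : @Defs.glue R n r V y1 y2 A -> v != 0 -> F y1 (v *m A) = F y2 v.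
  exact: hF3.
pose O := orbit_closure l.
have [p /set_mem [/= Kp Op] hp] : exists2 p, p \in K `*` O & forall t, t \in K `*` O ->
    cmod (F t.1 t.2) <= cmod (F p.1 p.2).
  apply: compact_EVT_max.
  - by have [z Kz _] := hK (q y0); exists (z, l); split => //; exact: orbit_closure_id.
  - by apply: compact_setX => //; exact: orbit_closure_compact.
  - apply: continuous_in_subspaceT => -[z v] /set_mem[/= Kz Ov].
    apply: (@continuous_comp _ _ _ (fun p : Mt * 'rV[C]_r => F p.1 p.2) (@cmod R)).
      by apply: (section_continuous hF); exact: orbit_closure_neq0 Ov.
    exact: cmod_continuous.
(* A deck transformation brings any base point into [K] and changes the covector only within the
   orbit closure, so the maximum over the compact set is global. *)
have hmax z : cmod (F z p.2) <= cmod (F p.1 p.2).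
  have [z' Kz' zz'] := hK (q z).
  have [A gA] := glue_fibre y0 quc rho zz'.
  have GA := glue_image quc hy0 gA.
  rewrite -(Fgl _ _ _ _ gA (orbit_closure_neq0 l0 Op)).
  apply: (hp (z', _)); apply/mem_set; split; first exact: Kz'.
  exact: (orbit_closure_mul Op GA).
have cst := section_max_constant quc hF (orbit_closure_neq0 l0 Op) hmax.
set c := F p.1 p.2 in cst.
suff H z : F z l = c by rewrite !H.
apply/eqP; rewrite -subr_eq0 -cmod_eq0 eq_le cmod_ge0 andbT.
apply/ler_addgt0Pr => e e0; rewrite add0r.
have [d d0 hd] := section_equicontinuous Kc l0 e0.
have r0 : (0 : R) < r.+1%:R by [].
(* [l *m A] approximates the maximum point [p.2]: equicontinuity compares the values there, and
   gluing by [A] leads back to [l]. The radius is divided by [r.+1] because moving the base point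
   into [K] multiplies the covectors by a unitary [B]. *)
have [w [A GA ->] hw] := (closure_n1P _ _).1 Op _ (divr_gt0 d0 r0).
have lA0 : l *m A != 0.
  have Ol : orbit_closure l l by exact: orbit_closure_id.
  have OlA := orbit_closure_mul Ol GA.
  by move: (orbit_closure_neq0 l0 OlA).
have [T [T' [_ T'K _ _ _]] gT] := image_glue quc hy0 GA.
rewrite -(T'K z) -(Fgl _ _ _ _ (gT (T' z)) l0).
set z1 := T' z.
have [z2 Kz2 z21] := hK (q z1).
have [B gB] := glue_fibre y0 quc rho z21.
have GB := glue_image quc hy0 gB.
rewrite -(cst z1) -(Fgl _ _ _ _ gB lA0) -(Fgl _ _ _ _ gB (orbit_closure_neq0 l0 Op)).
apply/ltW/hd; [exact: Kz2|exact: (orbit_closure_mul Op GB)|].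
rewrite -mulmxBl; apply: le_lt_trans (n1_mul_le _ (rep_image_unitary GB)) _.
rewrite ltr_pdivlMr// in hw; apply: le_lt_trans hw.
by rewrite mulrC ler_wpM2l ?n1_ge0// ler_nat.
Qed.

End OrbitClosure.

(** * Uniformly separated sets of matrices *)

Section SeparatedFinite.
Local Open Scope sesquilinear_scope.
Context {R : realType}.
Local Notation C := (Cx R).

(** If [x != 1], the geometric sum vanishes, so [m] is the modulus of the sum of the [1 - x^i],
    which is at most [m^2 |x - 1|]. *)
Lemma root_of_unity_close (x : C) m : (0 < m)%N -> x ^+ m = 1 ->
  m%:R * cmod (x - 1) < 1 -> x = 1.
Proof.
move=> m0 xm h; apply/eqP; rewrite -subr_eq0; apply: contraT => x1.
have cx : cmod x = 1.
  have : cmod x ^+ m = 1 by rewrite -cmodX xm cmod1.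
  by move/eqP; rewrite pexpr_eq1 ?cmod_ge0// => /eqP.
have S0 : \sum_(i < m) x ^+ i = 0.
  by apply: (mulfI x1); rewrite -subrX1 xm subrr mulr0.
have close i : cmod (1 - x ^+ i) <= i%:R * cmod (x - 1).
  elim: i => [|i IH]; first by rewrite subrr cmod0 mul0r.
  apply: le_trans (cmod_tri (x ^+ i) _ _) _.
  have -> : x ^+ i - x ^+ i.+1 = x ^+ i * (1 - x) by rewrite exprSr; ring.
  rewrite cmodM cmodX cx expr1n mul1r (cmodB 1 x) -natr1 mulrDl mul1r.
  by rewrite lerD2r.
have hm : cmod (\sum_(i < m) (1 - x ^+ i)) = m%:R.
  by rewrite sumrB S0 subr0 sumr_const card_ord cmod_nat.
have hs : \sum_(i < m) m%:R * cmod (x - 1) = m%:R * (m%:R * cmod (x - 1)).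
  by rewrite sumr_const card_ord -[LHS]mulr_natl.
have : (m%:R : R) <= m%:R * (m%:R * cmod (x - 1)).
  rewrite -{1}hm -hs; apply: le_trans (cmod_sum _ _ _) _.
  apply: ler_sum => i _; apply: le_trans (close i) _.
  by rewrite ler_wpM2r ?cmod_ge0// ler_nat ltnW.
by rewrite -{1}[X in X <= _]mulr1 ler_pM2l ?ltr0n// leNgt h.
Qed.

(** Pigeonhole: real and imaginary parts of entries are sorted into cells of width less than
    [e / 2], and a matrix is determined by its cells. *)
Lemma separated_finite (r : nat) (G : set 'M[C]_r) (e : R) : 0 < e ->
  (forall A, G A -> forall i j, cmod (A i j) <= 1) ->
  (forall A B, G A -> G B -> (forall i j, cmod (A i j - B i j) < e) -> A = B) ->
  finite_set G.
Proof.
move=> e0 Gb Gs.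
have e2 : 0 < e / 2 by rewrite divr_gt0.
have [N0 _ hN] := near_infty_natSinv_lt (PosNum e2).
have {hN} hN := hN _ (leqnn N0); rewrite /= in hN; pose N := N0.+1.
have NR : 0 < (N%:R : R) by rewrite ltr0n.
pose T := {ffun 'I_r * 'I_r -> 'I_(2 * N).+1 * 'I_(2 * N).+1}.
(* For [x] in [[-1, 1]] the cell numbers run from 0 to [2 * N] included. *)
pose c (x : R) : 'I_(2 * N).+1 := inord (Num.truncn ((x + 1) * N%:R)).
have cP x y : `|x| <= 1 -> `|y| <= 1 -> c x = c y -> `|x - y| < e / 2.
  have H z : `|z| <= 1 -> (c z : nat)%:R <= (z + 1) * N%:R < (c z : nat)%:R + 1.
    rewrite ler_norml => /andP[z1 z2].
    have p0 : 0 <= (z + 1) * N%:R by rewrite mulr_ge0//; lra.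
    rewrite /c inordK.
      by have := truncn_itv p0; rewrite -natr1.
    rewrite ltnS -(ler_nat R); apply: (@le_trans _ _ ((z + 1) * N%:R)).
      by rewrite truncn_le.
    by rewrite natrM ler_wpM2r//; lra.
  move=> /H /andP[x1 x2] /H /andP[y1 y2] exy.
  apply: le_lt_trans hN; rewrite -(ler_pM2r NR) mulVf ?gt_eqF//.
  rewrite -[X in _ * X](ger0_norm (ltW NR)) -normrM ler_norml.
  by rewrite mulrBl; rewrite exy in x1 x2; apply/andP; split; move: x1 x2 y1 y2;
    rewrite !mulrDl mul1r; lra.
pose f (A : 'M[C]_r) : T := [ffun ij => (c (complex.Re (A ij.1 ij.2)), c (complex.Im (A ij.1 ij.2)))].
have finj A B : G A -> G B -> f A = f B -> A = B.
  move=> GA GB /ffunP fAB; apply: Gs => // i j.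
  have := fAB (i, j); rewrite !ffunE /= => -[h1 h2].
  apply: le_lt_trans (cmod_le_ReIm _) _.
  have := Gb A GA i j; have := Gb B GB i j; move: h1 h2.
  case: (A i j) => a1 a2; case: (B i j) => b1 b2 /= h1 h2 hb ha.
  have nr := @normRe_le_cmod R; have ni := @normIm_le_cmod R.
  rewrite [e]splitr; apply: ltrD; apply: cP => //.
  - exact: le_trans (nr (a1 +i* a2)%C) ha.
  - exact: le_trans (nr (b1 +i* b2)%C) hb.
  - exact: le_trans (ni (a1 +i* a2)%C) ha.
  - exact: le_trans (ni (b1 +i* b2)%C) hb.
have /choice[g hg] : forall t : T, exists A, (exists2 A', G A' & f A' = t) -> G A /\ f A = t.
  move=> t; have [[A GA <-]|h] := pselect (exists2 A', G A' & f A' = t).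
    by exists A.
  by exists 0 => h'; case: h.
apply: (@sub_finite_set _ _ (g @` setT)); last exact/finite_image/finite_finset.
move=> A GA; exists (f A) => //.
by have [h1 h2] := hg (f A) (ex_intro2 _ _ A GA erefl); exact: finj.
Qed.

End SeparatedFinite.

(** * From semi-ampleness to a finite image *)

Section SemiAmpleFinite.
Local Open Scope sesquilinear_scope.
Context {R : realType} {n r : nat} {Mt M : cmanifold R n}.
Variables (q : Mt -> M) (x0 : M) (y0 : Mt).
Hypotheses (quc : universal_covering q) (hy0 : q y0 = x0).
Hypothesis Mc : compact [set: M].
Variable rho : @unitary_rep R M x0 r.
Local Notation C := (Cx R).
Local Notation V := (flat_bundle q y0 rho).
Local Notation G := (rep_image rho).

Lemma semi_ample_eigenvalue : semi_ample V -> exists2 m, (0 < m)%N &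
  forall A B (l : 'rV[C]_r) (a : C), G A -> G B -> l != 0 ->
    l *m A = a *: (l *m B) -> a ^+ m = 1.
Proof.
move=> [m [m0 hV]]; exists m => // A B l a GA GB l0 lAB.
have [F hF Fl] := hV y0 l l0; have [_ F2 F3] := hF.
have inv A' : G A' -> F y0 (l *m A') = F y0 l.
  move=> GA'; have [T _ gT] := image_glue quc hy0 GA'.
  by rewrite (F3 _ _ _ _ (gT y0) l0); exact: (section_const quc hy0 Mc hF).
have lU A' : G A' -> l *m A' != 0.
  move=> GA'; apply: contra_neq l0 => h.
  by rewrite -(mulmxK (unitarymx_unit (rep_image_unitary GA')) l) h mul0mx.
have a0 : a != 0 by apply: contraNneq (lU _ GA) => a0; rewrite lAB a0 scale0r.
have := F2 y0 (l *m B) a (lU _ GB) a0; rewrite -lAB !inv// => h.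
by apply: (mulIf Fl); rewrite -h mul1r.
Qed.

(* For A, B in G, the eigenvalues of A B^-1 are m-th roots of unity; so A != B
   forces A - B to be bounded below. *)
Lemma semi_ample_finite : semi_ample V -> finite_set G.
Proof.
move=> /semi_ample_eigenvalue[m m0 hm].
(* An eigenvalue [x] of [A *m B^-1] will satisfy [|x - 1| <= r^2 * e], and [m |x - 1| < 1] is
   required; [r.+1] makes the inequality strict. *)
pose e : R := (m%:R * (r.+1%:R * r.+1%:R))^-1.
have mR : 0 < (m%:R : R) by rewrite ltr0n.
have e0 : 0 < e by rewrite invr_gt0 !mulr_gt0.
apply: (separated_finite e0).
  by move=> A GA i j; exact: unitary_entry (rep_image_unitary GA).
move=> A B GA GB AB.
have uA := rep_image_unitary GA; have uB := rep_image_unitary GB.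
have uB' : B ^t* \is unitarymx by rewrite trmxC_unitary.
pose U := A *m B ^t*.
have uU : U \is unitarymx by exact: mul_unitarymx.
have BB : B ^t* *m B = 1%:M by apply: mulmx1C; exact/unitarymxP.
have /unitarymxP eU := uU; have /unitarymxP eB := uB.
have nU : U \is normalmx.
  apply/normalmxP; rewrite eU; symmetry.
  exact: mulmx1C.
pose P := spectralmx U; pose d := spectral_diag U.
have uP : P \in unitmx by exact: spectral_unit.
have PU : P *m U = diag_mx d *m P.
  by rewrite {1}(orthomx_spectralP nU) !mulmxA mulmxV// mul1mx.
(* A unitary matrix is normal, hence diagonalizable, so it equals the identity as soon as its
   eigenvalues are 1. *)
suff d1 i : d 0 i = 1.
  have : diag_mx d = 1%:M by apply/matrixP => i j; rewrite !mxE d1.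
  move=> dE; have : U = 1%:M.
    by apply: (can_inj (mulKmx uP)); rewrite PU dE mulmx1 mul1mx.
  by move=> /(congr1 (mulmx^~ B)); rewrite -mulmxA BB mulmx1 mul1mx.
pose p := row i P.
have p0 : p != 0.
  apply/eqP => h; have := congr1 (row i) (mulmxV uP).
  rewrite row_mul -/p h mul0mx => /rowP/(_ i)/eqP.
  by rewrite !mxE eqxx eq_sym oner_eq0.
have pU : p *m U = d 0 i *: p.
  by rewrite -row_mul PU mul_diag_mx; apply/rowP => j; rewrite !mxE.
have pA : p *m A = d 0 i *: (p *m B).
  by rewrite scalemxAl -pU -!mulmxA BB mulmx1.
apply: (root_of_unity_close m0 (hm _ _ _ _ GA GB p0 pA)).
have E : (d 0 i - 1) *: p = p *m (A - B) *m B ^t*.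
  rewrite mulmxBr mulmxBl -!mulmxA -/U eB mulmx1 pU.
  by rewrite scalerBl scale1r.
have n1Z (a : C) (v : 'rV[C]_r) : n1 (a *: v) = cmod a * n1 v.
  by rewrite /n1 mulr_sumr; apply: eq_bigr => j _; rewrite mxE cmodM.
have h1 : cmod (d 0 i - 1) * n1 p <= r%:R * (r%:R * e * n1 p).
  rewrite -n1Z E; apply: le_trans (n1_mul_le _ uB') _; rewrite ler_wpM2l//.
  have -> : r%:R * e * n1 p = \sum_(j < r) \sum_(k < r) cmod (p 0 k) * e.
    by rewrite sumr_const card_ord -mulr_suml -[RHS]mulr_natl mulrAC mulrA.
  apply: ler_sum => j _; rewrite mxE; apply: le_trans (cmod_sum _ _ _) _.
  apply: ler_sum => k _; rewrite cmodM ler_wpM2l ?cmod_ge0// ltW//.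
  by rewrite !mxE; exact: AB.
have np : 0 < n1 p by exact: n1_gt0.
have h2 : cmod (d 0 i - 1) <= r%:R * r%:R * e.
  by rewrite -(ler_pM2r np) -!mulrA; rewrite -!mulrA in h1.
apply: (@le_lt_trans _ _ (m%:R * (r%:R * r%:R * e))); first by rewrite ler_wpM2l.
rewrite /e mulrA ltr_pdivrMr ?mulr_gt0// mul1r ltr_pM2l//.
by rewrite -!natrM ltr_nat ltn_mul.
Qed.

End SemiAmpleFinite.

(** * Meromorphic functions on Riemann surfaces *)

Lemma continuous_mul (K : numFieldType) (T : topologicalType) (f g : T -> K) x :
  {for x, continuous f} -> {for x, continuous g} -> {for x, continuous (fun y => f y * g y)}.
Proof. by move=> fc gc; exact: cvgM. Qed.

Lemma continuous_inv (K : numFieldType) (T : topologicalType) (f : T -> K) x :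
  f x != 0 -> {for x, continuous f} -> {for x, continuous (fun y => (f y)^-1)}.
Proof. by move=> f0 fc; exact: cvgV. Qed.

Section RiemannSurface.
Context {R : realType} {S : cmanifold R 1}.
Local Notation C := (Cx R).
Implicit Types (s z p : S) (h g : S -> C) (w : S -> R).

(** One chart is chosen at each point, so that orders refer to a single uniformizer [unif s];
    [coordi_ratio] compares it with the other charts. *)
Definition cidx s : chart_index S := projT1 (cid (chart_cover s)).
Lemma cidxP s : chart_dom (cidx s) s. Proof. exact: projT2 (cid (chart_cover s)). Qed.

Definition coordi (i : chart_index S) z : C := chart i z 0 0.
Definition unif s z : C := coordi (cidx s) z - coordi (cidx s) s.

Lemma unif0 s : unif s s = 0. Proof. exact: subrr. Qed.

Lemma rV1P (u v : 'rV[C]_1) : u 0 0 = v 0 0 -> u = v.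
Proof. by move=> e; apply/rowP => j; rewrite (ord1 j). Qed.

Lemma coordi_inj i s z : chart_dom i s -> chart_dom i z -> coordi i s = coordi i z -> s = z.
Proof. by move=> si zi /rV1P e; rewrite -(chartK si) e chartK. Qed.

Lemma near_chart_dom i s : chart_dom i s -> \forall z \near s, chart_dom i z.
Proof. by move=> si; apply: open_nbhs_nbhs; split => //; exact: open_chart_dom. Qed.

Lemma near_neq s p : s != p -> \forall z \near s, z != p.
Proof.
move=> sp; have := @cmanifold_hausdorff R 1 S; rewrite open_hausdorff.
move=> /(_ _ _ sp)[[A B] /= [sA pB] [oA oB /eqP AB]].
have : nbhs s A by apply: open_nbhs_nbhs; split => //; rewrite -inE.
apply: filterS => z Az; apply: contraPneq AB => zp.
apply/eqP/set0P; exists z; split => //; rewrite zp -inE//.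
Qed.

Lemma dnear_neq s p : \forall z \near s^', z != p.
Proof.
have [->|sp] := eqVneq p s; first by apply: withinT.
by apply: nbhs_dnbhs; apply: near_neq; rewrite eq_sym.
Qed.

Lemma dnear_notin s (l : seq S) : \forall z \near s^', z \notin l.
Proof.
elim: l => [|p l IH]; first by near=> z.
by apply: filterS2 (dnear_neq s p) IH => z; rewrite inE negb_or => -> ->.
Unshelve. all: by end_near.
Qed.

Lemma dnear_near s (P : set S) : (\forall z \near s^', P z) ->
  \forall z \near s^', \forall z' \near z, P z'.
Proof.
move=> h; have h' : nbhs s (fun z => z != s -> P z) by [].
have : nbhs s (fun z => z != s -> \forall z' \near z, P z'); last by [].
apply: filterS (nbhs_interior h') => z hz zs.
by apply: filterS2 hz (near_neq zs) => z'; apply.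
Qed.

Lemma nbhs_not_isolated s (P : set S) : nbhs s P -> exists2 z, z != s & P z.
Proof.
move=> Ps; have [i si] := chart_cover s.
have n1' : nbhs (chart i s) (chart_inv i @^-1` P).
  by apply: (chart_inv_continuous si); rewrite chartK.
have n2 : nbhs (chart i s) (chart i @` chart_dom i).
  by apply: open_nbhs_nbhs; split; [exact: open_chart_image|exists s].
have /nbhs_n1P[e e0 he] : nbhs (chart i s) (chart_inv i @^-1` P `&` chart i @` chart_dom i).
  exact: filterI n1' n2.
have e2 : 0 < e / 2 by rewrite divr_gt0.
pose p : 'rV[C]_1 := chart i s + const_mx (r2c (e / 2)).
have [|pP [z zi zp]] := he p.
  rewrite /p addrAC subrr add0r /n1 big_ord1 mxE cmod_r2c gtr0_norm//.
  by rewrite ltr_pdivrMr// ltr_pMr// ltr1n.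
exists z; last by move: pP; rewrite /= -zp chartK.
apply/eqP => zs; have := zp; rewrite zs /p => /eqP.
rewrite -subr_eq0 opprD addNKr oppr_eq0 => /eqP/rowP/(_ 0)/eqP.
by rewrite !mxE -cmod_eq0 cmod_r2c normr_eq0 gt_eqF.
Qed.

Lemma dnbhs_nonempty s (P : set S) : (\forall z \near s^', P z) -> exists2 z, z != s & P z.
Proof.
move=> h; have h' : nbhs s (fun z => z != s -> P z) by [].
by have [z zs hz] := nbhs_not_isolated h'; exists z => //; exact: hz.
Qed.

Lemma holo_continuous h z : holo_fun_at h z -> {for z, continuous h}.
Proof.
move=> hh; have [i zi] := chart_cover z.
have hc := differentiable_continuous (hh i zi).
have : {for z, continuous ((h \o chart_inv i) \o chart i)}.
  by apply: continuous_comp; [exact: chart_continuous|exact: hc].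
apply: near_eq_continuous; apply: filterS (near_chart_dom zi) => z' zi'.
by rewrite /= chartK.
Qed.

Lemma holo_cst (c : C) z : holo_fun_at (fun=> c) z.
Proof. by move=> i zi; exact: differentiable_cst. Qed.

Lemma holoM h g z : holo_fun_at h z -> holo_fun_at g z -> holo_fun_at (fun z => h z * g z) z.
Proof. by move=> hh hg i zi; apply: differentiableM; [exact: hh|exact: hg]. Qed.

Lemma holoB h g z : holo_fun_at h z -> holo_fun_at g z -> holo_fun_at (fun z => h z - g z) z.
Proof. by move=> hh hg i zi; apply: differentiableB; [exact: hh|exact: hg]. Qed.

Lemma holoV h z : holo_fun_at h z -> h z != 0 -> holo_fun_at (fun z => (h z)^-1) z.
Proof.
move=> hh h0 i zi; apply: differentiableV; first exact: hh.
by rewrite /= chartK.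
Qed.

Lemma holo_coordi i z : chart_dom i z -> holo_fun_at (coordi i) z.
Proof.
move=> zi j zj.
apply: (@differentiable_comp _ _ _ _ (chart i \o chart_inv j) (fun v : 'rV[C]_1 => v 0 0)).
  exact: transition_holomorphic.
exact: differentiable_coord.
Qed.

Lemma coordi_continuous i z : chart_dom i z -> {for z, continuous (coordi i)}.
Proof. by move=> zi; apply: holo_continuous; exact: holo_coordi. Qed.

Lemma near_unif_neq0 s : \forall z \near s^', unif s z != 0.
Proof.
have h1 : \forall z \near s^', z != s by exact: dnear_neq.
have h2 : \forall z \near s^', chart_dom (cidx s) z.
  by apply: nbhs_dnbhs; apply: near_chart_dom; exact: cidxP.
apply: filterS2 h1 h2 => z zs zi; rewrite subr_eq0; apply: contra_neq zs.
by apply: coordi_inj => //; exact: cidxP.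
Qed.

(** This notion takes the place of the removable singularity theorem: quotients of coordinate
    differences, once continuously extended, satisfy it directly, and the maximum principle applies
    to it. *)
Definition pholo h s := {for s, continuous h} /\ \forall z \near s^', holo_fun_at h z.

Lemma holo_pholo h s : (\forall z \near s, holo_fun_at h z) -> pholo h s.
Proof.
by move=> hh; split; [apply: holo_continuous; exact: nbhs_singleton|exact: nbhs_dnbhs].
Qed.

Lemma pholo_near_continuous h s : pholo h s -> \forall z \near s, {for z, continuous h}.
Proof.
move=> [hc hh]; have hh' : nbhs s (fun z => z != s -> holo_fun_at h z) by [].
apply: filterS hh' => z; have [->//|zs /(_ isT)] := eqVneq z s.
exact: holo_continuous.
Qed.

Lemma pholo_cst (c : C) s : pholo (fun=> c) s.
Proof. by apply: holo_pholo; near=> z; exact: holo_cst. Unshelve. all: by end_near. Qed.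

Lemma near_neq0 h s : {for s, continuous h} -> h s != 0 -> \forall z \near s, h z != 0.
Proof.
move=> hc h0; have hn : nbhs (h s) (fun x : C => x != 0).
  apply/nbhs_cmodP; exists (cmod (h s)); first by rewrite cmod_gt0.
  by move=> y; apply: contraTneq => ->; rewrite sub0r cmodN ltxx.
exact: hc hn.
Qed.

Lemma pholoM h g s : pholo h s -> pholo g s -> pholo (fun z => h z * g z) s.
Proof.
move=> [hc hh] [gc hg]; split; first exact: continuous_mul hc gc.
by apply: filterS2 hh hg => z; exact: holoM.
Qed.

Lemma pholoV h s : pholo h s -> h s != 0 -> pholo (fun z => (h z)^-1) s.
Proof.
move=> [hc hh] h0; split; first exact: continuous_inv h0 hc.
by apply: filterS2 hh (nbhs_dnbhs (near_neq0 hc h0)) => z; exact: holoV.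
Qed.

Lemma pholoX h s k : pholo h s -> pholo (fun z => h z ^+ k) s.
Proof.
move=> hh; elim: k => [|k IH].
  by under eq_fun do rewrite expr0; exact: pholo_cst.
by under eq_fun do rewrite exprS; exact: pholoM.
Qed.

Lemma pholoXz h s (k : int) : pholo h s -> h s != 0 -> pholo (fun z => h z ^ k) s.
Proof.
move=> hh h0; case: k => k; first exact: pholoX.
have := pholoV (pholoX k.+1 hh); apply; exact: expf_neq0.
Qed.

End RiemannSurface.

Lemma near_eq_differentiable (K : numFieldType) (V W : normedModType K) (f g : V -> W) x :
  (\forall y \near x, f y = g y) -> differentiable f x -> differentiable g x.
Proof.
move=> fg /diff_locallyP[dfc fE].
have e0 : f x = g x by exact: (nbhs_singleton fg).
have h : g \o shift x = cst (g x) + 'd f x +o_ (0 : V) id.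
  apply/eqaddoP => e e1; move: fE => /eqaddoP/(_ e e1) fE.
  have fg0 : \forall y \near (0 : V), f (y + x) = g (y + x).
    by have := fg; rewrite (near_shift 0) subr0.
  apply: filterS2 fE fg0 => y.
  by rewrite !fctE /= e0 => + <-.
have dgf := diff_unique dfc h.
by apply/diff_locallyP; rewrite dgf.
Qed.

(** * Orders of meromorphic functions and locally supported weights *)

Section Orders.
Context {R : realType} {S : cmanifold R 1}.
Local Notation C := (Cx R).
Implicit Types (s z p : S) (h g : S -> C) (w : S -> R).

Lemma near_chart_inv i z (P : set S) : chart_dom i z -> nbhs z P ->
  \forall v \near chart i z, P (chart_inv i v).
Proof.
move=> zi Pz; have Pz' : nbhs (chart_inv i (chart i z)) P by rewrite chartK.
exact: (chart_inv_continuous zi Pz').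
Qed.

Lemma holo_near_eq h g z : (\forall z' \near z, h z' = g z') ->
  holo_fun_at h z -> holo_fun_at g z.
Proof.
move=> hg hh i zi; apply: near_eq_differentiable (hh i zi).
exact: (near_chart_inv zi hg).
Qed.

Lemma pholo_dnear_eq h g s : {for s, continuous g} -> (\forall z \near s^', h z = g z) ->
  (\forall z \near s^', holo_fun_at h z) -> pholo g s.
Proof.
move=> gc hg hh; split => //.
by apply: filterS2 (dnear_near hg) hh => z; exact: holo_near_eq.
Qed.

Lemma coordi_linear i j s : chart_dom i s -> chart_dom j s -> exists a : C,
  forall e : R, 0 < e -> \forall z \near s,
    cmod (coordi i z - coordi i s - a * (coordi j z - coordi j s)) <=
    e * cmod (coordi j z - coordi j s).
Proof.
move=> si sj.
pose f (v : 'rV[C]_1) := coordi i (chart_inv j v).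
pose one : 'rV[C]_1 := const_mx 1.
have fd : differentiable f (chart j s + 0 *: one).
  by rewrite scale0r addr0; exact: holo_coordi.
have [a ha] := differentiable_cdiff fd.
exists a => e e0; have [d d0 hd] := ha e e0.
have h1 : \forall z \near s, cmod (coordi j z - coordi j s) < d.
  have hn : nbhs (coordi j s) (fun x => cmod (x - coordi j s) < d).
    by apply/nbhs_cmodP; exists d.
  exact: (coordi_continuous sj hn).
apply: filterS2 h1 (near_chart_dom sj) => z hz zj.
have E (z' : S) : chart_dom j z' ->
    f (chart j s + (coordi j z' - coordi j s) *: one) = coordi i z'.
  move=> zj'; rewrite /f (_ : _ + _ = chart j z') ?chartK//.
  by apply: rV1P; rewrite !mxE mulr1 /coordi subrKC.
have := hd (coordi j z - coordi j s); rewrite subr0 => /(_ hz).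
rewrite E// (_ : f (chart j s + 0 *: one) = coordi i s)//.
by rewrite scale0r addr0 /f chartK.
Qed.

(** The value of the factor at [s] is the derivative [a] of the transition map, which is nonzero
    because the inverse transition is differentiable as well. *)
Lemma coordi_ratio i s : chart_dom i s -> exists r, [/\ pholo r s, r s != 0 &
  \forall z \near s, coordi i z - coordi i s = unif s z * r z].
Proof.
move=> si; have sj := cidxP s.
have [a ha] := coordi_linear si sj; have [b hb] := coordi_linear sj si.
have a0 : a != 0.
  apply/eqP => a0.
  pose e : R := (2 * (cmod b + 1))^-1.
  have b1 : 0 < cmod b + 1 by rewrite ltr_wpDl// cmod_ge0.
  have e0 : 0 < e by rewrite invr_gt0 mulr_gt0.
  have H : \forall z \near s^', False.
    apply: filterS3 (nbhs_dnbhs (ha e e0)) (nbhs_dnbhs (hb 1 ltr01)) (near_unif_neq0 s).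
    move=> z; rewrite a0 mul0r subr0 -/(unif s z).
    set u := coordi i z - _; set t := unif s z => h1 h2 t0.
    have T0 : 0 < cmod t by rewrite cmod_gt0.
    have h3 : cmod t <= (cmod b + 1) * cmod u.
      have := cmodD (t - b * u) (b * u); rewrite subrK cmodM.
      by move: h2; lra.
    have h4 : (cmod b + 1) * cmod u <= (cmod b + 1) * (e * cmod t).
      by rewrite ler_pM2l.
    have h5 : (cmod b + 1) * (e * cmod t) = cmod t / 2.
      by rewrite /e; field; rewrite gt_eqF.
    by move: h3 h4 T0; rewrite h5; lra.
  by have [] := dnbhs_nonempty H.
pose r0 z := (coordi i z - coordi i s) * (unif s z)^-1.
pose r z := if z == s then a else r0 z.
exists r; split; last 2 first.
- by rewrite /r eqxx.
- have h := near_unif_neq0 s; have h' : nbhs s (fun z => z != s -> unif s z != 0) by [].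
  apply: filterS h' => z; rewrite /r; have [-> _|zs /(_ isT) u0] := eqVneq z s.
    by rewrite subrr unif0 mul0r.
  by rewrite /r0 mulrC divfK.
have hol : \forall z \near s^', holo_fun_at r0 z.
  have d1 := nbhs_dnbhs (near_chart_dom si); have d2 := nbhs_dnbhs (near_chart_dom sj).
  apply: filterS3 d1 d2 (near_unif_neq0 s) => z zi zj u0.
  apply: holoM; first by apply: holoB; [exact: holo_coordi|exact: holo_cst].
  apply: holoV; last exact: u0.
  by apply: holoB; [exact: holo_coordi|exact: holo_cst].
apply: pholo_dnear_eq hol.
  move=> W /nbhs_cmodP[e e0 he].
  have e2 : 0 < e / 2 by rewrite divr_gt0.
  have hu : nbhs s (fun z => z != s -> unif s z != 0) by exact: near_unif_neq0.
  have : \forall z \near s, W (r z); last by [].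
  apply: filterS2 (ha _ e2) hu => z hz u0; apply: he; rewrite {2}/r eqxx /r.
  have [_|zs] := eqVneq z s; first by rewrite subrr cmod0.
  have {}u0 := u0 zs; have U0 : 0 < cmod (unif s z) by rewrite cmod_gt0.
  rewrite -(ltr_pM2r U0) -cmodM mulrBl /r0 divfK//.
  by apply: le_lt_trans hz _; rewrite ltr_pM2r// ltr_pdivrMr// ltr_pMr// ltr1n.
by apply: filterS (dnear_neq s s) => z; rewrite /r => /negPf ->.
Qed.

(** In contrast with [mero_order], the uniformizer is the chosen one and the factor is only [pholo],
    which is what a change of chart produces. *)
Definition morder g s (k : int) := exists h, [/\ pholo h s, h s != 0 &
  \forall z \near s^', g z = unif s z ^ k * h z].

Lemma morder_mul g1 g2 s k1 k2 : morder g1 s k1 -> morder g2 s k2 ->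
  morder (fun z => g1 z * g2 z) s (k1 + k2).
Proof.
move=> [h1 [p1 n1 e1]] [h2 [p2 n2 e2]]; exists (fun z => h1 z * h2 z); split.
- exact: pholoM.
- exact: mulf_neq0.
- apply: filterS3 e1 e2 (near_unif_neq0 s) => z -> -> u0.
  by rewrite expfzDr// mulrACA.
Qed.

Lemma morder_inv g s k : morder g s k -> morder (fun z => (g z)^-1) s (- k).
Proof.
move=> [h [p n e]]; exists (fun z => (h z)^-1); split.
- exact: pholoV.
- exact: invr_neq0.
- by apply: filterS e => z ->; rewrite invfM invr_expz.
Qed.

Lemma morder_cst (c : C) s : c != 0 -> morder (fun=> c) s 0.
Proof.
move=> c0; exists (fun=> c); split => //; first exact: pholo_cst.
by near=> z; rewrite expr0z mul1r.
Unshelve. all: by end_near.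
Qed.

Lemma morder_exp g s k m : morder g s k -> morder (fun z => g z ^+ m) s (k *+ m).
Proof.
move=> gk; elim: m => [|m IH].
  by under eq_fun do rewrite expr0; rewrite mulr0n; exact: morder_cst.
by under eq_fun do rewrite exprS; rewrite mulrS; exact: morder_mul.
Qed.

Lemma morder_coordi i s p : chart_dom i s -> chart_dom i p ->
  morder (fun z => coordi i z - coordi i p) s ((s == p)%:R).
Proof.
move=> si pi; have [<-|sp] := eqVneq s p.
  have [r [rp r0 re]] := coordi_ratio si; exists r; split => //.
  by apply: nbhs_dnbhs; apply: filterS re => z ->; rewrite expr1z.
exists (fun z => coordi i z - coordi i p); split.
- apply: holo_pholo; apply: filterS (near_chart_dom si) => z zi.
  by apply: holoB; [exact: holo_coordi|exact: holo_cst].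
- rewrite subr_eq0; apply: contra_neq sp; exact: coordi_inj.
- by near=> z; rewrite expr0z mul1r.
Unshelve. all: by end_near.
Qed.

(* w is supported from below at s by a power of the modulus of a holomorphic
   function; this replaces subharmonicity of log w. *)
Definition touched w s := exists m h, [/\ (0 < m)%N, pholo h s,
  cmod (h s) = w s ^+ m & \forall z \near s, cmod (h z) <= w z ^+ m].

Definition tame w s := [/\ 0 < w s, \forall z \near s, {for z, continuous w} & touched w s].

(* w plays the role of the inverse norm of the canonical section of O(E), for a
   metric of semipositive curvature. *)
Definition psubh (E : S -> int) := exists w, forall s, (\forall z \near s^', E z = 0) /\
  exists v, tame v s /\ \forall z \near s^', w z = v z * cmod (unif s z) ^ (- E s).

Lemma tame_cmod h s : pholo h s -> h s != 0 -> tame (fun z => cmod (h z)) s.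
Proof.
move=> hp h0; split; first by rewrite cmod_gt0.
  apply: filterS (pholo_near_continuous hp) => z hc.
  by apply: (@continuous_comp _ _ _ h (@cmod R)) => //; exact: cmod_continuous.
exists 1%N, h; split => //.
by near=> z; rewrite expr1.
Unshelve. all: by end_near.
Qed.

Lemma tame_mul v w s : tame v s -> tame w s -> tame (fun z => v z * w z) s.
Proof.
move=> [v0 vc [m1 [h1 [m10 p1 e1 t1]]]] [w0 wc [m2 [h2 [m20 p2 e2 t2]]]]; split.
- exact: mulr_gt0.
- by apply: filterS2 vc wc => z; exact: continuous_mul.
- exists (m1 * m2)%N, (fun z => h1 z ^+ m2 * h2 z ^+ m1); split.
  + by rewrite muln_gt0 m10.
  + by apply: pholoM; exact: pholoX.
  + by rewrite cmodM !cmodX e1 e2 -!exprM [(m2 * m1)%N]mulnC -exprMn.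
  + apply: filterS2 t1 t2 => z h1z h2z; rewrite cmodM !cmodX exprMn.
    rewrite [v z ^+ _]exprM [(m1 * m2)%N]mulnC [w z ^+ _]exprM.
    have g1 := le_trans (cmod_ge0 _) h1z; have g2 := le_trans (cmod_ge0 _) h2z.
    apply: ler_pM; rewrite ?exprn_ge0 ?cmod_ge0//.
      by apply: lerXn2r; rewrite ?nnegrE ?cmod_ge0.
    by apply: lerXn2r; rewrite ?nnegrE ?cmod_ge0.
Qed.

(** The function supporting the larger of the two at [s] also supports the maximum, which dominates
    both. *)
Lemma tame_max v w s : tame v s -> tame w s -> tame (fun z => Num.max (v z) (w z)) s.
Proof.
move=> [v0 vc [m1 [h1 [m10 p1 e1 t1]]]] [w0 wc [m2 [h2 [m20 p2 e2 t2]]]].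
have vp : \forall z \near s, 0 < v z.
  have c : {for s, continuous v} by exact: nbhs_singleton vc.
  exact: (c _ (lt_nbhsr v0)).
have wp : \forall z \near s, 0 < w z.
  have c : {for s, continuous w} by exact: nbhs_singleton wc.
  exact: (c _ (lt_nbhsr w0)).
split.
- by rewrite lt_max v0.
- by apply: filterS2 vc wc => z; exact: (@continuous_max R _ v w z).
- have [vw|wv] := leP (w s) (v s).
    exists m1, h1; split => //; first by rewrite e1 max_l.
    apply: filterS3 t1 vp wp => z h a b; apply: le_trans h _.
    have l : v z <= Num.max (v z) (w z) by rewrite le_max lexx.
    exact: lerXn2r (ltW a) (le_trans (ltW a) l) l.
  exists m2, h2; split => //; first by rewrite e2 max_r// ltW.
  apply: filterS3 t2 vp wp => z h a b; apply: le_trans h _.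
  have l : w z <= Num.max (v z) (w z) by rewrite le_max lexx orbT.
  exact: lerXn2r (ltW b) (le_trans (ltW b) l) l.
Qed.

Lemma tame_near_eq v w s : (\forall z \near s, v z = w z) -> tame v s -> tame w s.
Proof.
move=> vw [v0 vc [m [h [m0 p e t]]]]; have vws := nbhs_singleton vw; split.
- by rewrite -vws.
- apply: filterS2 (nbhs_interior vw) vc => z hz; exact: near_eq_continuous hz.
- exists m, h; split => //; first by rewrite -vws.
  by apply: filterS2 t vw => z + <-.
Qed.

Lemma psubh0 : psubh (fun=> 0).
Proof.
exists (fun=> 1) => s; split; first by near=> z.
exists (fun=> 1); split; last by near=> z; rewrite oppr0 expr0z mulr1.
apply: (tame_near_eq _ (tame_cmod (pholo_cst 1 s) (oner_neq0 _))).
by near=> z; rewrite cmod1.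
Unshelve. all: by end_near.
Qed.

Lemma psubhD E1 E2 : psubh E1 -> psubh E2 -> psubh (fun s => E1 s + E2 s).
Proof.
move=> [w1 h1] [w2 h2]; exists (fun z => w1 z * w2 z) => s.
have [d1 [v1 [t1 e1]]] := h1 s; have [d2 [v2 [t2 e2]]] := h2 s; split.
  by apply: filterS2 d1 d2 => z -> ->; rewrite addr0.
exists (fun z => v1 z * v2 z); split; first exact: tame_mul.
apply: filterS3 e1 e2 (near_unif_neq0 s) => z -> -> u0.
by rewrite opprD expfzDr ?cmod_eq0// mulrACA.
Qed.

Lemma psubhMn E n : psubh E -> psubh (fun s => E s *+ n).
Proof.
move=> hE; elim: n => [|n IH].
  by under eq_fun do rewrite mulr0n; exact: psubh0.
by under eq_fun do rewrite mulrS; exact: psubhD.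
Qed.

End Orders.

(** * Maximum principle for weights *)

Section MaximumPrinciple.
Context {R : realType} {S : cmanifold R 1}.
Local Notation C := (Cx R).
Implicit Types (s z p : S) (h g : S -> C) (w : S -> R).

Lemma pholo_max h z : pholo h z -> (\forall z' \near z, cmod (h z') <= cmod (h z)) ->
  \forall z' \near z, h z' = h z.
Proof.
move=> [hc hh] hm; have [i zi] := chart_cover z.
pose f (v : 'rV[C]_1) := h (chart_inv i v).
have fz : f (chart i z) = h z by rewrite /f chartK.
have n2 : nbhs (chart i z) (chart i @` chart_dom i).
  by apply: open_nbhs_nbhs; split; [exact: open_chart_image|exists z].
have H : \forall v \near chart i z, f v = f (chart i z).
  apply: maximum_modulus_near.
  - have hc' : {for chart_inv i (chart i z), continuous h} by rewrite chartK.
    exact: continuous_comp (chart_inv_continuous zi) hc'.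
  - have hh' : nbhs z (fun z' => z' != z -> holo_fun_at h z') by [].
    have : nbhs (chart i z) (fun v => v != chart i z -> differentiable f v); last by [].
    apply: filterS2 n2 (near_chart_inv zi hh') => v [z' zi' <-].
    rewrite (chartK zi') => h' vz; have zz : z' != z by apply: contra_neq vz => ->.
    exact: (h' zz i zi').
  - by rewrite fz; exact: (near_chart_inv zi hm).
have H2 : \forall z' \near z, f (chart i z') = f (chart i z).
  exact: (chart_continuous zi H).
by apply: filterS2 H2 (near_chart_dom zi) => z' + zi'; rewrite fz /f chartK.
Qed.

Lemma near_neq_real (f g : S -> R) z : {for z, continuous f} -> {for z, continuous g} ->
  f z != g z -> \forall z' \near z, f z' != g z'.
Proof.
move=> fc gc; rewrite -subr_eq0 => fg.
have c : {for z, continuous (fun z => f z - g z)} by exact: (@continuousB _ R^o).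
have hn : nbhs (f z - g z) (fun x : R => x != 0).
  apply/nbhs_ballP; exists `|f z - g z|; first by rewrite /= normr_gt0.
  by move=> y; rewrite -ball_normE /ball_ /=; apply: contraTneq => ->; rewrite subr0 ltxx.
have : nbhs z (fun z' => f z' - g z' != 0) by exact: (c _ hn).
by apply: filterS => z'; rewrite subr_eq0.
Qed.

Lemma eq_of_dnear (f g : S -> R) z : {for z, continuous f} -> {for z, continuous g} ->
  (\forall z' \near z^', f z' = g z') -> f z = g z.
Proof.
move=> fc gc fg; apply: contrapT => /eqP /(near_neq_real fc gc) h.
have : \forall z' \near z^', False.
  by apply: filterS2 fg (nbhs_dnbhs h) => z' -> /eqP.
by case/dnbhs_nonempty.
Qed.

Lemma cmod_unif_pow_continuous s n : \forall z \near s,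
  {for z, continuous (fun z => cmod (unif s z) ^+ n)}.
Proof.
apply: filterS (near_chart_dom (cidxP s)) => z zi.
have uc : {for z, continuous (unif s)}.
  by apply: holo_continuous; apply: holoB; [exact: holo_coordi|exact: holo_cst].
have cc : {for z, continuous (fun z => cmod (unif s z))}.
  by apply: (@continuous_comp _ _ _ (unif s) (@cmod R)) => //; exact: cmod_continuous.
elim: n => [|n IH].
  exact: (@cst_continuous S R 1 z).
apply: near_eq_continuous (continuous_mul cc IH).
by near=> z' => /=; rewrite exprS.
Unshelve. all: by end_near.
Qed.

(** As [- E >= 0], the weight extends to a continuous [W] that vanishes where [E < 0]. At a maximum
    point of [W] the supporting [h] has maximal modulus, so [h], and with it [W], is constant
    nearby. Thus [W] is constant, though it is positive somewhere and zero at [p]. *)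
Lemma psubh_neg (E : S -> int) p : connected [set: S] -> compact [set: S] ->
  (forall s, E s <= 0) -> E p != 0 -> psubh E -> False.
Proof.
move=> Sconn Scomp E0 Ep [w hw].
have /choice[v hv] : forall s, exists v, tame v s /\
    \forall z \near s^', w z = v z * cmod (unif s z) ^ (- E s).
  by move=> s; have [_] := hw s.
have Ed s : \forall z \near s^', E z = 0 by have [] := hw s.
pose N s : nat := `|E s|%N.
have EN s : - E s = (N s)%:Z by rewrite /N abszE ler0_norm.
(* The values of [w] at single points carry no information, so [W] is read off each local weight at
   its own centre; [0 ^+ N z] is 1 if [E z = 0] and 0 otherwise. *)
pose W z := v z z * 0 ^+ N z.
have v0 s : 0 < v s s by have [[]] := hv s.
have W0 s : 0 <= W s by rewrite mulr_ge0 ?exprn_ge0// ltW.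
have vs s : \forall z \near s, W z = v s z * cmod (unif s z) ^+ N s.
  have [[_ vc _] ve] := hv s.
  have vc' := nbhs_dnbhs vc.
  have uc := nbhs_dnbhs (cmod_unif_pow_continuous s (N s)).
  have H : \forall z \near s^', W z = v s z * cmod (unif s z) ^+ N s.
    have nE := dnear_near ve.
    have : \forall z \near s^', ({for z, continuous (v s)} /\
        {for z, continuous (fun z => cmod (unif s z) ^+ N s)}) /\
        ((\forall z' \near z, w z' = v s z' * cmod (unif s z') ^ (- E s)) /\ E z = 0).
      by apply: filterI; apply: filterI => //; exact: Ed.
    apply: filterS => z [[c1 c2] [e1 e2]].
    have [[_ /nbhs_singleton vzc _] vze] := hv z.
    have NZ : N z = 0%N by rewrite /N e2.
    rewrite /W NZ expr0 mulr1.
    apply: (@eq_of_dnear (v z) (fun z => v s z * cmod (unif s z) ^+ N s)) => //.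
      exact: continuous_mul.
    apply: filterS2 (nbhs_dnbhs e1) vze => z' -> .
    by rewrite e2 oppr0 expr0z mulr1 EN => <-.
  have H' : nbhs s (fun z => z != s -> W z = v s z * cmod (unif s z) ^+ N s) by [].
  apply: filterS H' => z; have [-> _|zs /(_ isT)//] := eqVneq z s.
  by rewrite unif0 cmod0.
have Wc : continuous W.
  move=> s; have [[_ vc _] _] := hv s.
  have := continuous_mul (nbhs_singleton vc) (nbhs_singleton (cmod_unif_pow_continuous s (N s))).
  by apply: near_eq_continuous; apply: filterS (vs s) => z ->.
have [z0 _ hz0] : exists2 c, c \in [set: S] & forall t, t \in [set: S] -> W t <= W c.
  by apply: compact_EVT_max => //; [exists p|exact: continuous_subspaceT].
have {}hz0 z : W z <= W z0 by apply: hz0; rewrite inE.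
have Wz0 : 0 < W z0.
  have [z1 _ Ez1] := dnbhs_nonempty (Ed p).
  apply: lt_le_trans (hz0 z1); rewrite /W (_ : N z1 = 0%N) ?expr0 ?mulr1//.
  by rewrite /N Ez1.
have Nz z : W z = W z0 -> N z = 0%N.
  move=> e; apply: contraTeq Wz0; rewrite -e /W => n0.
  by rewrite expr0n (negPf n0) mulr0 ltxx.
suff : W p = W z0.
  by move/Nz/eqP; rewrite /N absz_eq0 (negPf Ep).
apply: (@connected_forall _ [set: S] (fun z => W z = W z0)) => //.
- by exists z0.
- move=> z _ Wz; have NZ := Nz z Wz.
  have [[_ _ [m [h [m0 hp he ht]]]] _] := hv z.
  have vW : \forall z' \near z, v z z' = W z'.
    by apply: filterS (vs z) => z' ->; rewrite NZ expr0 mulr1.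
  have hz : cmod (h z) = W z0 ^+ m by rewrite he (nbhs_singleton vW) Wz.
  have : \forall z' \near z, h z' = h z.
    apply: pholo_max => //; apply: filterS2 ht vW => z' + e; rewrite e => h1.
    by rewrite hz; apply: le_trans h1 _; apply: lerXn2r; rewrite ?nnegrE.
  apply: filterS3 ht vW => z' h1 e h2 _; rewrite e h2 hz in h1.
  apply/eqP; rewrite eq_le hz0 /= leNgt; apply/negP => lt.
  rewrite leNgt in h1; move/negP: h1; apply.
  by rewrite ltr_pXn2r ?nnegrE.
- move=> z _ /eqP Wz; have := near_neq_real (Wc z) (@cst_continuous S R (W z0) z) Wz.
  by apply: filterS => z' /eqP.
Qed.

End MaximumPrinciple.

Lemma cmodXz (R : realType) (x : Cx R) (k : int) : cmod (x ^ k) = cmod x ^ k.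
Proof.
case: k => n; first exact: cmodX.
by rewrite !NegzE -!exprnN cmodV cmodX.
Qed.

(** * Gluing weights across a coordinate annulus *)

Section Glue.
Context {R : realType} {S : cmanifold R 1}.
Local Notation C := (Cx R).
Implicit Types (s z p : S).

Definition chart_rad (i : chart_index S) q z : R := cmod (coordi i z - coordi i q).

Definition chart_disc (i : chart_index S) q (r : R) := chart_dom i q /\
  forall x : C, cmod (x - coordi i q) <= r -> exists2 z, chart_dom i z & coordi i z = x.

Lemma chart_disc_exists q : exists i, exists2 r : R, 0 < r & chart_disc i q r.
Proof.
have [i qi] := chart_cover q.
have : nbhs (chart i q) (chart i @` chart_dom i).
  by apply: open_nbhs_nbhs; split; [exact: open_chart_image|exists q].
move=> /nbhs_n1P[e e0 he]; exists i, (e / 2); first by rewrite divr_gt0.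
split => // x hx; have [|z zi zx] := he (const_mx x).
  rewrite /n1 big_ord1 !mxE; apply: le_lt_trans hx _.
  by rewrite ltr_pdivrMr// ltr_pMr// ltr1n.
by exists z => //; rewrite /coordi zx mxE.
Qed.

Lemma near_chart_rad i q z (P : set R) : chart_dom i z -> nbhs (chart_rad i q z) P ->
  \forall z' \near z, P (chart_rad i q z').
Proof.
move=> zi hP; have c : {for z, continuous (chart_rad i q)}.
  apply: (@continuous_comp _ _ _ (fun z => coordi i z - coordi i q) (@cmod R)).
    by apply: holo_continuous; apply: holoB; [exact: holo_coordi|exact: holo_cst].
  exact: cmod_continuous.
exact: c hP.
Qed.

Variables (i : chart_index S) (q : S) (R1 R2 : R).
Hypotheses (R12 : R1 < R2) (qdisc : chart_disc i q R2).

Let K : set S := [set z | chart_dom i z /\ chart_rad i q z <= R2].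

(** A compact image in a Hausdorff space. Closedness makes the region where the glued weight is set
    to 1 open. *)
Lemma chart_disc_closed : closed K.
Proof.
apply: compact_closed; first exact: cmanifold_hausdorff.
have [qi hq] := qdisc.
have -> : K = chart_inv i @` [set v | n1 (v - chart i q) <= R2].
  apply/seteqP; split => z.
    move=> [zi hz]; exists (chart i z); last exact: chartK.
    by rewrite /= /n1 big_ord1 !mxE.
  move=> [v /= hv <-]; rewrite /n1 big_ord1 !mxE in hv.
  have [z' zi' e] := hq (v 0 0) hv.
  have -> : v = chart i z' by apply: rV1P; rewrite -e.
  by rewrite chartK//; split => //; rewrite /chart_rad e.
apply: continuous_compact; last exact: compact_n1.
apply: continuous_in_subspaceT => v /set_mem /= hv.
rewrite /n1 big_ord1 !mxE in hv; have [z' zi' e] := hq (v 0 0) hv.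
have -> : v = chart i z' by apply: rV1P; rewrite -e.
exact: chart_inv_continuous.
Qed.

Variables (ps zs : seq S) (A B : nat) (kappa : R).
Hypotheses (kappa0 : 0 < kappa).
Hypotheses (hps : forall p, p \in ps -> chart_dom i p /\ chart_rad i q p < R1).
Hypotheses (hzs : forall p, p \in zs -> chart_dom i p /\ chart_rad i q p < R1).

Definition chart_prod (l : seq S) z : C := \prod_(p <- l) (coordi i z - coordi i p).
Local Notation PP := (chart_prod ps).
Local Notation QQ := (chart_prod zs).

Hypothesis hR1 : forall z, chart_dom i z -> chart_rad i q z = R1 ->
  cmod (PP z) ^+ A < kappa * cmod (QQ z) ^+ B.
Hypothesis hR2 : forall z, chart_dom i z -> chart_rad i q z = R2 ->
  kappa * cmod (QQ z) ^+ B < cmod (PP z) ^+ A.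

Lemma chart_prod_neq0 l z : (forall p, p \in l -> chart_dom i p /\ chart_rad i q p < R1) ->
  chart_dom i z -> z \notin l -> chart_prod l z != 0.
Proof.
move=> hl zi zl; rewrite prodf_seq_neq0; apply/allP => p pl /=.
rewrite subr_eq0; apply: contraNneq zl => e.
by rewrite (coordi_inj zi (hl p pl).1 e).
Qed.

Lemma chart_prod_holo l z : chart_dom i z -> holo_fun_at (chart_prod l) z.
Proof.
move=> zi j zj; rewrite /chart_prod; apply: differentiable_bigprod => p.
have h : holo_fun_at (fun z => coordi i z - coordi i p) z.
  by apply: holoB; [exact: holo_coordi|exact: holo_cst].
exact: h.
Qed.

(** The poles are at [ps] and the zeros at [zs], since a weight for [E] behaves like
    [|unif s|^(- E s)]. *)
Let g z : C := QQ z ^+ B * (PP z ^+ A)^-1.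
Let G z : R := kappa * cmod (g z).

Let E z : int := (count_mem z ps)%:Z *+ A - (count_mem z zs)%:Z *+ B.

Lemma chart_prod_order l s : (forall p, p \in l -> chart_dom i p /\ chart_rad i q p < R1) ->
  chart_dom i s -> morder (chart_prod l) s (count_mem s l)%:Z.
Proof.
move=> hl si; elim: l hl => [|p l IH] hl.
  rewrite /chart_prod; under eq_fun do rewrite big_nil; exact: morder_cst.
rewrite /chart_prod; under eq_fun do rewrite big_cons.
rewrite /= PoszD (_ : Posz (p == s) = (s == p)%:R); last by rewrite eq_sym; case: (s == p).
apply: morder_mul; first by apply: morder_coordi => //; apply: (hl p _).1; rewrite mem_head.
by apply: IH => p' p'l; apply: hl; rewrite inE p'l orbT.
Qed.

Lemma glue_order s : chart_dom i s -> morder g s (- E s).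
Proof.
move=> si; rewrite /E opprB; apply: morder_mul.
  by apply: morder_exp; exact: chart_prod_order.
by apply: morder_inv; apply: morder_exp; exact: chart_prod_order.
Qed.

Lemma tame_scale (h : S -> C) s : pholo h s -> h s != 0 ->
  tame (fun z => kappa * cmod (h z)) s.
Proof.
move=> hp h0; apply: (tame_near_eq _ (tame_cmod (pholoM (pholo_cst (r2c kappa) s) hp) _)).
  by near=> z; rewrite cmodM cmod_r2c gtr0_norm.
rewrite mulf_neq0// -cmod_eq0 cmod_r2c normr_eq0 gt_eqF//.
Unshelve. all: by end_near.
Qed.

Lemma tame_G s : chart_dom i s -> s \notin ps -> s \notin zs -> tame G s.
Proof.
move=> si sp sz.
have P0 := chart_prod_neq0 hps si sp; have Q0 := chart_prod_neq0 hzs si sz.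
have hp l : pholo (chart_prod l) s.
  by apply: holo_pholo; apply: filterS (near_chart_dom si) => z; exact: chart_prod_holo.
apply: tame_scale.
  apply: pholoM; first exact: pholoX.
  by apply: pholoV; [exact: pholoX|exact: expf_neq0].
by rewrite mulf_neq0 ?invr_eq0 ?expf_neq0.
Qed.

(* The inequalities on the circles of radii R1 and R2 say that G > 1 on the inner
   one and G < 1 on the outer one, so max(G, 1) extends G inside and 1 outside. *)
Lemma glue_psubh : psubh E.
Proof.
pose w z := if `[< K z >] then if chart_rad i q z <= R1 then G z else Num.max (G z) 1 else 1.
have KP z : chart_dom i z -> `[< K z >] = (chart_rad i q z <= R2).
  by move=> zi; apply/asboolP/idP => [[]|].
have out (l : seq S) z : (forall p, p \in l -> chart_dom i p /\ chart_rad i q p < R1) ->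
    (chart_dom i z -> R1 <= chart_rad i q z) -> z \notin l.
  by move=> hl hz; apply/negP => /hl[zi]; rewrite ltNge hz.
have E0 z : z \notin ps -> z \notin zs -> E z = 0.
  by move=> h1 h2; rewrite /E (count_memPn h1) (count_memPn h2) !mul0rn subr0.
exists w => s; split.
  by apply: filterS2 (dnear_notin s ps) (dnear_notin s zs) => z; exact: E0.
have one : tame (fun=> 1) s.
  apply: (tame_near_eq _ (tame_cmod (pholo_cst 1 s) (oner_neq0 _))).
  by near=> z; rewrite cmod1.
have trivial_case v : tame v s -> E s = 0 -> (\forall z \near s, v z = w z) ->
    exists v, tame v s /\ \forall z \near s^', w z = v z * cmod (unif s z) ^ (- E s).
  move=> vt Es vw; exists v; split => //; rewrite Es.
  by apply: nbhs_dnbhs; apply: filterS vw => z ->; rewrite oppr0 expr0z mulr1.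
have [[si sR2]|nK] := pselect (K s); last first.
  have o (l : seq S) : (forall p, p \in l -> chart_dom i p /\ chart_rad i q p < R1) -> s \notin l.
    by move=> hl; apply: (out l s hl) => si; rewrite leNgt; apply/negP => lt;
       apply: nK; split => //; apply: ltW; apply: lt_trans lt R12.
  apply: (trivial_case _ one); first by apply: E0; exact: o.
  have : nbhs s (~` K).
    by apply: open_nbhs_nbhs; split => //; rewrite openC; exact: chart_disc_closed.
  by apply: filterS => z Kz; rewrite /w asboolF.
have sd := near_chart_dom si.
have Gcont (P : set R) : tame G s -> nbhs (G s) P -> \forall z \near s, P (G z).
  by move=> [_ /nbhs_singleton c _] hP; exact: c hP.
case: (ltgtP (chart_rad i q s) R1) => sR1.
- have n1 : \forall z \near s, chart_rad i q z < R1 by apply: (near_chart_rad si (P := [set x | x < R1])); exact: lt_nbhsl.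
  have [h [hp h0 he]] := glue_order si.
  exists (fun z => kappa * cmod (h z)); split; first exact: tame_scale.
  apply: filterS3 he (nbhs_dnbhs n1) (nbhs_dnbhs sd) => z ge zR1 zi.
  rewrite /w KP// (ltW (lt_trans zR1 R12)) (ltW zR1) /G ge cmodM cmodXz.
  by rewrite mulrA mulrAC.
- have sp : s \notin ps by apply: (out _ _ hps) => _; exact: ltW.
  have sz : s \notin zs by apply: (out _ _ hzs) => _; exact: ltW.
  have tG := tame_G si sp sz.
  have n1 : \forall z \near s, R1 < chart_rad i q z by apply: (near_chart_rad si (P := [set x | R1 < x])); exact: lt_nbhsr.
  move: sR2; rewrite le_eqVlt => /orP[/eqP sR2|sR2].
    apply: (trivial_case _ one); first exact: E0.
    have n2 : \forall z \near s, G z < 1.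
      apply: (Gcont [set x | x < 1] tG); apply: lt_nbhsl.
      have P0 := chart_prod_neq0 hps si sp.
      rewrite /G /g cmodM cmodV !cmodX mulrA ltr_pdivrMr ?exprn_gt0 ?cmod_gt0// mul1r.
      exact: hR2.
    apply: filterS3 sd n1 n2 => z zi zR1 zG; rewrite /w.
    case: ifP => // _; rewrite leNgt zR1 /= max_r//; exact: ltW.
  apply: (trivial_case _ (tame_max tG one)); first exact: E0.
  have n2 : \forall z \near s, chart_rad i q z < R2 by apply: (near_chart_rad si (P := [set x | x < R2])); exact: lt_nbhsl.
  apply: filterS3 sd n1 n2 => z zi zR1 zR2; rewrite /w KP// ltW//=.
  by rewrite leNgt zR1.
- have sp : s \notin ps by apply: (out _ _ hps) => _; rewrite sR1.
  have sz : s \notin zs by apply: (out _ _ hzs) => _; rewrite sR1.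
  have tG := tame_G si sp sz.
  apply: (trivial_case _ tG); first exact: E0.
  have n2 : \forall z \near s, chart_rad i q z < R2.
    by apply: (near_chart_rad si (P := [set x | x < R2])); apply: lt_nbhsl; rewrite sR1.
  have n3 : \forall z \near s, 1 < G z.
    apply: (Gcont [set x | 1 < x] tG); apply: lt_nbhsr.
    have P0 := chart_prod_neq0 hps si sp.
    rewrite /G /g cmodM cmodV !cmodX mulrA ltr_pdivlMr ?exprn_gt0 ?cmod_gt0// mul1r.
    exact: hR1.
  apply: filterS3 sd n2 n3 => z zi zR2 zG; rewrite /w KP// ltW//=.
  by case: ifP => // _; rewrite max_l// ltW.
Unshelve. all: by end_near.
Qed.

End Glue.

(** * Degrees of divisors *)

Section Cone.
Context {R : realType} {S : cmanifold R 1}.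
Local Notation C := (Cx R).
Implicit Types (s z p q : S) (E : S -> rat).

Definition pmass p : S -> rat := fun s => (s == p)%:R.

(** Weights are raised to natural powers only, hence rational rather than real coefficients; [m]
    clears the denominators. *)
Definition cone E := exists m : nat, (0 < m)%N /\ exists2 E' : S -> int, psubh E' &
  forall s, (E' s)%:~R = m%:R * E s.

Lemma cone_ext E1 E2 : (forall s, E1 s = E2 s) -> cone E1 -> cone E2.
Proof. by move=> /funext ->. Qed.

Lemma coneD E1 E2 : cone E1 -> cone E2 -> cone (fun s => E1 s + E2 s).
Proof.
move=> [m1 [m10 [F1 h1 e1]]] [m2 [m20 [F2 h2 e2]]].
exists (m1 * m2)%N; split; first by rewrite muln_gt0 m10.
exists (fun s => F1 s *+ m2 + F2 s *+ m1).
  by apply: psubhD; exact: psubhMn.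
by move=> s; rewrite rmorphD /= !rmorphMn /= e1 e2 -[_ *+ m2]mulr_natr -[_ *+ m1]mulr_natr natrM; ring.
Qed.

Lemma cone0 : cone (fun=> 0).
Proof.
exists 1%N; split => //; exists (fun=> 0); first exact: psubh0.
by move=> s; rewrite mulr0.
Qed.

Lemma coneZ (c : rat) E : 0 <= c -> cone E -> cone (fun s => c * E s).
Proof.
move=> c0 [m [m0 [F h e]]].
have nc : 0 <= numq c by rewrite numq_ge0.
exists (`|denq c| * m)%N; split.
  by rewrite muln_gt0 m0 andbT absz_gt0 denq_neq0.
exists (fun s => F s *+ `|numq c|); first exact: psubhMn.
move=> s; rewrite rmorphMn /= e -[LHS]mulr_natl natrM.
have -> : (`|numq c|%N)%:R = (numq c)%:~R :> rat.
  by rewrite -[in RHS](gez0_abs nc).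
have -> : (`|denq c|%N)%:R = (denq c)%:~R :> rat.
  by rewrite -[in RHS](gez0_abs (ltW (denq_gt0 c))).
rewrite -{3}(divq_num_den c); field.
by rewrite intr_eq0 denq_neq0.
Qed.

Lemma cone_sum (I : Type) (l : seq I) (F : I -> S -> rat) :
  (forall i, cone (F i)) -> cone (fun s => \sum_(i <- l) F i s).
Proof.
move=> h; elim: l => [|i l IH].
  by apply: cone_ext cone0 => s; rewrite big_nil.
by apply: cone_ext (coneD (h i) IH) => s; rewrite big_cons.
Qed.

Lemma cone_neg E p : connected [set: S] -> compact [set: S] ->
  (forall s, E s <= 0) -> E p != 0 -> ~ cone E.
Proof.
move=> Sc Sk E0 Ep [m [m0 [F h e]]].
have mR : 0 < (m%:R : rat) by rewrite ltr0n.
apply: (@psubh_neg R S F p) => //.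
  by move=> s; rewrite -(ler_int rat) e pmulr_rle0.
by rewrite -(intr_eq0 rat) e mulf_neq0// gt_eqF.
Qed.

Lemma cone_glue i q (R1 R2 : R) (ps zs : seq S) (A B : nat) (kappa : R) :
  R1 < R2 -> chart_disc i q R2 -> 0 < kappa ->
  (forall p, p \in ps -> chart_dom i p /\ chart_rad i q p < R1) ->
  (forall p, p \in zs -> chart_dom i p /\ chart_rad i q p < R1) ->
  (forall z, chart_dom i z -> chart_rad i q z = R1 ->
    cmod (chart_prod i ps z) ^+ A < kappa * cmod (chart_prod i zs z) ^+ B) ->
  (forall z, chart_dom i z -> chart_rad i q z = R2 ->
    kappa * cmod (chart_prod i zs z) ^+ B < cmod (chart_prod i ps z) ^+ A) ->
  cone (fun s => (count_mem s ps)%:R * A%:R - (count_mem s zs)%:R * B%:R).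
Proof.
move=> R12 qd k0 hps hzs h1 h2; exists 1%N; split => //.
have h := glue_psubh R12 qd k0 hps hzs h1 h2.
exists (fun z : S => (count_mem z ps)%:Z *+ A - (count_mem z zs)%:Z *+ B) => //.
by move=> s; rewrite mul1r rmorphB /= !rmorphMn /= -[_ *+ A]mulr_natr -[_ *+ B]mulr_natr.
Qed.

Lemma chart_prod1 i p z : chart_prod i [:: p] z = coordi i z - coordi i p.
Proof. by rewrite /chart_prod big_seq1. Qed.

Lemma chart_rad_self i q : chart_rad i q q = 0. Proof. by rewrite /chart_rad subrr cmod0. Qed.

(** The weight is [kappa / |z - q|] cut off at 1, with [kappa] strictly between the two radii
    [r / 2] and [r]. *)
Lemma cone_pmass q : cone (pmass q).
Proof.
have [i [r r0 qd]] := chart_disc_exists q; have [qi _] := qd.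
have r2 : 0 < r / 2 by rewrite divr_gt0.
have rr : r / 2 < r by rewrite ltr_pdivrMr// ltr_pMr// ltr1n.
have := @cone_glue i q (r / 2) r [:: q] [::] 1 0 (3 / 4 * r) rr qd.
move=> h; have k0 : 0 < 3 / 4 * r by rewrite mulr_gt0.
apply: cone_ext (h k0 _ _ _ _).
- by move=> s; rewrite /= mul0r subr0 mulr1 addn0 /pmass eq_sym.
- by move=> p; rewrite inE => /eqP ->; rewrite chart_rad_self.
- by [].
- move=> z zi hz; rewrite chart_prod1 -/(chart_rad i q z) hz expr1 expr0 mulr1.
  by move: r0; lra.
- move=> z zi hz; rewrite chart_prod1 -/(chart_rad i q z) hz expr1 expr0 mulr1.
  by move: r0; lra.
Qed.

Lemma rat_gt1_frac (c : rat) : 1 < c -> exists A B : nat,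
  [/\ (0 < B)%N, (B < A)%N & c = A%:R / B%:R].
Proof.
move=> c1; have c0 : 0 < c by apply: lt_trans c1.
have n0 : 0 < numq c by rewrite numq_gt0.
exists `|numq c|%N, `|denq c|%N.
have cE : c = (`|numq c|%N)%:R / (`|denq c|%N)%:R.
  rewrite -{1}(divq_num_den c); congr (_ / _).
    by rewrite -[in LHS](gez0_abs (ltW n0)).
  by rewrite -[in LHS](gez0_abs (ltW (denq_gt0 c))).
have d0 : (0 < `|denq c|)%N by rewrite absz_gt0 denq_neq0.
split => //; move: c1; rewrite cE ltr_pdivlMr ?ltr0n// mul1r ltr_nat.
by rewrite -cE.
Qed.

(** For [e = 0] the inequalities read [R1^(A-B) < kappa < R2^(A-B)]; continuity leaves room for a
    positive [e]. *)
Lemma annulus_gap (R1 R2 : R) (A B : nat) : 0 < R1 -> R1 < R2 -> (B < A)%N ->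
  exists kappa e : R, [/\ 0 < kappa, 0 < e < R1,
    (R1 + e) ^+ A < kappa * (R1 - e) ^+ B & kappa * (R2 + e) ^+ B < (R2 - e) ^+ A].
Proof.
move=> R10 R12 BA; have R20 : 0 < R2 by exact: lt_trans R12.
pose x1 := R1 ^+ (A - B); pose x2 := R2 ^+ (A - B).
have x12 : x1 < x2 by rewrite ltr_pXn2r ?nnegrE ?ltW// subn_gt0.
have x10 : 0 < x1 by rewrite exprn_gt0.
pose k := (x1 + x2) / 2.
have k1 : x1 < k by rewrite /k; lra.
have k2 : k < x2 by rewrite /k; lra.
have sc (x s : R) n : {for 0, continuous (fun e : R => (x + s * e) ^+ n)}.
  apply: (@continuous_comp _ _ _ (fun e : R => x + s * e) (fun y : R => y ^+ n)).
    by apply: cvgD; [exact: cvg_cst|exact: mulrl_continuous].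
  exact: exprn_continuous.
have f1c : {for 0, continuous (fun e : R => k * (R1 + (-1) * e) ^+ B - (R1 + 1 * e) ^+ A)}.
  apply: (@continuousB _ R^o); last exact: sc.
  by apply: continuous_mul; [exact: cst_continuous|exact: sc].
have f2c : {for 0, continuous (fun e : R => (R2 + (-1) * e) ^+ A - k * (R2 + 1 * e) ^+ B)}.
  apply: (@continuousB _ R^o); first exact: sc.
  by apply: continuous_mul; [exact: cst_continuous|exact: sc].
have p1 : 0 < k * (R1 + (-1) * 0) ^+ B - (R1 + 1 * 0) ^+ A.
  rewrite !mulr0 addr0 subr_gt0 -(subnK (ltnW BA)) exprD ltr_pM2r//.
  by rewrite exprn_gt0.
have p2 : 0 < (R2 + (-1) * 0) ^+ A - k * (R2 + 1 * 0) ^+ B.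
  rewrite !mulr0 addr0 subr_gt0 -[X in _ < R2 ^+ X](subnK (ltnW BA)) exprD ltr_pM2r//.
  by rewrite exprn_gt0.
have n1 : nbhs (0 : R) (fun e : R => 0 < k * (R1 + (-1) * e) ^+ B - (R1 + 1 * e) ^+ A).
  exact: (f1c _ (lt_nbhsr p1)).
have n2 : nbhs (0 : R) (fun e : R => 0 < (R2 + (-1) * e) ^+ A - k * (R2 + 1 * e) ^+ B).
  exact: (f2c _ (lt_nbhsr p2)).
have /nbhs_ballP[d /= d0 hd] : nbhs (0 : R) (fun e : R =>
    0 < k * (R1 + (-1) * e) ^+ B - (R1 + 1 * e) ^+ A /\
    0 < (R2 + (-1) * e) ^+ A - k * (R2 + 1 * e) ^+ B) by exact: filterI n1 n2.
pose e := Num.min (d / 2) (R1 / 2).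
have e0 : 0 < e by rewrite lt_min !divr_gt0.
have ed : e < d.
  by apply: (@le_lt_trans _ _ (d / 2)); [rewrite ge_min lexx|move: d0; lra].
have eR : e < R1.
  by apply: (@le_lt_trans _ _ (R1 / 2)); [rewrite ge_min lexx orbT|move: R10; lra].
have [|] := hd e; first by rewrite -ball_normE /ball_ /= sub0r normrN gtr0_norm.
rewrite !mulN1r !mul1r !subr_gt0 => h1 h2.
exists k, e; split => //; first by apply: lt_trans k1.
by rewrite e0.
Qed.

(** A local Harnack inequality, in both directions. With [c = A / B], a pole of order [A] is played
    against a zero of order [B]; points within [e] of the centre change the distances to the two
    circles by at most [e]. *)
Lemma cone_near q (c : rat) : 1 < c -> \forall q' \near q,
  cone (fun s => c * pmass q s - pmass q' s) /\ cone (fun s => c * pmass q' s - pmass q s).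
Proof.
move=> /rat_gt1_frac[A [B [B0 BA ->]]].
have [i [r r0 qd]] := chart_disc_exists q; have [qi _] := qd.
have r2 : 0 < r / 2 by rewrite divr_gt0.
have rr : r / 2 < r by rewrite ltr_pdivrMr// ltr_pMr// ltr1n.
have [k [e [k0 /andP[e0 eR] h1 h2]]] := annulus_gap r2 rr BA.
have n1 : \forall q' \near q, chart_rad i q q' < e.
  by apply: (near_chart_rad qi (P := [set x | x < e])); apply: lt_nbhsl; rewrite chart_rad_self.
apply: filterS2 n1 (near_chart_dom qi) => q' q'e q'i.
have H p z : chart_rad i q p < e -> chart_dom i p -> chart_rad i q z < e -> chart_dom i z ->
    cone (fun s => A%:R / B%:R * pmass p s - pmass z s).
  move=> pe pi ze zi.
  have E x (y : S) : chart_rad i q y < e -> chart_rad i q x - e <= cmod (coordi i x - coordi i y) /\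
      cmod (coordi i x - coordi i y) <= chart_rad i q x + e.
    move=> ye; have a1 := cmod_tri (coordi i y) (coordi i x) (coordi i q).
    have a2 := cmod_tri (coordi i q) (coordi i x) (coordi i y).
    by move: ye a1 a2; rewrite /chart_rad (cmodB (coordi i q)); split; lra.
  have h := @cone_glue i q (r / 2) r [:: p] [:: z] A B k rr qd k0.
  have BR : (0 : rat) <= B%:R^-1 by rewrite invr_ge0.
  have B1 : (B%:R : rat) != 0 by rewrite pnatr_eq0 -lt0n.
  apply: cone_ext (coneZ BR (h _ _ _ _)).
  - by move=> s; rewrite /= !addn0 /pmass !(eq_sym s); field.
  - by move=> x; rewrite inE => /eqP ->; split => //; exact: lt_trans eR.
  - by move=> x; rewrite inE => /eqP ->; split => //; exact: lt_trans eR.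
  - move=> x xi xR; rewrite !chart_prod1.
    have [_ b1] := E x p pe; have [b2 _] := E x z ze; rewrite xR in b1 b2.
    apply: (@le_lt_trans _ _ ((r / 2 + e) ^+ A)).
      by apply: lerXn2r; rewrite ?nnegrE ?cmod_ge0// addr_ge0 ?ltW.
    apply: lt_le_trans h1 _; rewrite ler_pM2l//.
    by apply: lerXn2r; rewrite ?nnegrE ?cmod_ge0// subr_ge0 ltW.
  - move=> x xi xR; rewrite !chart_prod1.
    have [b1 _] := E x p pe; have [_ b2] := E x z ze; rewrite xR in b1 b2.
    apply: (@le_lt_trans _ _ (k * (r + e) ^+ B)).
      rewrite ler_pM2l//.
      by apply: lerXn2r; rewrite ?nnegrE ?cmod_ge0// addr_ge0 ?ltW.
    apply: lt_le_trans h2 _.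
    by apply: lerXn2r; rewrite ?nnegrE ?cmod_ge0// subr_ge0 ltW// (lt_trans eR).
by split; apply: H => //; rewrite chart_rad_self.
Qed.

End Cone.

Lemma prod_roots (F : fieldType) n (w u a : F) : n.-primitive_root w -> a != 0 ->
  \prod_(j < n) (u - a * w ^+ j) = u ^+ n - a ^+ n.
Proof.
move=> wn a0; have := factor_Xn_sub_1 wn.
move=> /(congr1 (fun P => a ^+ n * P.[u / a])).
rewrite big_mkord horner_prod !hornerE expr_div_n mulrBr mulr1.
rewrite mulrCA mulfV ?expf_neq0// mulr1 => <-.
rewrite -[X in a ^+ X]card_ord -prodr_const -big_split /=.
by apply: eq_bigr => j _; rewrite !hornerE mulrBr mulrCA mulfV// mulr1.
Qed.

(** * Mean value inequality over a circle *)

Section Circle.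
Context {R : realType} {S : cmanifold R 1}.
Local Notation C := (Cx R).
Implicit Types (s z p q : S) (E : S -> rat).

Definition chart_pt (i : chart_index S) (x : C) : S := chart_inv i (const_mx x).

Lemma chart_ptP i q r x : chart_disc i q r -> cmod (x - coordi i q) <= r ->
  chart_dom i (chart_pt i x) /\ coordi i (chart_pt i x) = x.
Proof.
move=> [qi h] /h[z zi zx]; have -> : chart_pt i x = z; last by [].
rewrite /chart_pt (_ : const_mx x = chart i z) ?chartK//.
by apply: rV1P; rewrite mxE -zx.
Qed.

Lemma count_mem_pmass (l : seq S) s : (count_mem s l)%:R = \sum_(p <- l) pmass p s.
Proof.
elim: l => [|p l IH]; first by rewrite big_nil.
by rewrite big_cons /= natrD IH /pmass eq_sym.
Qed.

Lemma exprn_small (y e : R) : 0 <= y < 1 -> 0 < e -> exists K, forall k, (K <= k)%N ->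
  y ^+ (2 ^ k) < e.
Proof.
move=> /andP[y0 y1] e0.
have h : (fun n => y ^+ n) @ \oo --> (0 : R) by apply: cvg_expr; rewrite ger0_norm.
have hn : nbhs (0 : R) (fun x => x < e) by exact: lt_nbhsl.
have [K _ hK] := h _ hn.
exists K => k Kk; apply: le_lt_trans (hK K (leqnn K)).
by apply: ler_wiXn2l => //; [exact: ltW|exact: leq_trans Kk (ltnW (ltn_expl k (ltnSn 1)))].
Qed.

(** With [u] the coordinate centred at [q], poles at the [N] points of the circle multiply to
    [u^N - a^N], and [N] zeros at the centre to [u^N]. For large [N] the two are comparable outside
    the circle, and [c > 1] absorbs the discrepancy. *)
Lemma cone_circle i q (r : R) (a : C) (c : rat) : chart_disc i q r ->
  a != 0 -> cmod a < r -> 1 < c -> exists K, forall k, (K <= k)%N ->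
  cone (fun s => c / (2 ^ k)%:R *
    (\sum_(j < 2 ^ k) pmass (chart_pt i (coordi i q + a * rootu k ^+ j)) s) - pmass q s).
Proof.
move=> qd a0 ar /rat_gt1_frac[A [B [B0 BA ->]]].
pose R1 := (cmod a + r) / 2; pose y := R1 / r.
have ca : 0 < cmod a by rewrite cmod_gt0.
have r0 : 0 < r by exact: lt_trans ar.
have aR1 : cmod a < R1 by rewrite /R1; lra.
have R1r : R1 < r by rewrite /R1; lra.
have R10 : 0 < R1 by exact: lt_trans aR1.
have y01 : 0 <= y < 1 by rewrite divr_ge0 ?ltW//= ltr_pdivrMr// mul1r.
(* [|u^N - a^N|] is at most [2 * R1^N] on the inner circle and at least [r^N / 2] on the outer one.
   With [kappa] as below, the outer inequality amounts to [(R1 / r)^(N * (A - B)) < eta], which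
   follows from [(R1 / r)^N < eta]. *)
pose eta : R := (2 * 4 ^+ A)^-1.
have eta0 : 0 < eta by rewrite invr_gt0 mulr_gt0// exprn_gt0.
have [K hK] := exprn_small y01 eta0.
exists K => k /hK yk; pose N := (2 ^ k)%N.
have N0 : (0 < N)%N by rewrite expn_gt0.
pose pt j := chart_pt i (coordi i q + a * rootu k ^+ j).
have ptP j : chart_dom i (pt j) /\ coordi i (pt j) = coordi i q + a * rootu k ^+ j.
  apply: (chart_ptP qd); rewrite addrAC subrr add0r cmodM cmod_rootuX mulr1.
  exact: ltW.
pose ps := [seq pt j | j <- iota 0 N].
pose kappa : R := 2 * (2 ^+ A * R1 ^+ (N * (A - B))).
have k0 : 0 < kappa by rewrite !mulr_gt0 ?exprn_gt0.
have [qi _] := qd.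
have hps p : p \in ps -> chart_dom i p /\ chart_rad i q p < R1.
  move=> /mapP[j _ ->]; have [h1 h2] := ptP j; split => //.
  by rewrite /chart_rad h2 addrAC subrr add0r cmodM cmod_rootuX mulr1.
have hzs p : p \in nseq N q -> chart_dom i p /\ chart_rad i q p < R1.
  by move=> /nseqP[-> _]; rewrite chart_rad_self.
have PE z : chart_prod i ps z = (coordi i z - coordi i q) ^+ N - a ^+ N.
  rewrite /chart_prod big_map -{1}(subn0 N) -/(index_iota 0 N) big_mkord -(prod_roots _ (rootu_prim k) a0).
  by apply: eq_bigr => j _; have [_ ->] := ptP j; rewrite opprD addrA.
have QE z : cmod (chart_prod i (nseq N q) z) = chart_rad i q z ^+ N.
  by rewrite /chart_prod big_nseq -cmodX; congr cmod; rewrite -iter_mulr_1.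
have NAB : (N * A = N * (A - B) + N * B)%N by rewrite -mulnDr subnK// ltnW.
have powE (x : R) : (x ^+ N) ^+ A = x ^+ (N * (A - B)) * (x ^+ N) ^+ B.
  by rewrite -!exprM -exprD -NAB.
have h1 z : chart_dom i z -> chart_rad i q z = R1 ->
    cmod (chart_prod i ps z) ^+ A < kappa * cmod (chart_prod i (nseq N q) z) ^+ B.
  move=> zi zR; rewrite QE zR PE.
  apply: (@le_lt_trans _ _ ((2 * R1 ^+ N) ^+ A)).
    have g0 : 0 <= 2 * R1 ^+ N by rewrite mulr_ge0// exprn_ge0// ltW.
    apply: lerXn2r; rewrite ?nnegrE ?cmod_ge0//.
    apply: le_trans (cmodBD _ _) _; rewrite !cmodX -/(chart_rad i q z) zR.
    have : cmod a ^+ N <= R1 ^+ N by apply: lerXn2r; rewrite ?nnegrE ?ltW.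
    by lra.
  rewrite exprMn powE /kappa -!mulrA ltr_pMl ?ltr1n//.
  by rewrite !mulr_gt0 ?exprn_gt0.
have h2 z : chart_dom i z -> chart_rad i q z = r ->
    kappa * cmod (chart_prod i (nseq N q) z) ^+ B < cmod (chart_prod i ps z) ^+ A.
  move=> zi zR; rewrite QE zR PE.
  have rN : 0 < r ^+ N by rewrite exprn_gt0.
  have ky : R1 ^+ N < eta * r ^+ N by move: yk; rewrite expr_div_n ltr_pdivrMr.
  have et2 : eta <= 2^-1.
    rewrite /eta lef_pV2 ?posrE ?mulr_gt0 ?exprn_gt0// ler_pMr//.
    by rewrite exprn_ege1// ler1n.
  have aN : cmod a ^+ N <= r ^+ N / 2.
    apply: (@le_trans _ _ (R1 ^+ N)); first by apply: lerXn2r; rewrite ?nnegrE ?ltW.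
    by apply: le_trans (ltW ky) _; rewrite mulrC ler_wpM2l// ltW.
  apply: (@lt_le_trans _ _ ((r ^+ N / 2) ^+ A)); last first.
    have g0 : 0 <= r ^+ N / 2 by rewrite divr_ge0// ltW.
    apply: lerXn2r; rewrite ?nnegrE ?cmod_ge0//.
    have := cmod_leB ((coordi i z - coordi i q) ^+ N) (a ^+ N).
    by rewrite !cmodX -/(chart_rad i q z) zR; move: aN; lra.
  rewrite exprMn powE /kappa exprVn.
  rewrite [ltRHS]mulrAC ltr_pM2r ?exprn_gt0//.
  rewrite ltr_pdivlMr ?exprn_gt0//.
  have -> : 2 * (2 ^+ A * R1 ^+ (N * (A - B))) * 2 ^+ A =
     2 * 4 ^+ A * R1 ^+ (N * (A - B)) :> R.
    have -> : (4 : R) = 2 * 2 by rewrite -natrM.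
    by rewrite (exprMn A (2 : R) 2) -!mulrA [R1 ^+ _ * _]mulrC.
  rewrite mulrC -ltr_pdivlMr ?mulr_gt0 ?exprn_gt0// -/eta.
  have [m ->] : exists m, (A - B = m.+1)%N.
    by exists (A - B).-1; rewrite prednK// subn_gt0.
  rewrite [R1 ^+ _]exprM [r ^+ _]exprM !exprS.
  apply: (@le_lt_trans _ _ (R1 ^+ N * (r ^+ N) ^+ m)).
    have g1 : R1 ^+ N <= r ^+ N by apply: lerXn2r; rewrite ?nnegrE ?(ltW R10) ?(ltW r0) ?(ltW R1r).
    by rewrite ler_pM2l ?exprn_gt0//; apply: lerXn2r; rewrite ?nnegrE ?exprn_ge0 ?(ltW R10) ?(ltW r0).
  by rewrite [ltRHS]mulrAC ltr_pM2r ?exprn_gt0// mulrC.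
have BR : (0 : rat) <= (B * N)%:R^-1 by rewrite invr_ge0.
have BN0 : ((B * N)%:R : rat) != 0 by rewrite pnatr_eq0 -lt0n muln_gt0 B0.
have h := cone_glue R1r qd k0 hps hzs h1 h2.
apply: cone_ext (coneZ BR h) => s.
have -> : (count_mem s ps)%:R = \sum_(j < N) pmass (pt j) s.
  by rewrite count_mem_pmass big_map -{1}(subn0 N) -/(index_iota 0 N) big_mkord.
rewrite count_nseq natrM -/N.
set X := \sum_(j < N) _.
rewrite (_ : pmass q s = (q == s)%:R) /=; last by rewrite /pmass eq_sym.
move: BN0; rewrite natrM mulf_eq0 negb_or => /andP[b0 n0].
by field; rewrite b0 n0.
Qed.

End Circle.

(** * Harnack constants and the sign of the degree *)

Section Transfer.
Context {R : realType} {S : cmanifold R 1}.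
Local Notation C := (Cx R).
Implicit Types (s z p q : S) (E : S -> rat).
Hypotheses (Sconn : connected [set: S]) (Scomp : compact [set: S]).

Lemma pmass_self p : pmass p p = 1. Proof. by rewrite /pmass eqxx. Qed.

Section Source.
Variable p : S.

Definition transfer (c : rat) q := cone (fun s => c * pmass p s - pmass q s).

Lemma transfer_le c c' q : c <= c' -> transfer c q -> transfer c' q.
Proof.
move=> cc h; have d0 : 0 <= c' - c by rewrite subr_ge0.
by apply: cone_ext (coneD h (coneZ d0 (cone_pmass p))) => s; ring.
Qed.

(** For [c <= 0] the divisor would be nonzero and nonpositive, which the maximum principle
    excludes. *)
Lemma transfer_gt0 c q : transfer c q -> 0 < c.
Proof.
move=> h; rewrite ltNge; apply/negP => c0.
apply: (@cone_neg R S (fun s => c * pmass p s - pmass q s) q) h => //.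
  by move=> s; rewrite /pmass; case: (s == p); case: (s == q) => /=; rewrite ?mulr1 ?mulr0; move: c0; lra.
rewrite pmass_self /pmass lt_eqF//; case: (q == p) => /=.
  rewrite mulr1; lra.
rewrite mulr0; lra.
Qed.

Lemma transfer_trans c d q q' : 0 <= d -> transfer c q ->
  cone (fun s => d * pmass q s - pmass q' s) -> transfer (d * c) q'.
Proof. by move=> d0 h1 h2; apply: cone_ext (coneD (coneZ d0 h1) h2) => s; ring. Qed.

Lemma transfer_near c c' q : c < c' -> transfer c q -> \forall q' \near q, transfer c' q'.
Proof.
move=> cc h; have c0 := transfer_gt0 h.
have d1 : 1 < c' / c by rewrite ltr_pdivlMr// mul1r.
apply: filterS (cone_near q d1) => q' [h1 _].
have := transfer_trans (ltW (lt_trans ltr01 d1)) h h1.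
by rewrite divfK// gt_eqF.
Qed.

(** Chains of discs: the two directions of [cone_near] give the openness and the closedness of the
    set of points reached from [p]. *)
Lemma transfer_exists q : exists c, transfer c q.
Proof.
apply: (@connected_forall _ [set: S] (fun q => exists c, transfer c q)) => //.
- exists p => //; exists 1; apply: cone_ext (@cone0 R S) => s; ring.
- move=> a _ [c hc]; have cc : c < c + 1 by lra.
  by apply: filterS (transfer_near cc hc) => q' h _; exists (c + 1).
- move=> a _ ha; have d1 : (1 : rat) < 2 by [].
  apply: filterS (cone_near a d1) => q' [_ h] _ [c hc]; apply: ha.
  by exists (2 * c); exact: transfer_trans hc h.
Qed.

Lemma transfer_uniform : exists c, forall q, transfer c q.
Proof.
have /compact_near_coveringP h := Scomp.
have [|N _ hN] := h nat \oo (fun N q => transfer N%:R q) _; last first.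
  by exists N%:R => q; exact: (hN N (leqnn N)).
move=> q _; have [c hc] := transfer_exists q.
have cc : c < c + 1 by lra.
have [N hN] : exists N : nat, c + 1 <= N%:R.
  by exists (Num.truncn (c + 1)).+1; apply: ltW; exact: truncnS_gt.
exists ([set q' | transfer (c + 1) q'], [set n | (N <= n)%N]).
  by split; [exact: transfer_near hc|exists N].
move=> [q' n] [/= hq Nn]; apply: transfer_le hq; apply: le_trans hN _.
by rewrite ler_nat.
Qed.

Lemma rat_between (x y : R) : x < y -> exists c : rat, x < ratr c < y.
Proof.
by move=> /rat_in_itvoo[c]; rewrite in_itv /= => h; exists c.
Qed.

(** The supremum over [q] of the optimal constants, expressed as the infimum of the uniform ones. *)
Let bound : R := inf [set x : R | exists2 c : rat, ratr c = x & forall q, transfer c q].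

Let bound_inf : has_inf [set x : R | exists2 c : rat, ratr c = x & forall q, transfer c q].
Proof.
split; first by have [c hc] := transfer_uniform; exists (ratr c), c.
exists 0 => x [c <- hc]; rewrite -(rmorph0 (ratr : rat -> R)) ler_rat.
exact: ltW (transfer_gt0 (hc p)).
Qed.

Lemma transfer_above (c : rat) q : bound < ratr c -> transfer c q.
Proof.
move=> h; have d0 : 0 < ratr c - bound by rewrite subr_gt0.
have [x [c' <- hc'] hx] := inf_adherent d0 bound_inf.
apply: transfer_le (hc' q); rewrite -(ler_rat R); apply: ltW.
by move: hx; rewrite -/bound; lra.
Qed.

Lemma bound_le (c : rat) : (forall q, transfer c q) -> bound <= ratr c.
Proof. by move=> hc; apply: ge_inf; [exact: bound_inf.2|exists c]. Qed.

(** If every point had a constant below [bound], compactness would give a uniform one below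
    [bound]. *)
Lemma bound_attained : exists q, forall c : rat, ratr c < bound -> ~ transfer c q.
Proof.
apply: contrapT => hn.
have H q : exists2 c : rat, ratr c < bound & transfer c q.
  apply: contrapT => hq; apply: hn; exists q => c cb hc; apply: hq; by exists c.
have /compact_near_coveringP h := Scomp.
have [|N _ hN] := h nat \oo (fun N q => exists2 c : rat,
    ratr c <= bound - N.+1%:R^-1 & transfer c q) _; last first.
  have [c /andP[c1 c2]] : exists c : rat, bound - N.+1%:R^-1 < ratr c < bound.
    by apply: rat_between; rewrite ltrBlDr ltrDl invr_gt0.
  have : forall q, transfer c q.
    move=> q; have [c' h1 h2] := hN N (leqnn N) q I; apply: transfer_le h2.
    by rewrite -(ler_rat R); apply: ltW; exact: le_lt_trans c1.
  by move=> /bound_le; rewrite leNgt c2.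
move=> q _; have [c cb hc] := H q.
have [c' /andP[c1 c2]] := rat_between cb.
have d0 : 0 < bound - ratr c' by rewrite subr_gt0.
have [N _ hN] := near_infty_natSinv_lt (PosNum d0).
exists ([set q' | transfer c' q'], [set n | (N <= n)%N]).
  split; last by exists N.
  by apply: transfer_near hc; rewrite -(ltr_rat R).
move=> [q' n] [/= hq Nn]; exists c' => //.
rewrite lerBrDr -lerBrDl; apply: ltW; exact: (hN n Nn).
Qed.

(* The set where the bound is attained is open: cone_circle bounds the value at
   the centre of a disc by the mean of the values on a circle, up to any factor
   greater than one. *)
Lemma bound_open q : (forall c : rat, ratr c < bound -> ~ transfer c q) -> 1 < bound ->
  \forall q1 \near q, forall c : rat, ratr c < bound -> ~ transfer c q1.
Proof.
move=> hq b1; have [i [r r0 qd]] := chart_disc_exists q; have [qi _] := qd.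
have n1 : \forall q1 \near q, chart_rad i q q1 < r.
  by apply: (near_chart_rad qi (P := [set x | x < r])); apply: lt_nbhsl; rewrite chart_rad_self.
apply: filterS2 n1 (near_chart_dom qi) => q1 q1r q1i c1 c1b hc1.
have [c2 /andP[c12 c2b]] := rat_between c1b.
have hc2 : \forall q' \near q1, transfer c2 q'.
  by apply: transfer_near hc1; rewrite -(ltr_rat R).
pose a : C := coordi i q1 - coordi i q.
have [a0|a0] := eqVneq a 0.
  apply: (hq c1 c1b); suff -> : q = q1 by [].
  by apply: (coordi_inj qi q1i); apply/eqP; rewrite eq_sym -subr_eq0 -/a a0.
have A0 : 0 < cmod a by rewrite cmod_gt0.
have /nbhs_n1P[d d0 hd] : nbhs (chart i q1) (fun v => transfer c2 (chart_inv i v)).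
  exact: (near_chart_inv q1i hc2).
have [k0 hk0] := rootu_arc (divr_gt0 d0 A0).
have kap0 : 0 < (2 ^+ k0 : R)^-1 by rewrite invr_gt0 exprn_gt0.
pose kap : rat := (2 ^+ k0)^-1.
have kapE : ratr kap = (2 ^+ k0 : R)^-1 by rewrite /kap fmorphV rmorphXn /= ratr_nat.
(* On an arc of proportion [kap] around [q1] the constant [c2 < bound] is available, elsewhere only
   [c3] just above [bound]; [c3] is so close to [bound] that the mean [v] remains below it. *)
have [c3 /andP[c3b c3u]] : exists c3 : rat, bound < ratr c3 <
    bound + (2 ^+ k0)^-1 * (bound - ratr c2).
  by apply: rat_between; rewrite ltrDl mulr_gt0// subr_gt0.
pose v := kap * c2 + (1 - kap) * c3.
have vb : ratr v < bound.
  have -> : ratr v = ratr kap * ratr c2 + (1 - ratr kap) * ratr c3 :> R.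
    by rewrite /v rmorphD !rmorphM rmorphB rmorph1.
  rewrite kapE.
  have : (2 ^+ k0)^-1 * (ratr c3 - bound) > 0 :> R by rewrite mulr_gt0// subr_gt0.
  by move: c3u; lra.
have c20 : 0 < c2.
  have h : transfer c2 q1 by exact: nbhs_singleton hc2.
  exact: transfer_gt0 h.
have c30 : 0 < c3 by exact: transfer_gt0 (transfer_above q c3b).
have kp0 : 0 < kap by rewrite invr_gt0 exprn_gt0.
have kp1 : kap <= 1 by rewrite invf_le1 ?exprn_gt0// exprn_ege1// ler1n.
have v0 : 0 < v.
  by rewrite /v ltr_pwDl ?mulr_gt0// mulr_ge0 ?subr_ge0// ltW.
have rv0 : 0 < ratr v :> R by rewrite -(rmorph0 (ratr : rat -> R)) ltr_rat.
(* The factor lost in [cone_circle], close enough to 1 for [c * v] to stay below [bound]. *)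
have [c /andP[cl cu]] : exists c : rat, (1 : R) < ratr c < bound / ratr v.
  by apply: rat_between; rewrite ltr_pdivlMr// mul1r.
have c1' : 1 < c by rewrite -(ltr_rat R) rmorph1.
have cvb : ratr (c * v) < bound by rewrite rmorphM /= -ltr_pdivlMr.
apply: (hq _ cvb).
have [K hK] := cone_circle qd a0 q1r c1'.
pose k := maxn k0 K; have k0k : (k0 <= k)%N by rewrite leq_maxl.
have h1 := hK k (leq_maxr _ _).
pose N := (2 ^ k)%N; pose n := (2 ^ (k - k0))%N.
pose pt j := chart_pt i (coordi i q + a * rootu k ^+ j).
pose cc j := if (j < n)%N then c2 else c3.
have htr j : transfer (cc j) (pt j).
  rewrite /cc; case: ifP => jn; last exact: transfer_above.
  apply: hd; rewrite /n1 big_ord1 !mxE -/(coordi i q1).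
  have -> : coordi i q + a * rootu k ^+ j - coordi i q1 = a * (rootu k ^+ j - 1).
    by rewrite /a; ring.
  by rewrite cmodM mulrC -ltr_pdivlMr//; exact: hk0.
have h2 : cone (fun s => \sum_(j < N) (cc j * pmass p s - pmass (pt j) s)).
  by apply: cone_sum => j; exact: htr.
have NR : (N%:R : rat) != 0 by rewrite pnatr_eq0 -lt0n expn_gt0.
have nN : (n <= N)%N by rewrite leq_pexp2l// leq_subr.
have sumcc : \sum_(j < N) cc j = N%:R * v.
  rewrite -(big_mkord xpredT) (big_cat_nat (n := n))//=.
  rewrite big_nat (eq_bigr (fun=> c2)); last by move=> j /andP[_ jn]; rewrite /cc jn.
  rewrite -big_nat sumr_const_nat subn0.
  rewrite big_nat (eq_bigr (fun=> c3)); last first.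
    by move=> j /andP[nj _]; rewrite /cc ltnNge nj.
  rewrite -big_nat sumr_const_nat -[c2 *+ n]mulr_natl -[c3 *+ _]mulr_natl natrB//.
  have nE : n%:R = N%:R * kap :> rat.
    rewrite /n /N /kap -{2}(subnK k0k) expnD natrM !natrX mulfK// expf_neq0//.
  by rewrite nE /v; ring.
have cN0 : 0 <= c / N%:R by rewrite divr_ge0// ltW// (lt_trans ltr01).
apply: cone_ext (coneD (coneZ cN0 h2) h1) => s.
rewrite sumrB -mulr_suml sumcc -/N; set X := \sum_(j < N) _.
by field.
Qed.

Lemma transfer_all (c : rat) q : 1 < c -> transfer c q.
Proof.
move=> c1; apply: transfer_above; apply: (@le_lt_trans _ _ 1); last first.
  by rewrite -(rmorph1 (ratr : rat -> R)) ltr_rat.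
rewrite leNgt; apply/negP => b1.
have [q0 hq0] := bound_attained.
have : forall c : rat, ratr c < bound -> ~ transfer c p.
  apply: (@connected_forall _ [set: S]
    (fun q => forall c : rat, ratr c < bound -> ~ transfer c q)) => //.
  - by exists q0.
  - by move=> a _ ha; apply: filterS (bound_open ha b1) => x hx _.
  - move=> a _ ha.
    have [c' cb hc'] : exists2 c' : rat, ratr c' < bound & transfer c' a.
      by apply: contrapT => h; apply: ha => c' cb hc'; apply: h; exists c'.
    have [c'' /andP[h1 h2]] := rat_between cb.
    have cc : c' < c'' by rewrite -(ltr_rat R).
    by apply: filterS (transfer_near cc hc') => x hx _ /(_ c'' h2).
move=> /(_ 1); rewrite rmorph1 => /(_ b1); apply.
by apply: cone_ext (@cone0 R S) => s; ring.
Qed.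

End Source.

(** Positive masses are gathered at [p] at the cost of a factor [c], negative ones at the cost of
    [1 / c]. With [c] close to 1, a negative degree would put a negative multiple of [p] in the
    cone. *)
Lemma cone_degree (p : S) (l : seq S) (e : S -> rat) :
  cone (fun s => \sum_(t <- l) e t * pmass t s) -> 0 <= \sum_(t <- l) e t.
Proof.
move=> hE; rewrite leNgt; apply/negP => neg.
pose pos t : rat := Num.max (e t) 0; pose ngt t : rat := Num.max (- e t) 0.
have posE t : e t = pos t - ngt t.
  by rewrite /pos /ngt; case: (leP (e t) 0) => h; case: (leP (- e t) 0) => h'; move: h h'; lra.
have pos0 t : 0 <= pos t by rewrite le_max lexx orbT.
have ngt0 t : 0 <= ngt t by rewrite le_max lexx orbT.
pose P := \sum_(t <- l) pos t; pose N := \sum_(t <- l) ngt t.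
have P0 : 0 <= P by apply: sumr_ge0.
have PN : P < N.
  have : \sum_(t <- l) e t = P - N by rewrite -sumrB; apply: eq_bigr => t _.
  by move: neg; lra.
have N0 : 0 < N by exact: le_lt_trans PN.
(* Chosen so that [(1 + d)^2 * P < N]: as [d <= 1 / 4] and [P < N], the left side is at most
   [P + 9 / 4 * (d * N)], and [d * N = (N - P) / 4]. *)
pose d := (N - P) / (4 * N).
have d0 : 0 < d by rewrite divr_gt0 ?subr_gt0// mulr_gt0.
have dN : d * N = (N - P) / 4 by rewrite /d; field; rewrite gt_eqF.
have d1 : d <= 1 / 4 by rewrite -(ler_pM2r N0) dN; move: P0; lra.
pose c := 1 + d.
have c1 : 1 < c by rewrite /c; lra.
have c0 : 0 < c by lra.
have key : c * P - N / c < 0.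
  rewrite subr_lt0 ltr_pdivlMr// /c.
  have dP : d * P <= d * N by rewrite ler_pM2l// ltW.
  have ddP : d * (d * P) <= 1 / 4 * (d * N).
    exact: ler_pM (ltW d0) (mulr_ge0 (ltW d0) P0) d1 dP.
  have -> : (1 + d) * P * (1 + d) = P + 2 * (d * P) + d * (d * P) by ring.
  by move: dP ddP dN PN; lra.
have h1 : cone (fun s => \sum_(t <- l) pos t * (c * pmass p s - pmass t s)).
  apply: cone_sum => t; apply: coneZ => //; exact: (transfer_all p t c1).
have h2 : cone (fun s => \sum_(t <- l) ngt t / c * (c * pmass t s - pmass p s)).
  apply: cone_sum => t; apply: coneZ; last exact: (transfer_all t p c1).
  by rewrite divr_ge0// ltW.
apply: (@cone_neg R S (fun s => (c * P - N / c) * pmass p s) p) => //.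
- by move=> s; rewrite /pmass mulr_le0_ge0// ltW.
- by rewrite pmass_self mulr1 lt_eqF.
- apply: cone_ext (coneD (coneD h1 h2) hE) => s.
  rewrite -!big_split /= /P /N mulrBl mulr_sumr !mulr_suml -sumrB.
  by apply: eq_bigr => t _; rewrite (posE t); field; rewrite gt_eqF.
Qed.

End Transfer.

(** * Nefness *)

(** The sum of the squares of [a j * B - b j * P] is [B * (A * B - P^2)]. *)
Lemma sum_cauchy_schwarz (R : realType) (I : finType) (a b : I -> R) :
  (\sum_j a j * b j) ^+ 2 <= (\sum_j a j ^+ 2) * (\sum_j b j ^+ 2).
Proof.
set P := \sum_j a j * b j; set A := \sum_j a j ^+ 2; set B := \sum_j b j ^+ 2.
have B0 : 0 <= B by apply: sumr_ge0 => j _; exact: sqr_ge0.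
have [B1|B1] := eqVneq B 0.
  rewrite B1 mulr0 /P big1 ?expr0n// => j _.
  have /eqP : b j ^+ 2 = 0.
    by apply/(psumr_eq0P (fun j _ => sqr_ge0 (b j)) B1).
  by rewrite sqrf_eq0 => /eqP ->; rewrite mulr0.
have Bp : 0 < B by rewrite lt_def B1.
have : 0 <= \sum_j (a j * B - b j * P) ^+ 2 by apply: sumr_ge0 => j _; exact: sqr_ge0.
have E x y : \sum_j (a j * x - b j * y) ^+ 2 = A * x ^+ 2 - P * (2 * x * y) + B * y ^+ 2.
  rewrite /A /P /B !mulr_suml -sumrB -big_split /=.
  by apply: eq_bigr => j _; ring.
rewrite E (_ : _ + _ = B * (A * B - P ^+ 2)); last by ring.
by rewrite pmulr_rge0// subr_ge0.
Qed.

(** * Hermitian norm on covectors *)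

Section Normsq.
Local Open Scope sesquilinear_scope.
Context {R : realType} {r : nat}.
Local Notation C := (Cx R).
Implicit Types (l m : 'rV[C]_r).

Definition normsq l : R := \sum_j cmod (l 0 j) ^+ 2.

Definition herm l m : C := \sum_j l 0 j * (m 0 j)^*.

Lemma herm_mul l m : herm l m = (l *m m^t*) 0 0.
Proof. by rewrite mxE; apply: eq_bigr => j _; rewrite !mxE. Qed.

Lemma herm_self l : herm l l = r2c (normsq l).
Proof. by rewrite /r2c rmorph_sum; apply: eq_bigr => j _; rewrite -cmod_sqr. Qed.

Lemma normsq_unitary (A : 'M[C]_r) l : A \is unitarymx -> normsq (l *m A) = normsq l.
Proof.
move=> /unitarymxP AA; apply: (@complexI R); rewrite -/(r2c _) -/(r2c _) -!herm_self !herm_mul.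
by rewrite trmx_mul map_mxM mulmxA -(mulmxA l) AA mulmx1.
Qed.

Lemma normsqZ c l : normsq (c *: l) = cmod c ^+ 2 * normsq l.
Proof. by rewrite mulr_sumr; apply: eq_bigr => j _; rewrite mxE cmodM exprMn. Qed.

Lemma normsq_gt0 l : l != 0 -> 0 < normsq l.
Proof.
move=> l0; rewrite lt_def sumr_ge0 ?andbT => [|j _]; last exact: sqr_ge0.
apply: contra_neq l0 => /(psumr_eq0P (fun j _ => sqr_ge0 _)) h.
by apply/rowP => j; rewrite mxE; apply/eqP; rewrite -cmod_eq0 -sqrf_eq0 h.
Qed.

Lemma cmod_conj (z : C) : cmod z^* = cmod z.
Proof. by apply: (@complexI R); have := norm_conjC z; rewrite !normE. Qed.

Lemma herm_le l m : cmod (herm l m) ^+ 2 <= normsq l * normsq m.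
Proof.
apply: le_trans (sum_cauchy_schwarz _ _).
have h : cmod (herm l m) <= \sum_j cmod (l 0 j) * cmod (m 0 j).
  apply: le_trans (cmod_sum _ _ _) _; apply: ler_sum => j _.
  by rewrite cmodM cmod_conj.
by apply: lerXn2r => //; rewrite nnegrE ?cmod_ge0// sumr_ge0// => j _; rewrite mulr_ge0 ?cmod_ge0.
Qed.

End Normsq.

Section TameNormsq.
Context {R : realType} {r : nat} {S : cmanifold R 1}.
Local Notation C := (Cx R).
Variables (l : S -> 'rV[C]_r) (s : S).
Hypotheses (lh : \forall z \near s, holo_fun_at l z) (ls0 : l s != 0).

Lemma holo_coord_row j z : holo_fun_at l z -> holo_fun_at (fun w => l w 0 j) z.
Proof.
move=> hl i zi.
apply: (@differentiable_comp _ _ _ _ (l \o chart_inv i) (fun v : 'rV[C]_r => v 0 j)).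
  exact: hl.
exact: differentiable_coord.
Qed.

Lemma holo_herm m z : holo_fun_at l z -> holo_fun_at (fun w => herm (l w) m) z.
Proof.
move=> hl i zi; apply: differentiable_bigsum => j.
apply: differentiableM; last exact: differentiable_cst.
exact: (holo_coord_row j hl zi).
Qed.

Lemma normsq_continuous z : holo_fun_at l z -> {for z, continuous (fun w => normsq (l w))}.
Proof.
move=> hl; rewrite /normsq; elim: (index_enum _) => [|j t IH].
  apply: (@near_eq_continuous _ _ (fun=> 0 : R)); last exact: cst_continuous.
  by near=> w; rewrite big_nil.
apply: (@near_eq_continuous _ _ (fun w => cmod (l w 0 j) ^+ 2 + \sum_(j <- t) cmod (l w 0 j) ^+ 2)).
  by near=> w; rewrite big_cons.
apply: (@continuousD _ R^o); last exact: IH.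
have c : {for z, continuous (fun w => cmod (l w 0 j))}.
  apply: (@continuous_comp _ _ _ (fun w => l w 0 j) (@cmod R)).
    by apply: holo_continuous; exact: holo_coord_row.
  exact: cmod_continuous.
exact: (continuous_mul c c).
Unshelve. all: by end_near.
Qed.

(* By Cauchy-Schwarz, |<l z, l s>|^2 / |l s|^2 supports |l z|^2 at s from below. *)
Lemma tame_normsq : tame (fun z => normsq (l z)) s.
Proof.
have N0 := normsq_gt0 ls0; split => //.
  by apply: filterS lh => z; exact: normsq_continuous.
exists 1%N, (fun z => herm (l z) (l s) ^+ 2 * r2c (normsq (l s))^-1); split => //.
- apply: pholoM; last exact: pholo_cst.
  apply: pholoX; apply: holo_pholo.
  by apply: filterS lh => z; exact: holo_herm.
- rewrite cmodM cmodX herm_self !cmod_r2c gtr0_norm// gtr0_norm ?invr_gt0// expr1.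
  by rewrite expr2 mulfK// gt_eqF.
- near=> z; rewrite cmodM cmodX cmod_r2c gtr0_norm ?invr_gt0// expr1.
  by rewrite ler_pdivrMr//; exact: herm_le.
Unshelve. all: by end_near.
Qed.

End TameNormsq.

(** * The norm of a meromorphic section along a curve *)

Section Nef.
Context {R : realType} {n r : nat} {Mt M : cmanifold R n}.
Variables (q : Mt -> M) (x0 : M) (y0 : Mt).
Hypotheses (quc : universal_covering q) (hy0 : q y0 = x0).
Variable rho : @unitary_rep R M x0 r.
Local Notation C := (Cx R).
Local Notation V := (flat_bundle q y0 rho).
Local Notation Point := (Mt * 'rV[C]_r)%type.

Section SectionNorm.
Context {S : cmanifold R 1}.
Variables (f : S -> set Point) (sigma : S -> Point -> C) (D : S -> int).
Hypothesis hf : @holo_to_Proj R n r V S f.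
Hypothesis hD : @mero_section_divisor R n r V S f sigma D.

Let normq z (p : Point) : R := normsq p.2 / cmod (sigma z p) ^+ 2.

Lemma Proj_point_self (p : Point) : @Proj_point R n r V p p.
Proof.
exists 1%:M, 1; split; [exact: glue_refl|exact: oner_neq0|].
by rewrite mulmx1 scale1r.
Qed.

(** The scalar cancels by homogeneity, and the gluing matrix disappears because it is unitary. *)
Lemma section_norm_invariant z (p p' : Point) : f z = @Proj_point R n r V p ->
  f z = @Proj_point R n r V p' -> normq z p = normq z p'.
Proof.
move=> fp fp'; have [hs hg _ _] := hD.
have : f z p' by rewrite fp'; exact: Proj_point_self.
rewrite {1}fp => -[A [c [gA c0 e]]].
case: p => y l in fp gA e *; case: p' => y' l' in fp' gA e *; rewrite /= in gA e.
have fp1 : f z (y', l') by rewrite fp'; exact: Proj_point_self.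
have fp2 : f z (y, l' *m A).
  rewrite fp; exists 1%:M, c; split => //; first exact: glue_refl.
  by rewrite mulmx1.
rewrite /normq /= e hs// (hg _ _ _ _ _ gA fp1) normsqZ cmodM exprMn.
rewrite (normsq_unitary _ (glue_unitary quc hy0 gA)).
by rewrite -mulf_div divff ?mul1r// expf_neq0// cmod_eq0.
Qed.

(** The weight uses at each [z] a lift chosen at that point; by invariance, one holomorphic lift
    near [s] replaces them all. The divisor is doubled because the norm is squared. *)
Lemma section_divisor_psubh : psubh (fun s => D s *+ 2).
Proof.
have [_ _ ho /finite_seqP[t ht]] := hD.
pose lift s := projT1 (cid (hf s)).
have liftP s : @local_lift R n r V S f (lift s) s := projT2 (cid (hf s)).
exists (fun z => normq z (lift z z)) => s; split.
  apply: filterS (dnear_notin s t) => z zt; suff -> : D z = 0 by rewrite mul0rn.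
  apply: contrapT => /eqP Dz; have : [set` t] z by rewrite -ht.
  by rewrite /= (negPf zt).
pose e := lift s; have he := liftP s.
have [i si [h [hh h0 hE]]] := ho _ _ he.
have [u [up u0 uE]] := coordi_ratio si.
(* Passage from the chart supplied by [mero_order] to the chosen uniformizer. *)
pose g z := u z ^ D s * h z.
have gp : pholo g s by apply: pholoM; [exact: pholoXz|exact: holo_pholo].
have g0 : g s != 0 by rewrite mulf_neq0// expfz_neq0.
have tN : tame (fun z => normsq (e z).2) s.
  apply: tame_normsq; first by apply: filterS he => z [].
  by have [] := nbhs_singleton he.
have tg : tame (fun z => cmod ((g z)^-1 ^+ 2)) s.
  apply: tame_cmod; first by apply: pholoX; exact: pholoV.
  by rewrite expf_neq0// invr_neq0.
exists (fun z => normsq (e z).2 * cmod ((g z)^-1 ^+ 2)); split; first exact: tame_mul.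
have n1 := nbhs_dnbhs he; have n2 := nbhs_dnbhs uE.
have n12 : \forall z \near s^', f z = @Proj_point R n r V (e z) /\
    sigma z (e z) = unif s z ^ D s * g z.
  apply: filterS3 n1 n2 hE => z [_ _ _ fz] uz ->; split => //.
  by rewrite -/(coordi i z) -/(coordi i s) uz expfzMl mulrA.
apply: filterS2 n12 (near_unif_neq0 s) => z [fz sz] uz0.
have [_ _ _ fz'] := nbhs_singleton (liftP z).
rewrite (section_norm_invariant fz' fz) /normq sz cmodX cmodV cmodM exprMn invfM.
rewrite mulrCA mulrC exprVn; congr (_ * _).
rewrite cmodXz exprnP exprz_exp invr_expz; congr (exprz _ _).
by rewrite mulr2n; ring.
Qed.

Lemma section_degree_ge0 : [set: S] !=set0 -> connected [set: S] -> compact [set: S] ->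
  0 <= \sum_(s \in [set: S]) D s.
Proof.
move=> [p _] Sconn Scomp; have [_ _ _ fin] := hD.
rewrite -(fsbig_widen [set s | D s != 0] setT) //; last first.
  by move=> s [_ /= /negP]; rewrite negbK => /eqP.
rewrite fsbig_finite//=; set l := (X in \sum_(t <- X) _).
have lu : uniq l by exact: finmap.fset_uniq.
have lP s : (s \in l) = (D s != 0) by rewrite in_fset_set//; apply/idP/idP; rewrite inE.
have : cone (fun s => \sum_(t <- l) (D t)%:~R * pmass t s).
  apply: (@cone_ext _ _ (fun s => (D s)%:~R : rat)); last first.
    exists 2%N; split => //; exists (fun s => D s *+ 2); first exact: section_divisor_psubh.
    by move=> s; rewrite -[LHS]/((_ *+ 2)%:~R) rmorphMn /= -mulr_natl.
  move=> s; have [sl|sl] := boolP (s \in l).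
    rewrite (bigD1_seq s) //= big1 ?addr0 ?pmass_self ?mulr1// => t ts.
    by rewrite /pmass eq_sym (negPf ts) mulr0.
  rewrite big_seq big1 => [|t tl]; last first.
    by rewrite /pmass; case: eqP => [st|]; [rewrite st tl in sl|rewrite mulr0].
  by move: sl; rewrite lP negbK => /eqP ->.
move=> /(cone_degree Sconn Scomp p).
by rewrite -rmorph_sum ler0z.
Qed.

End SectionNorm.

Lemma flat_nef : nef V.
Proof.
move=> S f [[S0 Sconn] Scomp hf _] d [sigma [D [hD ->]]].
exact: section_degree_ge0 hf hD S0 Sconn Scomp.
Qed.

End Nef.

Theorem theorem9 (R : realType) (n r : nat)
    (M : cmanifold R n) (hM : projective_manifold M)
    (Mt : cmanifold R n) (q : Mt -> M) (hq : universal_covering q)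
    (x0 : M) (y0 : Mt) (hy0 : q y0 = x0)
    (rho : @unitary_rep R M x0 r) :
  nef (flat_bundle q y0 rho) /\
  (semi_ample (flat_bundle q y0 rho) <-> finite_set (rep_image rho)).
Proof.
have [_ _ Mc _] := hM; split; first exact: flat_nef.
by split; [exact: semi_ample_finite|exact: finite_semi_ample].
Qed.
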